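(* Let $P,Q,A_1,\dots,A_r,B_1,\dots,B_s\in\mathbb{C}^{N\times N}$ be pairwise commuting matrices such that $\Re(P)>0$, $\Re(Q)>0$ and $A_i+\ell I$, $B_j+\ell I$ are invertible for all integers $\ell\ge0$, $1\le i\le r$, $1\le j\le s$. Let $x>0$ and $y,z\in\mathbb{C}$. Then $${}_{r}E_{s}\left[(x,P,Q;y+z)\left|\begin{matrix}A_1,\dots,A_r\\ B_1,\dots,B_s\end{matrix}\right.\right]=\Gamma(B_1)\cdots\Gamma(B_s)\Gamma^{-1}(A_1)\cdots\Gamma^{-1}(A_r)\sum_{\ell=0}^\infty\Gamma(A_1+\ell I)\cdots\Gamma(A_r+\ell I)\,\Gamma^{-1}(B_1+\ell I)\cdots\Gamma^{-1}(B_s+\ell I)\,\frac{z^\ell}{\ell!}\;{}_{r}E_{s}\left[(x,P,\ell P+Q;y)\left|\begin{matrix}A_1+\ell I,\dots,A_r+\ell I\\ B_1+\ell I,\dots,B_s+\ell I\end{matrix}\right.\right].$$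
   Context: $I$ is the identity matrix in $\mathbb{C}^{N\times N}$; $t^{M}=\exp(M\ln t)$ for $t>0$; $\Re(M)>0$ means that every eigenvalue of $M$ has positive real part. $\Gamma^{-1}(M)$ is the entire function $1/\Gamma$ applied to $M$ (holomorphic functional calculus); if $M+\ell I$ is invertible for all integers $\ell\ge0$, it is invertible with inverse $\Gamma(M)$. For $x>0$, $\Gamma(M,x)=\int_x^\infty u^{M-I}e^{-u}du$. Pochhammer symbol: $(M)_0=I$, $(M)_\ell=M(M+I)\cdots(M+(\ell-1)I)$. The generalized incomplete exponential matrix function is $${}_rE_s\left[(x,P,Q;z)\left|\begin{matrix}A_1,\dots,A_r\\ B_1,\dots,B_s\end{matrix}\right.\right]=\sum_{\ell=0}^\infty \frac{z^\ell}{\ell!}\prod_{i=1}^r(A_i)_\ell\Big[\prod_{j=1}^s(B_j)_\ell\Big]^{-1}\Gamma(\ell P+Q,x)\Gamma^{-1}(\ell P+Q).$$ The identity is understood for those $y,z\in\mathbb{C}$ for which the series involved converge. *)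

(* Defs.v *)
From HB Require Import structures.
From mathcomp Require Import all_boot all_order all_algebra.
From mathcomp Require Import all_classical all_reals all_analysis.
From mathcomp Require Export complex.
Set Implicit Arguments.
Unset Strict Implicit.
Unset Printing Implicit Defensive.
Import Order.TTheory GRing.Theory Num.Theory.
Import numFieldNormedType.Exports.
Local Open Scope classical_set_scope.
Local Open Scope complex_scope.
Local Open Scope ring_scope.

(* R[i] with the topology of its modulus; 'M[R[i]]_(m, n) then carries the
   topology of entrywise convergence. *)
#[non_forgetful_inheritance]
HB.instance Definition _ (R : rcfType) := NormedModule.copy R[i] R[i]^o.

Section ScalarFunctions.
Variable R : realType.

Definition cexp (z : R[i]) : R[i] :=
  (expR (complex.Re z))%:C * (cos (complex.Im z) +i* sin (complex.Im z)).

(* The entire function 1/Gamma, by Gauss's formula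
   Gamma(z) = lim_n n! n^z / (z (z + 1) ... (z + n)). *)
Definition rgamma (z : R[i]) : R[i] :=
  limn (fun n : nat =>
    (\prod_(k < n.+1) (z + k%:R)) / (n`!%:R * cexp (z * (ln n%:R)%:C))).

Definition cintegral (D : set R) (f : R -> R[i]) : R[i] :=
  (\int[lebesgue_measure]_(t in D) complex.Re (f t))
  +i* (\int[lebesgue_measure]_(t in D) complex.Im (f t)).

End ScalarFunctions.

Section MatrixFunctions.
Variables (R : realType) (N : nat).
Local Notation MC := 'M[R[i]]_N.+1.
Implicit Types (M P Q : MC) (A B : seq MC).

Definition mxintegral (D : set R) (F : R -> MC) : MC :=
  \matrix_(i, j) cintegral D (fun t => F t i j).

Definition mxexp M : MC :=
  limn (series (fun k : nat => k`!%:R^-1 *: M ^+ k)).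

Definition rpowmx (t : R) M : MC := mxexp ((ln t)%:C *: M).

(* \oint F(w) dw over the circle |w| = rho, with w = rho e^(i theta) and
   dw = i w dtheta. *)
Definition circle_integral (rho : R) (F : R[i] -> MC) : MC :=
  mxintegral `[0, 2 * pi] (fun theta : R =>
    let w := rho%:C * cexp (theta *i) in ('i%C * w) *: F w).

(* A radius exceeding the modulus of every eigenvalue of M. *)
Definition enclosing_radius M : R :=
  1 + \sum_i \sum_j complex.Re `|M i j|.

(* The Riesz-Dunford functional calculus
   f(M) = (2 pi i)^-1 \oint f(w) (w I - M)^-1 dw, for f an entire function. *)
Definition holomorphic_calculus (f : R[i] -> R[i]) M : MC :=
  ((2 * pi)%:C * 'i%C)^-1 *:
    circle_integral (enclosing_radius M) (fun w => f w *: (w%:M - M)^-1).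

Definition rgammamx M : MC := holomorphic_calculus (@rgamma R) M.

(* Meaningful when M + l I is invertible for every natural number l. *)
Definition gammamx M : MC := (rgammamx M)^-1.

Definition incgammamx M (x : R) : MC :=
  mxintegral `[x, +oo[ (fun u : R => (expR (- u))%:C *: rpowmx u (M - 1%:M)).

Definition pochmx M (l : nat) : MC := \prod_(k < l) (M + k%:R%:M).

(* Re(M) > 0 *)
Definition positive_stable M : Prop :=
  forall a : R[i], eigenvalue M a -> 0 < complex.Re a.

Definition shiftmx (l : nat) A : seq MC := [seq M + l%:R%:M | M <- A].

(* In rEs, the numbers of parameters are r = size A and s = size B. *)
Definition incexp_term (x : R) P Q A B (z : R[i]) (l : nat) : MC :=
  (z ^+ l / l`!%:R) *:
    ((\prod_(M <- A) pochmx M l) * (\prod_(M <- B) pochmx M l)^-1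
     * incgammamx (l%:R *: P + Q) x * rgammamx (l%:R *: P + Q)).

Definition incexp_cvg (x : R) P Q A B (z : R[i]) : Prop :=
  cvgn (series (incexp_term x P Q A B z)).

Definition incexp (x : R) P Q A B (z : R[i]) : MC :=
  limn (series (incexp_term x P Q A B z)).

End MatrixFunctions.

(* Main.v *)
(* Put G_n = Gamma(nP + Q, x) Gamma^-1(nP + Q), let d_n be the quotient of the
   products of the (A_i)_n and of the (B_j)_n, and let a_n = d_n G_n / n!.
   The l-th inner series is l! d_l^-1 b_l, where b_l is the l-th Taylor
   coefficient at y of f(w) = sum_n a_n w^n, and the factors Gamma(A_i + l),
   Gamma^-1(B_j + l) together with the prefactor amount to d_l.  So the theorem
   says that f(y + z) is the sum of the Taylor series of f at y, as soon as
   both series converge.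

   If y lies inside the disk of convergence of f, the two sides agree on the
   segment from y towards y + z by analytic continuation, and at its end point
   by Abel's theorem.

   That y lies inside has to be extracted from the convergence of the inner
   series, which is where Re(P) > 0 enters: in a norm for which 1 - hP is a
   strict contraction, Gamma^-1(nP + Q) decays faster than any geometric
   sequence, hence G_n -> I, and the radius of convergence of f is governed by
   the growth of d_n.  It is infinite for r <= s and at least 1 for r = s + 1.
   In the remaining cases (r = s + 1 and |y| >= 1, or r >= s + 2 and y <> 0),
   the growth of d_n^-1 contradicts the convergence of some inner series.  For
   y = 0 nothing has to be proved.

   On matrices, 1/Gamma is computed by Gauss's product: it converges uniformly
   on bounded sets, so the contour integral, which is explicit on polynomials,
   has the same value. *)

Require Import Defs.
From mathcomp Require Import all_boot all_order all_algebra.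
From mathcomp Require Import all_classical all_reals all_analysis.
From mathcomp Require Import measurable_realfun spectral.
From mathcomp Require Import ring lra zify.
Import Order.TTheory GRing.Theory Num.Theory.
Import numFieldNormedType.Exports.
Local Open Scope classical_set_scope.
Local Open Scope ring_scope.
Set Implicit Arguments.
Unset Strict Implicit.
Unset Printing Implicit Defensive.

(** * Norms and limits of matrices *)

(** Convergence at y alone bounds the coefficients at the modulus of y only, whereas re-expansion
    needs a strictly larger radius. For r = s + 1 and |y| = 1 a single inner series may well
    converge; but the terms of the l-th one carry a further factor of order n^l, so they cannot all
    converge. This is why the radius argument draws on every l.

    Matrix norms bound products from above only. A lower bound on d_n comes from 1 <= |d_n| |d_n^-1|
    and an upper bound on d_n^-1. Of G_n -> I only |I - G_n| <= 1/2 for large n is used: it makes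
    |d_n| and |d_n G_n| comparable.

    No integral down to 0 is formed. Integrating (1 - t/n)^n t^(M - I) over [x, n] by parts gives
    Gauss's approximation of Gamma(M) minus a finite sum; in the limit, I - Gamma(M, x) Gamma^-1(M)
    is at most |x^M| e^x |Gamma^-1(M)| in norm once the inverse of (M)_(j+1) is at most 1/j! for
    every j.

    The end point y + z may lie on the circle of convergence of f, and z on that of the Taylor
    series. A segment issuing from an interior point stays in a Stolz angle, which is what Abel's
    theorem asks for. *)

Section ComplexModulus.
Variable R : realType.
Implicit Types (z w : R[i]) (a : R).

(** The norm of [R[i]] takes its values in [R[i]] itself, with its partial order; the estimates want
    a real number. *)
Definition cmod z : R := ComplexField.Normc.normc z.

Lemma cmodE z : `|z| = (cmod z)%:C%C. Proof. by []. Qed.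

Lemma cmod_ge0 z : 0 <= cmod z.
Proof. by case: z => x y; rewrite /cmod /= sqrtr_ge0. Qed.

Lemma cmodM z w : cmod (z * w) = cmod z * cmod w.
Proof. exact: ComplexField.Normc.normcM. Qed.

Lemma cmod0 : cmod 0 = 0. Proof. exact: ComplexField.Normc.normc0. Qed.
Lemma cmod1 : cmod 1 = 1. Proof. exact: ComplexField.Normc.normc1. Qed.

Lemma cmod_eq0 z : cmod z = 0 -> z = 0.
Proof. exact: ComplexField.Normc.eq0_normc. Qed.

Lemma cmodV z : cmod z^-1 = (cmod z)^-1.
Proof. exact: ComplexField.Normc.normcV. Qed.

Lemma cmodD z w : cmod (z + w) <= cmod z + cmod w.
Proof. exact: le_normcD. Qed.

Lemma cmodN z : cmod (- z) = cmod z.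
Proof. exact: normcN. Qed.

Lemma cmodX z n : cmod (z ^+ n) = cmod z ^+ n.
Proof. by elim: n => [|n IH]; rewrite ?expr0 ?cmod1 // !exprS cmodM IH. Qed.

Lemma cmod_real a : cmod a%:C%C = `|a|.
Proof. by rewrite /cmod /= expr0n /= addr0 sqrtr_sqr. Qed.

Lemma cmod_nat n : cmod n%:R = n%:R.
Proof. by rewrite -(rmorph_nat (real_complex R)) cmod_real ger0_norm. Qed.

Lemma cmod_Re z : `|complex.Re z| <= cmod z.
Proof.
case: z => x y; rewrite /cmod /= -sqrtr_sqr ler_sqrt ?addr_ge0 ?sqr_ge0 //.
by rewrite lerDl sqr_ge0.
Qed.

Lemma cmod_Im z : `|complex.Im z| <= cmod z.
Proof.
case: z => x y; rewrite /cmod /= -sqrtr_sqr ler_sqrt ?addr_ge0 ?sqr_ge0 //.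
by rewrite lerDr sqr_ge0.
Qed.

Lemma cmod_ReIm z : cmod z <= `|complex.Re z| + `|complex.Im z|.
Proof.
case: z => x y; rewrite /cmod /=.
rewrite -[leRHS]ger0_norm ?addr_ge0 // -sqrtr_sqr ler_sqrt ?sqr_ge0 //.
rewrite sqrrD !real_normK ?num_real // lerD2r lerDl.
by rewrite mulrn_wge0 // mulr_ge0.
Qed.

Lemma cmod_sum (I : Type) (r : seq I) (P : pred I) (F : I -> R[i]) :
  cmod (\sum_(i <- r | P i) F i) <= \sum_(i <- r | P i) cmod (F i).
Proof.
elim/big_ind2 : _ => //; first by rewrite cmod0.
by move=> x1 x2 y1 y2 h1 h2; apply: (le_trans (cmodD _ _)); apply: lerD.
Qed.

End ComplexModulus.

(* The submultiplicative norms on square complex matrices, all equivalent to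
   the entrywise one.  The contour estimates need the maximal row sum, the
   asymptotics of the incomplete gamma ratio a norm adapted to P. *)
Record algnorm (R : realType) (N : nat) := AlgNorm {
  nu :> 'M[R[i]]_N.+1 -> R;
  nuD : forall X Y : 'M[R[i]]_N.+1, nu (X + Y) <= nu X + nu Y;
  nuZ : forall (c : R[i]) (X : 'M[R[i]]_N.+1), nu (c *: X) = cmod c * nu X;
  nuM : forall X Y : 'M[R[i]]_N.+1, nu (X * Y) <= nu X * nu Y;
  nu1 : nu 1 = 1;
  nu_entry : exists2 c : R, 0 <= c &
    forall (X : 'M[R[i]]_N.+1) i j, cmod (X i j) <= c * nu X }.

Section AlgNorm.
Variables (R : realType) (N : nat).
Local Notation MC := 'M[R[i]]_N.+1.
Implicit Types (v : algnorm R N) (X Y : MC).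

Lemma nu0 v : v 0 = 0.
Proof. by rewrite -(scale0r (0 : MC)) nuZ cmod0 mul0r. Qed.

Lemma nuN v X : v (- X) = v X.
Proof. by rewrite -scaleN1r nuZ cmodN cmod1 mul1r. Qed.

Lemma nuB v X Y : v (X - Y) <= v X + v Y.
Proof. by rewrite -(nuN v Y); exact: nuD. Qed.

Lemma nu_ge0 v X : 0 <= v X.
Proof.
have := nuB v X X; rewrite subrr nu0 -mulr2n -mulr_natl.
by rewrite pmulr_rge0.
Qed.

Lemma nu_subC v X Y : v (X - Y) = v (Y - X).
Proof. by rewrite -(nuN v (Y - X)) opprB. Qed.

Lemma nu_dist v X Y : v X <= v Y + v (X - Y).
Proof. by rewrite -{1}(subrK Y X) addrC; apply: nuD. Qed.

Lemma nu_eq0 v X : v X = 0 -> X = 0.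
Proof.
have [c c0 H] := nu_entry v => X0; apply/matrixP => i j; rewrite mxE.
apply: cmod_eq0; apply/eqP; rewrite eq_le cmod_ge0 andbT.
by have := H X i j; rewrite X0 mulr0.
Qed.

Lemma nu_sum v (I : Type) (r : seq I) (P : pred I) (F : I -> MC) :
  v (\sum_(i <- r | P i) F i) <= \sum_(i <- r | P i) v (F i).
Proof.
elim/big_ind2 : _ => //; first by rewrite nu0.
by move=> x1 x2 y1 y2 h1 h2; apply: (le_trans (nuD _ _ _)); apply: lerD.
Qed.

Lemma nu_prod v (I : Type) (r : seq I) (P : pred I) (F : I -> MC) :
  v (\prod_(i <- r | P i) F i) <= \prod_(i <- r | P i) v (F i).
Proof.
suff : 0 <= v (\prod_(i <- r | P i) F i) <= \prod_(i <- r | P i) v (F i).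
  by case/andP.
elim/big_ind2 : _ => //; first by rewrite nu1 ler01 lexx.
  move=> x1 x2 y1 y2 /andP[a1 a2] /andP[b1 b2]; rewrite nu_ge0 /=.
  by apply: (le_trans (nuM _ _ _)); apply: ler_pM.
by move=> i _; rewrite nu_ge0 lexx.
Qed.

Lemma nuX v X n : v (X ^+ n) <= v X ^+ n.
Proof.
elim: n => [|n IH]; first by rewrite !expr0 nu1.
rewrite !exprS; apply: (le_trans (nuM _ _ _)); apply: ler_pM => //.
all: exact: nu_ge0.
Qed.

Lemma nu_scalar v (c : R[i]) : v c%:M = cmod c.
Proof. by rewrite -scalemx1 nuZ nu1 mulr1. Qed.

(** With [nu_entry], this makes every [algnorm] equivalent to the entrywise supremum, so convergence
    does not depend on the norm chosen. *)
Lemma nu_upper v :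
  exists2 c, 0 <= c & forall X d, (forall i j, cmod (X i j) <= d) -> v X <= c * d.
Proof.
exists (\sum_i \sum_j v (delta_mx i j)).
  by apply: sumr_ge0 => i _; apply: sumr_ge0 => j _; exact: nu_ge0.
move=> X d H; rewrite (matrix_sum_delta X) mulr_suml.
apply: (le_trans (nu_sum _ _ _ _)); apply: ler_sum => i _; rewrite mulr_suml.
apply: (le_trans (nu_sum _ _ _ _)); apply: ler_sum => j _.
by rewrite nuZ mulrC ler_wpM2l ?nu_ge0.
Qed.

Lemma near_ord (I : finType) (P : I -> nat -> Prop) :
  (forall i, \forall n \near \oo, P i n) -> \forall n \near \oo, forall i, P i n.
Proof. by move=> H; apply: filter_forall. Qed.

Lemma cvg_mx_entryP (u : nat -> MC) (L : MC) :
  u @ \oo --> L <->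
  forall i j, (fun n => cmod (u n i j - L i j)) @ \oo --> (0 : R).
Proof.
split=> [/cvg_ballP H i j|H].
  apply/cvgrPdist_lt => e e0.
  have e0' : (0 : R[i]) < e%:C%C by rewrite ltcR.
  near=> n.
  rewrite sub0r normrN ger0_norm ?cmod_ge0 //.
  have: ball L e%:C%C (u n) by near: n; exact: H.
  case=> _ /(_ i j); rewrite /ball /= /ball_ /=.
  by rewrite cmodE ltcR -cmodN opprB.
apply/cvg_ballP => e e0.
(* Positivity in [R[i]] forces a zero imaginary part, so a radius is a real number. *)
have [e' e'0 ee'] : exists2 e' : R, 0 < e' & e = e'%:C%C.
  case: e e0 => a b; rewrite ltcE /= => /andP[/eqP -> a0].
  by exists a.
rewrite ee'; near=> n.
split=> [|i j]; first by rewrite ltcR.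
rewrite /ball /= /ball_ /= cmodE ltcR -cmodN opprB.
suff: forall i j, cmod (u n i j - L i j) < e' by [].
near: n.
apply: near_ord => i'; apply: near_ord => j'.
have /cvgrPdist_lt /(_ _ e'0) := H i' j'.
apply: filterS => n; by rewrite sub0r normrN ger0_norm ?cmod_ge0.
Unshelve. all: by end_near.
Qed.

Lemma cvg_nuP v (u : nat -> MC) (L : MC) :
  u @ \oo --> L <-> (fun n => v (u n - L)) @ \oo --> (0 : R).
Proof.
rewrite cvg_mx_entryP; split=> H.
  have [c c0 Hc] := nu_upper v.
  apply/cvgrPdist_le => e e0.
  have e0' : 0 < e / (c + 1) by rewrite divr_gt0 // ltr_wpDl.
  have K : \forall n \near \oo, forall i j, cmod (u n i j - L i j) < e / (c + 1).
    apply: near_ord => i'; apply: near_ord => j'.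
    have /cvgrPdist_lt /(_ _ e0') := H i' j'.
    by apply: filterS => n; rewrite sub0r normrN ger0_norm ?cmod_ge0.
  near=> n.
  rewrite sub0r normrN ger0_norm ?nu_ge0 //.
  have : v (u n - L) <= c * (e / (c + 1)).
    apply: Hc => i j; rewrite !mxE; apply: ltW.
    have := near K n; apply => //.
  move=> /le_trans; apply.
  by rewrite mulrA ler_pdivrMr ?ltr_wpDl// mulrC ler_pM2l // lerDl.
have [c c0 Hc] := nu_entry v => i j.
apply: (@squeeze_cvgr _ _ _ _ (cst 0) (fun n => c * v (u n - L))).
- near=> n; rewrite cmod_ge0 /=; have := Hc (u n - L) i j; by rewrite !mxE.
- exact: cvg_cst.
- by rewrite -(mulr0 c); apply: cvgMr.
Unshelve. all: by end_near.
Qed.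

Lemma cvg_mx_unique (u : nat -> MC) (L L' : MC) :
  u @ \oo --> L -> u @ \oo --> L' -> L = L'.
Proof. by apply: cvg_unique; exact: norm_hausdorff. Qed.

Lemma cvg_mx_lim (u : nat -> MC) (L : MC) : u @ \oo --> L -> limn u = L.
Proof. by move=> h; apply: cvg_lim => //; exact: norm_hausdorff. Qed.

End AlgNorm.

Section RowNorm.
Variables (R : realType) (N : nat).
Local Notation MC := 'M[R[i]]_N.+1.

Definition max_row_sum (X : MC) : R :=
  \big[Num.max/0]_i \sum_j cmod (X i j).

Lemma le_max_row_sum (X : MC) i : \sum_j cmod (X i j) <= max_row_sum X.
Proof. exact: le_bigmax. Qed.

Lemma max_row_sum_le (X : MC) c :
  0 <= c -> (forall i, \sum_j cmod (X i j) <= c) -> max_row_sum X <= c.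
Proof. by move=> c0 H; apply: bigmax_le. Qed.

Lemma max_row_sum_ge0 (X : MC) : 0 <= max_row_sum X.
Proof.
apply: le_trans (le_max_row_sum X ord0).
by apply: sumr_ge0 => j _; exact: cmod_ge0.
Qed.

Lemma max_row_sumD (X Y : MC) :
  max_row_sum (X + Y) <= max_row_sum X + max_row_sum Y.
Proof.
apply: max_row_sum_le => [|i]; first by rewrite addr_ge0 ?max_row_sum_ge0.
apply: le_trans (lerD (le_max_row_sum X i) (le_max_row_sum Y i)).
by rewrite -big_split; apply: ler_sum => j _; rewrite mxE cmodD.
Qed.

Lemma max_row_sumZ (c : R[i]) (X : MC) :
  max_row_sum (c *: X) = cmod c * max_row_sum X.
Proof.
have H (d : R[i]) (Y : MC) : max_row_sum (d *: Y) <= cmod d * max_row_sum Y.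
  apply: max_row_sum_le => [|i]; first by rewrite mulr_ge0 ?cmod_ge0 ?max_row_sum_ge0.
  apply: le_trans (ler_wpM2l (cmod_ge0 d) (le_max_row_sum Y i)).
  by rewrite mulr_sumr; apply: ler_sum => j _; rewrite mxE cmodM.
apply/eqP; rewrite eq_le H /=.
have [->|c0] := eqVneq c 0; first by rewrite cmod0 mul0r max_row_sum_ge0.
have := H c^-1 (c *: X); rewrite scalerA mulVf // scale1r cmodV => h.
have c0' : 0 < cmod c.
  by rewrite lt_def cmod_ge0 andbT; apply: contra c0 => /eqP/cmod_eq0 ->.
by rewrite -ler_pdivlMl.
Qed.

Lemma max_row_sumM (X Y : MC) :
  max_row_sum (X * Y) <= max_row_sum X * max_row_sum Y.
Proof.
apply: max_row_sum_le => [|i]; first by rewrite mulr_ge0 ?max_row_sum_ge0.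
apply: le_trans (ler_wpM2r (max_row_sum_ge0 Y) (le_max_row_sum X i)).
rewrite mulr_suml.
apply: (@le_trans _ _ (\sum_j \sum_k cmod (X i k) * cmod (Y k j))).
  apply: ler_sum => j _; rewrite mxE; apply: le_trans (cmod_sum _ _ _) _.
  by apply: ler_sum => k _; rewrite cmodM.
rewrite exchange_big; apply: ler_sum => k _; rewrite -mulr_sumr.
by rewrite ler_wpM2l ?cmod_ge0 ?le_max_row_sum.
Qed.

Lemma max_row_sum1 : max_row_sum (1 : MC) = 1.
Proof.
have H i : \sum_j cmod ((1 : MC) i j) = 1.
  rewrite (bigD1 i) //= mxE eqxx cmod1 big1 ?addr0 // => j ji.
  by rewrite mxE eq_sym (negbTE ji) cmod0.
apply/eqP; rewrite eq_le; apply/andP; split; last by rewrite -(H ord0) le_max_row_sum.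
by apply: max_row_sum_le => // i; rewrite H.
Qed.

Lemma max_row_sum_entry : exists2 c : R, 0 <= c &
  forall (X : MC) i j, cmod (X i j) <= c * max_row_sum X.
Proof.
exists 1 => // X i j; rewrite mul1r; apply: le_trans (le_max_row_sum X i).
by rewrite (bigD1 j) //= lerDl; apply: sumr_ge0 => k _; exact: cmod_ge0.
Qed.

Definition rownorm : algnorm R N :=
  AlgNorm max_row_sumD max_row_sumZ max_row_sumM max_row_sum1 max_row_sum_entry.

Variables (v : algnorm R N) (U : MC).
Hypothesis Uu : U \in unitmx.

Let cj (X : MC) := U * X * U^-1.

Let cjM X Y : cj (X * Y) = cj X * cj Y.
Proof. by rewrite /cj !mulrA mulrVK. Qed.

Let conjD X Y : v (cj (X + Y)) <= v (cj X) + v (cj Y).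
Proof. by rewrite /cj mulrDr mulrDl nuD. Qed.

Let conjZ c X : v (cj (c *: X)) = cmod c * v (cj X).
Proof. by rewrite /cj -scalerAr -scalerAl nuZ. Qed.

Let conjM X Y : v (cj (X * Y)) <= v (cj X) * v (cj Y).
Proof. by rewrite cjM nuM. Qed.

Let conj1 : v (cj 1) = 1.
Proof. by rewrite /cj mulr1 divrr // nu1. Qed.

Let conj_entry : exists2 c : R, 0 <= c &
  forall (X : MC) i j, cmod (X i j) <= c * v (cj X).
Proof.
have [c c0 H] := nu_entry v.
exists (c * (v U^-1 * v U)); first by rewrite !mulr_ge0 ?nu_ge0.
move=> X i j; apply: le_trans (H X i j) _; rewrite -mulrA ler_wpM2l //.
have {1}-> : X = U^-1 * cj X * U by rewrite /cj !mulrA mulVr // mul1r mulrVK.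
apply: le_trans (nuM _ _ _) _; rewrite mulrAC ler_wpM2r ?nu_ge0 //.
by rewrite nuM.
Qed.

(** A change of basis keeps submultiplicativity, so a norm can be fitted to a matrix after
    triangularizing and rescaling it. *)
Definition conjnorm : algnorm R N := AlgNorm conjD conjZ conjM conj1 conj_entry.

End RowNorm.

Section AlgNormLimits.
Variables (R : realType) (N : nat).
Local Notation MC := 'M[R[i]]_N.+1.
Implicit Types (v : algnorm R N) (X Y : MC).

Lemma cvg_nu v (u : nat -> MC) (L : MC) :
  u @ \oo --> L -> (fun n => v (u n)) @ \oo --> v L.
Proof.
move=> /(cvg_nuP v) /cvgrPdist_le H; apply/cvgrPdist_le => e e0.
apply: filterS (H e e0) => n; rewrite sub0r normrN ger0_norm ?nu_ge0 // => h.
have h1 := nu_dist v (u n) L; have h2 := nu_dist v L (u n).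
rewrite (nu_subC v L) in h2.
by rewrite ler_norml; apply/andP; split; lra.
Qed.

Lemma cvg_nu_le v (u : nat -> MC) (L : MC) (c : R) :
  u @ \oo --> L -> (\forall n \near \oo, v (u n) <= c) -> v L <= c.
Proof. by move=> /(@cvg_nu v) h H; apply: (cvgr_to_le h). Qed.

Lemma cvg_mx_bounded v (u : nat -> MC) (L : MC) :
  u @ \oo --> L -> exists2 K : R, 0 <= K & forall n, v (u n) <= K.
Proof.
move=> /(@cvg_nu v) h.
have /cvg_seq_bounded [K [_ HK]] : cvgn (fun n => v (u n)) by apply/cvg_ex; exists (v L).
exists (`|K| + 1); first by rewrite addr_ge0.
move=> n; apply: le_trans (ler_norm _) (HK (`|K| + 1) _ n I).
by rewrite ltr_pwDr // ler_norm.
Qed.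

Lemma cvg_mxM (u w : nat -> MC) (L L' : MC) :
  u @ \oo --> L -> w @ \oo --> L' -> (fun n => u n * w n) @ \oo --> L * L'.
Proof.
move: (rownorm R N) => v hu hw; apply/(cvg_nuP v).
have [K K0 HK] := cvg_mx_bounded v hw.
move/(cvg_nuP v) in hu; move/(cvg_nuP v) in hw.
apply: (@squeeze_cvgr _ _ _ _ (cst 0)
  (fun n => v (u n - L) * K + v L * v (w n - L'))).
- near=> n; rewrite nu_ge0 /=.
  have -> : u n * w n - L * L' = (u n - L) * w n + L * (w n - L').
    by rewrite mulrBl mulrBr addrA subrK.
  apply: le_trans (nuD _ _ _) _; apply: lerD _ (nuM _ _ _).
  by apply: le_trans (nuM _ _ _) _; rewrite ler_wpM2l ?nu_ge0.
- exact: cvg_cst.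
- rewrite [X in _ --> X](_ : 0 = 0 * K + v L * 0); last by rewrite mul0r mulr0 addr0.
  by apply: cvgD; [apply: cvgMl|apply: cvgMr].
Unshelve. all: by end_near.
Qed.

Lemma cvg_mxMl (w : nat -> MC) X (L : MC) :
  w @ \oo --> L -> (fun n => X * w n) @ \oo --> X * L.
Proof. by move=> h; apply: cvg_mxM (cvg_cst _) h. Qed.

Lemma cvg_mxMr (w : nat -> MC) X (L : MC) :
  w @ \oo --> L -> (fun n => w n * X) @ \oo --> L * X.
Proof. by move=> h; apply: cvg_mxM h (cvg_cst _). Qed.

Lemma cvg_mxZ (w : nat -> MC) (c : R[i]) (L : MC) :
  w @ \oo --> L -> (fun n => c *: w n) @ \oo --> c *: L.
Proof.
move=> h; have e (X : MC) : c *: X = c%:M * X by rewrite -mul_scalar_mx.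
by rewrite e; under eq_fun do rewrite e; exact: cvg_mxMl.
Qed.

Lemma cvg_mxD (u w : nat -> MC) (L L' : MC) :
  u @ \oo --> L -> w @ \oo --> L' -> (fun n => u n + w n) @ \oo --> L + L'.
Proof. exact: cvgD. Qed.

Lemma cvg_mxB (u w : nat -> MC) (L L' : MC) :
  u @ \oo --> L -> w @ \oo --> L' -> (fun n => u n - w n) @ \oo --> L - L'.
Proof. exact: cvgB. Qed.

(** Weierstrass's criterion, reduced to the real and imaginary parts of the entries. The tail bound
    is kept for every n: n = 0 bounds the sum itself, n = 2 gives the quadratic remainder of the
    exponential. *)
Lemma nu_dominated_series v (u : nat -> MC) (f : nat -> R) (l : R) :
  (forall k, v (u k) <= f k) -> series f @ \oo --> l ->
  exists2 L : MC, series u @ \oo --> L & forall n, v (L - series u n) <= l - series f n.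
Proof.
move=> uf fl.
have [c c0 Hc] := nu_entry v.
have cvgf : cvgn (series (fun n => c * f n)).
  by apply: is_cvg_seriesZ; apply/cvg_ex; exists l.
have part (g : nat -> R) i j : (forall n, `|g n| <= cmod (u n i j)) -> cvgn (series g).
  move=> H; apply: normed_cvg; apply: series_le_cvg cvgf => n //.
  - by rewrite /=.
    by rewrite mulr_ge0 // (le_trans (nu_ge0 v _) (uf n)).
  by apply: le_trans (H n) _; apply: le_trans (Hc (u n) i j) _; rewrite ler_wpM2l.
pose re i j := limn (series (fun n => complex.Re (u n i j))).
pose im i j := limn (series (fun n => complex.Im (u n i j))).
pose L : MC := \matrix_(i, j) (re i j +i* im i j)%C.
have uL : series u @ \oo --> L.
  apply/cvg_mx_entryP => i j.
  have hr : series (fun n => complex.Re (u n i j)) @ \oo --> re i j.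
    by apply: (part _ i j) => n; exact: cmod_Re.
  have hi : series (fun n => complex.Im (u n i j)) @ \oo --> im i j.
    by apply: (part _ i j) => n; exact: cmod_Im.
  pose d (g : nat -> R) a n := `|series g n - a|.
  have d0 g a : series g @ \oo --> a -> d g a @ \oo --> (0 : R).
    move=> h; rewrite /d; rewrite -(normr0 R) -(subrr a).
    by apply: cvg_norm; apply: cvgB => //; exact: cvg_cst.
  apply: (@squeeze_cvgr _ _ _ _ (cst 0) (fun n => d _ _ n + d _ _ n));
    last 2 first.
  - exact: cvg_cst.
  - by rewrite -[X in _ --> X]addr0; apply: cvgD; [exact: d0 hr|exact: d0 hi].
  near=> n; rewrite cmod_ge0 /=; apply: le_trans (cmod_ReIm _) _.
  rewrite /d !seriesEnat /= summxE mxE !raddfB !raddf_sum /=.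
  by [].
exists L; first exact: uL.
move=> n; apply: (@cvg_nu_le v (fun m => series u m - series u n)).
  exact: cvg_mxB uL (cvg_cst _).
near=> m.
have nm : (n <= m)%N by near: m; exact: nbhs_infty_ge.
rewrite sub_series_geq //; apply: le_trans (nu_sum _ _ _ _) _.
apply: (@le_trans _ _ (series f m - series f n)).
  by rewrite sub_series_geq //; apply: ler_sum.
have f0 k : 0 <= f k by exact: le_trans (nu_ge0 v _) (uf k).
rewrite lerD2r -(cvg_lim _ fl)//; apply: nondecreasing_cvgn_le; last first.
  by apply/cvg_ex; exists l.
by apply: nondecreasing_series => k _ _; exact: f0.
Unshelve. all: by end_near.
Qed.

Lemma series_mx_cvg0 (u : nat -> MC) (L : MC) :
  series u @ \oo --> L -> u @ \oo --> (0 : MC).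
Proof.
move=> h; rewrite -(subrr L).
have h' : (fun n => series u n.+1) @ \oo --> L by rewrite (cvg_shiftS (series u)).
have := cvg_mxB h' h; apply: cvg_trans; apply: near_eq_cvg; near=> n.
by rewrite -[in LHS]/(series u n.+1 - series u n) seriesSB.
Unshelve. all: by end_near.
Qed.

End AlgNormLimits.

(** * Double series and summation along antidiagonals *)

Lemma ler_sum_widen (R : numDomainType) (f : nat -> R) m n :
  (forall i, 0 <= f i) -> (m <= n)%N ->
  \sum_(0 <= i < m) f i <= \sum_(0 <= i < n) f i.
Proof.
move=> f0 mn; rewrite (big_cat_nat (leq0n _) mn) //= lerDl.
by apply: sumr_ge0 => i _.
Qed.

Lemma bounded_pos_series (R : realType) (f : nat -> R) K :
  (forall i, 0 <= f i) -> (forall n, series f n <= K) ->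
  exists l, [/\ series f @ \oo --> l, l <= K & forall n, series f n <= l].
Proof.
move=> f0 fK.
have nd : nondecreasing_seq (series f).
  by apply: nondecreasing_series => n _ _; exact: f0.
have cf : cvgn (series f).
  by apply: nondecreasing_is_cvgn => //; exists K => _ [n _ <-].
exists (limn (series f)); split => //; last exact: nondecreasing_cvgn_le.
by apply: limr_le => //; near=> n; exact: fK.
Unshelve. all: by end_near.
Qed.

Lemma cvg_sum_nat (K : numFieldType) (V : normedModType K)
    (f : nat -> nat -> V) (l : nat -> V) n :
  (forall i, f i @ \oo --> l i) ->
  (fun m => \sum_(0 <= i < n) f i m) @ \oo --> \sum_(0 <= i < n) l i.
Proof.
move=> h; elim: n => [|n IH].
  by rewrite big_nil; under eq_fun do rewrite big_nil; exact: cvg_cst.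
rewrite big_nat_recr //=; under eq_fun do rewrite big_nat_recr //=.
exact: (cvgD IH (h n)).
Qed.

Lemma sum_triangle (V : nmodType) (u : nat -> nat -> V) n :
  \sum_(0 <= k < n) \sum_(0 <= i < k.+1) u i (k - i)%N =
  \sum_(0 <= i < n) \sum_(0 <= j < n - i) u i j.
Proof.
elim: n => [|n IH]; first by rewrite !big_nil.
rewrite big_nat_recr //= IH [RHS]big_nat_recr //= subSnn big_nat1.
rewrite big_nat_recr //= subnn addrA; congr +%R.
rewrite -big_split; apply: eq_big_nat => i /andP[_ ilt].
by rewrite subSn 1?ltnW // big_nat_recr.
Qed.

Section DoubleSeries.
Variables (R : realType) (N : nat) (v : algnorm R N).
Local Notation MC := 'M[R[i]]_N.+1.

(** The sums [sq] of norms over squares increase to a limit [l]. Partial sums of rows and sums over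
    triangles differ from those over squares by at most [l - sq n] and [l - sq n./2], hence share
    their limit. *)
Lemma double_series (u : nat -> nat -> MC) (K : R) :
  (forall n, \sum_(0 <= i < n) \sum_(0 <= j < n) v (u i j) <= K) ->
  exists (row : nat -> MC) (S : MC),
  [/\ forall i, series (u i) @ \oo --> row i, series row @ \oo --> S,
      series (fun k => \sum_(0 <= i < k.+1) u i (k - i)%N) @ \oo --> S
    & forall n, \sum_(0 <= i < n) v (row i) <= K].
Proof.
move=> hK.
pose sq n := \sum_(0 <= i < n) \sum_(0 <= j < n) v (u i j).
have vs0 i n m : 0 <= \sum_(n <= j < m) v (u i j).
  by apply: sumr_ge0 => *; exact: nu_ge0.
have rect n n' m : (n <= m)%N -> (n' <= m)%N ->
    \sum_(0 <= i < n) \sum_(0 <= j < n') v (u i j) <= sq m.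
  move=> nm nm'; apply: (@le_trans _ _ (\sum_(0 <= i < n) \sum_(0 <= j < m) v (u i j))).
    by apply: ler_sum => i _; apply: ler_sum_widen => // j; exact: nu_ge0.
  by apply: ler_sum_widen.
have sq_nd : nondecreasing_seq sq by move=> n m nm; apply: rect.
have sq_cvg : cvgn sq by apply: nondecreasing_is_cvgn => //; exists K => _ [n _ <-]; exact: hK.
pose l := limn sq.
have sq_le n : sq n <= l by exact: nondecreasing_cvgn_le.
have rows i : exists r : MC, series (u i) @ \oo --> r /\
    exists2 s : R, series (fun j => v (u i j)) @ \oo --> s & v r <= s.
  have [||s [s1 s2 s3]] := @bounded_pos_series R (fun j => v (u i j)) K.
  - by move=> j; exact: nu_ge0.
  - move=> n; rewrite seriesEnat /=; apply: le_trans (hK (maxn i.+1 n)).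
    apply: le_trans (rect i.+1 n _ (leq_maxl _ _) (leq_maxr _ _)).
    by rewrite big_nat_recr //= lerDr; apply: sumr_ge0.
  have [r ur Hr] := nu_dominated_series (fun k => lexx (v (u i k))) s1.
  exists r; split => //; exists s => //.
  by have := Hr 0%N; rewrite !seriesEnat /= !big_nil !subr0.
pose row i := projT1 (cid (rows i)).
have rowP i : series (u i) @ \oo --> row i by rewrite /row; case: cid => r [].
have rowN n : \sum_(0 <= i < n) v (row i) <= K.
  pose s i := limn (series (fun j => v (u i j))).
  have rs i : series (fun j => v (u i j)) @ \oo --> s i /\ v (row i) <= s i.
    rewrite /row /s; case: cid => r [_ [t ht hr]] /=.
    by rewrite (cvg_lim _ ht).
  apply: (@le_trans _ _ (\sum_(0 <= i < n) s i)); first by apply: ler_sum => i _; case: (rs i).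
  have h : (fun m => \sum_(0 <= i < n) series (fun j => v (u i j)) m) @ \oo -->
      \sum_(0 <= i < n) s i by apply: cvg_sum_nat => i; case: (rs i).
  apply: (cvgr_to_le h); near=> m; rewrite /series /=.
  apply: le_trans (hK m); apply: rect => //.
  by near: m; exact: nbhs_infty_ge.
have [||s [s1 s2 s3]] := @bounded_pos_series R (fun i => v (row i)) K.
- by move=> i; exact: nu_ge0.
- by move=> n; rewrite seriesEnat; exact: rowN.
have [S rS _] := nu_dominated_series (fun k => lexx (v (row k))) s1.
exists row, S; split => //.
pose Sq n := \sum_(0 <= i < n) \sum_(0 <= j < n) u i j.
have lsq0 : (fun n => l - sq n) @ \oo --> (0 : R).
  by rewrite -(subrr l); apply: cvgB => //; exact: cvg_cst.
have SqS : Sq @ \oo --> S.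
  have d0 : (fun n => series row n - Sq n) @ \oo --> (0 : MC).
    apply/(cvg_nuP v).
    apply: (@squeeze_cvgr _ _ _ _ (cst 0) (fun n => l - sq n)) => //; last exact: cvg_cst.
    near=> n; rewrite nu_ge0 /= subr0.
    apply: (@cvg_nu_le _ _ v (fun m => \sum_(0 <= i < n) series (u i) m - Sq n)).
      have h : (fun m => \sum_(0 <= i < n) series (u i) m) @ \oo --> series row n.
        by rewrite seriesEnat; apply: cvg_sum_nat => i; exact: rowP.
      exact: cvg_mxB h (cvg_cst _).
    near=> m; have nm : (n <= m)%N by near: m; exact: nbhs_infty_ge.
    rewrite /Sq -sumrB; apply: (@le_trans _ _ (sq m - sq n)); last by rewrite lerD2r.
    apply: (@le_trans _ _ (\sum_(0 <= i < n) \sum_(n <= j < m) v (u i j))).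
      apply: le_trans (nu_sum _ _ _ _) _; apply: ler_sum => i _.
      rewrite seriesEnat /= (big_cat_nat (leq0n _) nm) //= addrAC subrr add0r; exact: nu_sum.
    rewrite lerBrDl -big_split /=; apply: le_trans (rect n m m nm (leqnn _)).
    by apply: ler_sum => i _; rewrite [leRHS](big_cat_nat (leq0n _) nm).
  have := cvg_mxB rS d0; rewrite subr0; apply: cvg_trans.
  by apply: near_eq_cvg; near=> n; rewrite subKr.
have -> : series (fun k => \sum_(0 <= i < k.+1) u i (k - i)%N) =
    (fun n => \sum_(0 <= i < n) \sum_(0 <= j < n - i) u i j).
  by apply/funext => n; rewrite seriesEnat /= sum_triangle.
pose T n := \sum_(0 <= i < n) \sum_(0 <= j < n - i) u i j; rewrite -/T.
have d0 : (fun n => Sq n - T n) @ \oo --> (0 : MC).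
  apply/(cvg_nuP v).
  (* The triangle of side n contains the square of side [n./2]. *)
  apply: (@squeeze_cvgr _ _ _ _ (cst 0) (fun n => l - sq n./2)).
  - near=> n; rewrite nu_ge0 /= subr0 /Sq /T -sumrB.
    pose tri := \sum_(0 <= i < n) \sum_(0 <= j < n - i) v (u i j).
    apply: (@le_trans _ _ (sq n - tri)).
      rewrite /tri /sq -sumrB; apply: le_trans (nu_sum _ _ _ _) _.
      apply: ler_sum => i _; have ni : (n - i <= n)%N by lia.
      rewrite !(big_cat_nat (leq0n _) ni) //= !(addrAC _ _ (- _)) !subrr !add0r.
      exact: nu_sum.
    apply: lerB => //.
    have n2 : (n./2 <= n)%N by lia.
    rewrite /tri (big_cat_nat (leq0n _) n2) //= -[leLHS]addr0; apply: lerD; last exact: sumr_ge0.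
    rewrite /sq; apply: ler_sum_nat => i /andP[_ ilt].
    by apply: ler_sum_widen => [j|]; [exact: nu_ge0|lia].
  - exact: cvg_cst.
  - have : (fun n => l - sq n./2) = (fun n => l - sq n) \o half by [].
    move=> ->; apply: cvg_comp lsq0.
    move=> B [A _ hA]; exists A.*2 => // n /= An; apply: hA.
    by rewrite /=; lia.
have := cvg_mxB SqS d0; rewrite subr0; apply: cvg_trans.
by apply: near_eq_cvg; near=> n; rewrite subKr.
Unshelve. all: by end_near.
Qed.

End DoubleSeries.

(** * Power series with matrix coefficients *)

Section PowerSeries.
Variables (R : realType) (N : nat) (v : algnorm R N).
Local Notation MC := 'M[R[i]]_N.+1.
Implicit Types (a e : nat -> MC) (w u z : R[i]) (rho K : R).

Definition pseries_term a w : nat -> MC := fun n => w ^+ n *: a n.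

Definition pseries_val a w : MC := limn (series (pseries_term a w)).

(** This encodes a radius of convergence at least [rho] by boundedness instead of summability:
    convergence at a single point yields it at the modulus of that point, and it yields geometric
    domination strictly inside. *)
Definition coef_bound a rho K := forall n, v (a n) * rho ^+ n <= K.

Definition coef_bounded a rho := exists K : R, coef_bound a rho K.

Lemma coef_bound_ge0 a rho K : coef_bound a rho K -> 0 <= K.
Proof. by move/(_ 0%N); rewrite expr0 mulr1; apply: le_trans (nu_ge0 _ _). Qed.

Lemma nu_pseries_term a rho K w n : coef_bound a rho K -> 0 < rho ->
  v (pseries_term a w n) <= geometric K (cmod w / rho) n.
Proof.
move=> HK r0; rewrite /pseries_term nuZ cmodX /= expr_div_n mulrCA.
rewrite ler_wpM2l ?exprn_ge0 ?cmod_ge0 //.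
by rewrite ler_pdivlMr ?exprn_gt0 // HK.
Qed.

Lemma pseries_cvg_bound a rho K w :
  coef_bound a rho K -> cmod w < rho ->
  series (pseries_term a w) @ \oo --> pseries_val a w /\
  v (pseries_val a w) <= K / (1 - cmod w / rho).
Proof.
move=> HK wr; have r0 : 0 < rho by exact: le_lt_trans (cmod_ge0 w) wr.
have q1 : `|cmod w / rho| < 1.
  by rewrite ger0_norm ?divr_ge0 ?cmod_ge0 ?(ltW r0) // ltr_pdivrMr // mul1r.
have [L hL HL] := nu_dominated_series (fun k => nu_pseries_term w k HK r0)
  (@cvg_geometric_series _ K _ q1).
rewrite /pseries_val (cvg_mx_lim hL); split; first exact: hL.
by have := HL 0%N; rewrite !seriesEnat /= !big_nil !subr0.
Qed.

Lemma pseries_cvg a rho w : coef_bounded a rho -> cmod w < rho ->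
  series (pseries_term a w) @ \oo --> pseries_val a w.
Proof. by move=> [K HK] wr; case: (pseries_cvg_bound HK wr). Qed.

Lemma coef_bounded_cvg a w (L : MC) :
  series (pseries_term a w) @ \oo --> L -> coef_bounded a (cmod w).
Proof.
move=> /series_mx_cvg0 h; have [K _ HK] := cvg_mx_bounded v h.
by exists K => n; have := HK n; rewrite nuZ cmodX mulrC.
Qed.

Lemma pseries_val0 a : pseries_val a 0 = a 0%N.
Proof.
apply: cvg_mx_lim; rewrite -cvg_shiftS.
rewrite (_ : (fun n => _) = cst (a 0%N)); first exact: cvg_cst.
apply/funext => n; rewrite seriesEnat /= big_nat_recl //= /pseries_term expr0 scale1r.
by rewrite big1 ?addr0 // => i _; rewrite expr0n /= scale0r.
Qed.

Lemma coef_bounded_shift a rho : 0 < rho ->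
  coef_bounded a rho -> coef_bounded (a \o S) rho.
Proof.
move=> r0 [K HK]; exists (K / rho) => n.
by rewrite ler_pdivlMr // -mulrA -exprSr HK.
Qed.

Lemma pseries_val_split a rho w : coef_bounded a rho -> cmod w < rho ->
  pseries_val a w = a 0%N + w *: pseries_val (a \o S) w.
Proof.
move=> ha wr; have r0 : 0 < rho by exact: le_lt_trans (cmod_ge0 w) wr.
have h1 := pseries_cvg ha wr.
have h2 := pseries_cvg (coef_bounded_shift r0 ha) wr.
apply: (cvg_mx_unique (u := fun n => series (pseries_term a w) n.+1)).
  rewrite (cvg_shiftS (series (pseries_term a w))); exact: h1.
rewrite (_ : (fun n => _) =
  (fun n => a 0%N + w *: series (pseries_term (a \o S) w) n)).
  apply: cvg_mxD; first exact: cvg_cst.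
  by apply: cvg_mxZ; exact: h2.
apply/funext => n; rewrite !seriesEnat /= big_nat_recl //= /pseries_term.
rewrite expr0 scale1r scaler_sumr; congr +%R.
by apply: eq_bigr => i _; rewrite scalerA exprS.
Qed.

Lemma pseries_val_near0 a rho : 0 < rho -> coef_bounded a rho ->
  exists C : R, forall w, cmod w <= rho / 2 ->
    v (pseries_val a w - a 0%N) <= C * cmod w.
Proof.
move=> r0 ha; have [K HK] := coef_bounded_shift r0 ha.
exists (K * 2) => w wr.
have wr' : cmod w < rho by apply: le_lt_trans wr _; rewrite ltr_pdivrMr // ltr_pMr // ltr1n.
rewrite (pseries_val_split ha wr') addrC addKr nuZ mulrC ler_wpM2r ?cmod_ge0 //.
have [_ /le_trans] := pseries_cvg_bound HK wr'; apply.
have K0 := coef_bound_ge0 HK.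
have h : cmod w / rho <= 1 / 2 by rewrite ler_pdivrMr // mulrC mulrA mulr1.
by rewrite ler_wpM2l // -[leRHS]invrK lef_pV2 ?posrE ?invr_gt0//; lra.
Qed.

(** Zeros accumulating at 0 kill the constant coefficient by continuity. The series is then w times
    the shifted one, which has the same nonzero zeros, so induction on n applies. *)
Lemma pseries_identity e rho : 0 < rho -> coef_bounded e rho ->
  (forall d : R, 0 < d -> exists w, [/\ 0 < cmod w, cmod w < d & pseries_val e w = 0]) ->
  forall n, e n = 0.
Proof.
move=> r0 + + n.
have base f : coef_bounded f rho -> (forall d : R, 0 < d ->
    exists w, [/\ 0 < cmod w, cmod w < d & pseries_val f w = 0]) -> f 0%N = 0.
  move=> hf H; apply: (@nu_eq0 _ _ v); apply/eqP; rewrite eq_le nu_ge0 andbT.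
  have [C HC] := pseries_val_near0 r0 hf.
  apply/ler_addgt0Pr => t t0; rewrite add0r.
  have [|w [w0 wd fw]] := H (Num.min (rho / 2) (t / (`|C| + 1))).
    by rewrite lt_min !divr_gt0 // ltr_wpDl.
  move: wd; rewrite lt_min => /andP[/ltW wr /ltW wt].
  have := HC w wr; rewrite fw sub0r nuN => /le_trans; apply.
  apply: (@le_trans _ _ ((`|C| + 1) * cmod w)).
    by rewrite ler_wpM2r ?cmod_ge0 // (le_trans (ler_norm C)) // lerDl.
  by rewrite mulrC -ler_pdivlMr // ltr_wpDl.
elim: n e => [|n IH] e he H; first exact: base.
apply: (IH (e \o S)); first exact: coef_bounded_shift.
move=> d d0; have [|w [w0 wd ew]] := H (Num.min d rho); first by rewrite lt_min d0.
move: wd; rewrite lt_min => /andP[wd wr].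
have wn0 : w != 0 by apply: contraTneq w0 => ->; rewrite cmod0 ltxx.
exists w; split; [exact: w0|exact: wd|].
have := pseries_val_split he wr; rewrite ew (base _ he H) add0r => /esym/eqP.
by rewrite scaler_eq0 (negbTE wn0) => /eqP.
Qed.

(** The m-th term of f^(l)(w) / l! for f(w) = sum_n a_n w^n, reindexed by n = l + m. No derivative
    is ever taken: these are the coefficients that the binomial expansion of (w + u)^n produces. *)
Definition taylor_term a w l : nat -> MC :=
  fun m => ('C(l + m, l)%:R * w ^+ m) *: a (l + m)%N.

Definition taylor a w l : MC := limn (series (taylor_term a w l)).

(** The square of side n lies in the triangle of side n + n, whose k-th antidiagonal sums, by the
    binomial formula, to (|w| + |u|)^k |a_k|: a geometric majorant of ratio below 1. *)
Lemma taylor_sum_le a rho K w u n : coef_bound a rho K -> cmod w + cmod u < rho ->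
  \sum_(0 <= l < n) \sum_(0 <= m < n) v (u ^+ l *: taylor_term a w l m) <=
  K / (1 - (cmod w + cmod u) / rho).
Proof.
move=> HK wur; set q := (_ + _) / rho.
have r0 : 0 < rho by apply: le_lt_trans wur; rewrite addr_ge0 ?cmod_ge0.
have q0 : 0 <= q by rewrite divr_ge0 ?addr_ge0 ?cmod_ge0 ?ltW.
have q1 : q < 1 by rewrite ltr_pdivrMr // mul1r.
have K0 := coef_bound_ge0 HK.
pose f l m := v (u ^+ l *: taylor_term a w l m).
have f0 l m : 0 <= f l m by exact: nu_ge0.
apply: (@le_trans _ _ (\sum_(0 <= i < n + n) \sum_(0 <= j < n + n - i) f i j)).
  rewrite (big_cat_nat (leq0n _) (leq_addr n n)) /= -[leLHS]addr0; apply: lerD.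
    apply: ler_sum_nat => i /andP[_ ilt].
    by apply: ler_sum_widen => [j|]; [exact: f0|lia].
  by apply: sumr_ge0 => i _; apply: sumr_ge0.
rewrite -(sum_triangle f).
apply: (@le_trans _ _ (series (geometric K q) (n + n)%N)); last first.
  have qn : `|q| < 1 by rewrite ger0_norm.
  rewrite -(cvg_lim _ (@cvg_geometric_series _ K _ qn)) //.
  apply: nondecreasing_cvgn_le; last exact: is_cvg_geometric_series.
  by apply: nondecreasing_series => k _ _; rewrite /= mulr_ge0 ?exprn_ge0.
rewrite seriesEnat; apply: ler_sum => k _ /=.
have -> : \sum_(0 <= i < k.+1) f i (k - i)%N = (cmod w + cmod u) ^+ k * v (a k).
  rewrite exprDn mulr_suml big_mkord; apply: eq_bigr => i _.
  have ik : (i <= k)%N by rewrite -ltnS.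
  rewrite /f /taylor_term subnKC // !nuZ !cmodM !cmodX cmod_nat.
  by rewrite -mulr_natr; ring.
by rewrite expr_div_n mulrCA ler_wpM2l ?exprn_ge0 ?addr_ge0 ?cmod_ge0 // ler_pdivlMr ?exprn_gt0.
Qed.

(** In the double family [u ^+ l *: taylor_term a w l m], the rows sum to the terms of the series
    re-expanded at w and the antidiagonals to those of the series at w + u. The bound on the rows at
    u = s bounds the new coefficients. *)
Lemma taylor_shift a rho w (s : R) :
  coef_bounded a rho -> 0 < s -> cmod w + s < rho ->
  [/\ coef_bounded (taylor a w) s,
      forall l, series (taylor_term a w l) @ \oo --> taylor a w l &
      forall u, cmod u <= s -> pseries_val a (w + u) = pseries_val (taylor a w) u].
Proof.
move=> [K HK] s0 wsr.
have cs : cmod s%:C%C = s by rewrite cmod_real ger0_norm ?ltW.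
have main u : cmod u <= s -> exists (row : nat -> MC) (S : MC),
    [/\ forall l, series (fun m => u ^+ l *: taylor_term a w l m) @ \oo --> row l,
      series row @ \oo --> S, series (pseries_term a (w + u)) @ \oo --> S
    & exists K', forall n, \sum_(0 <= i < n) v (row i) <= K'].
  move=> us; have wur : cmod w + cmod u < rho.
    by apply: le_lt_trans wsr; rewrite lerD2l.
  have [row [S [h1 h2 h3 h4]]] := double_series (fun n => taylor_sum_le n HK wur).
  exists row, S; split; [exact: h1|exact: h2| |by eexists; exact: h4].
  rewrite (_ : pseries_term _ _ = fun k =>
    \sum_(0 <= i < k.+1) u ^+ i *: taylor_term a w i (k - i)); first exact: h3.
  apply/funext => k.
  rewrite /pseries_term exprDn scaler_suml big_mkord; apply: eq_bigr => i _.
  have ik : (i <= k)%N by rewrite -ltnS.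
  rewrite /taylor_term subnKC // scalerA; congr (_ *: _).
  by rewrite -mulr_natr; ring.
have rows l : series (taylor_term a w l) @ \oo --> taylor a w l.
  have [|row [S [h1 _ _ _]]] := main s%:C%C; first by rewrite cs.
  have sl0 : (s%:C%C ^+ l : R[i]) != 0.
    by apply: expf_neq0; rewrite fmorph_eq0 gt_eqF.
  have := cvg_mxZ (c := (s%:C%C ^+ l)^-1) (h1 l).
  rewrite (_ : (fun n => _) = series (taylor_term a w l)).
    by move=> h; rewrite /taylor (cvg_mx_lim h); exact: h.
  apply/funext => n; rewrite !seriesEnat /= scaler_sumr; apply: eq_bigr => m _.
  by rewrite scalerA mulVf // scale1r.
have rowE u row : (forall l, series (fun m => u ^+ l *: taylor_term a w l m) @ \oo --> row l) ->
    row = pseries_term (taylor a w) u.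
  move=> h; apply/funext => l; apply: cvg_mx_unique (h l) _.
  rewrite (_ : series _ = fun n => u ^+ l *: series (taylor_term a w l) n).
    exact: cvg_mxZ (rows l).
  by apply/funext => n; rewrite !seriesEnat /= scaler_sumr.
split; [|exact: rows|].
  have [|row [S [h1 _ _ [K' hK']]]] := main s%:C%C; first by rewrite cs.
  exists K' => n; have := hK' n.+1; rewrite (rowE _ _ h1) big_nat_recr //=.
  apply: le_trans; rewrite /pseries_term nuZ cmodX cs mulrC lerDr.
  by apply: sumr_ge0 => i _; exact: nu_ge0.
move=> u us; have [row [S [h1 h2 h3 _]]] := main u us.
rewrite (rowE _ _ h1) in h2.
by rewrite /pseries_val (cvg_mx_lim h2) (cvg_mx_lim h3).
Qed.

End PowerSeries.

(** * Abel's theorem and continuation along a segment *)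

Section Rearrangement.
Variables (R : realType) (N : nat) (v : algnorm R N).
Local Notation MC := 'M[R[i]]_N.+1.
Implicit Types (a b e : nat -> MC) (w u z : R[i]) (rho K : R).
Local Notation coef_bounded := (coef_bounded v).

Lemma coef_boundedB a b rho : 0 <= rho -> coef_bounded a rho -> coef_bounded b rho ->
  coef_bounded (fun n => a n - b n) rho.
Proof.
move=> r0 [K HK] [K' HK']; exists (K + K') => n.
apply: le_trans (lerD (HK n) (HK' n)); rewrite -mulrDl.
by rewrite ler_wpM2r ?exprn_ge0 ?nuB.
Qed.

Lemma pseries_valB a b rho w : coef_bounded a rho -> coef_bounded b rho -> cmod w < rho ->
  pseries_val (fun n => a n - b n) w = pseries_val a w - pseries_val b w.
Proof.
move=> ha hb wr; apply: cvg_mx_lim.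
rewrite (_ : series _ = fun n => series (pseries_term a w) n - series (pseries_term b w) n).
  exact: cvg_mxB (pseries_cvg ha wr) (pseries_cvg hb wr).
apply/funext => n; rewrite !seriesEnat /= -sumrB; apply: eq_bigr => i _.
by rewrite /pseries_term scalerBr.
Qed.

(** Summation by parts on the remainders [r] leaves (1 - w) times a series in them. Its head is a
    fixed finite sum, killed by 1 - w; in its tail the remainders are small and the geometric series
    costs |1 - w| / (1 - |w|) <= C. *)
Lemma abel_stolz a (s : MC) (w : nat -> R[i]) (C : R) :
  series a @ \oo --> s -> (forall k, cmod (w k) < 1) ->
  (forall k, cmod (1 - w k) <= C * (1 - cmod (w k))) ->
  (fun k => cmod (1 - w k)) @ \oo --> (0 : R) ->
  (fun k => pseries_val a (w k)) @ \oo --> s.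
Proof.
move=> hs w1 wC w0.
pose r n := series a n - s.
have r0 : (fun n => v (r n)) @ \oo --> (0 : R) by exact/(cvg_nuP v).
have a1 : coef_bounded a 1.
  rewrite -(cmod1 R); apply: (@coef_bounded_cvg _ _ _ _ _ s).
  rewrite (_ : pseries_term a 1 = a); first exact: hs.
  by apply/funext => n; rewrite /pseries_term expr1n scale1r.
have parts n x : series (pseries_term a x) n - s =
    x ^+ n *: r n + (1 - x) *: \sum_(0 <= k < n) x ^+ k *: r k.+1.
  elim: n => [|n IH].
    by rewrite seriesEnat /= /r seriesEnat /= !big_nil expr0 scale1r scaler0 addr0.
  have rS : r n.+1 = r n + a n.
    by rewrite /r !seriesEnat /= big_nat_recr //= addrAC.
  have pS : series (pseries_term a x) n.+1 = series (pseries_term a x) n + x ^+ n *: a n.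
    by rewrite !seriesEnat /= big_nat_recr.
  rewrite pS addrAC IH big_nat_recr //= [X in _ = _ + X]scalerDr rS scalerA.
  rewrite [RHS]addrCA -[in RHS]scalerDl mulrBl mul1r -exprS addrCA subrr addr0.
  by rewrite [X in _ = _ + X]scalerDr addrAC [LHS]addrC.
have C0 : 0 <= C.
  have h := le_trans (cmod_ge0 _) (wC 0%N).
  by rewrite pmulr_lge0 // in h; rewrite subr_gt0.
apply/(cvg_nuP v)/cvgrPdist_le => t t0.
(* One half of t pays for the tail and, through [tB], the other half for the head; adding 1 to C and
   B only avoids a zero denominator. *)
have t2 : 0 < t / (2 * (C + 1)) by rewrite divr_gt0 // mulr_gt0 // ltr_wpDl.
have /cvgrPdist_le /(_ _ t2) [n0 _ Hn0] := r0.
pose B := \sum_(0 <= k < n0) v (r k.+1).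
have B0 : 0 <= B by apply: sumr_ge0 => k _; exact: nu_ge0.
have rle k : (n0 <= k)%N -> v (r k) <= t / (2 * (C + 1)).
  by move=> /Hn0 /=; rewrite sub0r normrN ger0_norm ?nu_ge0.
have tB : 0 < t / (2 * (B + 1)) by rewrite divr_gt0 // mulr_gt0 // ltr_wpDl.
have /cvgrPdist_le /(_ _ tB) H := w0.
near=> k; rewrite sub0r normrN ger0_norm ?nu_ge0 //.
have wk : cmod (1 - w k) <= t / (2 * (B + 1)).
  have : `|0 - cmod (1 - w k)| <= t / (2 * (B + 1)) by near: k.
  by rewrite sub0r normrN ger0_norm ?cmod_ge0.
set x := w k in wk *.
have x1 : cmod x < 1 by exact: w1.
have xC : cmod (1 - x) <= C * (1 - cmod x) by exact: wC.
have x1' : `|cmod x| < 1 by rewrite ger0_norm ?cmod_ge0.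
apply: (@le_trans _ _ (0 + (cmod (1 - x) * B + C * (t / (2 * (C + 1)))))); last first.
  rewrite add0r [leRHS]splitr.
  apply: lerD.
    apply: (@le_trans _ _ (t / (2 * (B + 1)) * (B + 1))).
      by apply: ler_pM; rewrite ?cmod_ge0 // lerDl.
    by rewrite invfM mulrA mulfVK // gt_eqF // ltr_wpDl.
  have C1 : 0 < C + 1 by rewrite ltr_wpDl.
  have -> : C * (t / (2 * (C + 1))) = t / 2 * (C / (C + 1)).
    by field; rewrite gt_eqF.
  by rewrite ler_piMr ?divr_ge0 ?(ltW t0) // ler_pdivrMr // mul1r lerDl.
have lim1 : (fun n => v (series (pseries_term a x) n - s)) @ \oo --> v (pseries_val a x - s).
  by apply: cvg_nu; exact: (cvg_mxB (pseries_cvg a1 x1) (cvg_cst _)).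
have lim2 : (fun n => v (r n) + (cmod (1 - x) * B + C * (t / (2 * (C + 1)))))
    @ \oo --> 0 + (cmod (1 - x) * B + C * (t / (2 * (C + 1)))).
  by apply: cvgD => //; exact: cvg_cst.
apply: (ler_cvg_to lim1 lim2); near=> n; rewrite parts.
apply: le_trans (nuD _ _ _) _; apply: lerD.
  rewrite nuZ cmodX; apply: ler_piMl; first exact: nu_ge0.
  by rewrite exprn_ile1 ?cmod_ge0 ?ltW.
rewrite nuZ.
have nn : (n0 <= n)%N by near: n; exact: nbhs_infty_ge.
rewrite (big_cat_nat (leq0n _) nn) /=.
apply: (@le_trans _ _ (cmod (1 - x) * (B + (t / (2 * (C + 1))) / (1 - cmod x)))).
  rewrite ler_wpM2l ?cmod_ge0 //; apply: le_trans (nuD _ _ _) _; apply: lerD.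
    apply: le_trans (nu_sum _ _ _ _) _; apply: ler_sum => j _.
    rewrite nuZ cmodX; apply: ler_piMl; first exact: nu_ge0.
    by rewrite exprn_ile1 ?cmod_ge0 ?ltW.
  apply: le_trans (nu_sum _ _ _ _) _.
  apply: (@le_trans _ _ (\sum_(n0 <= j < n) geometric (t / (2 * (C + 1))) (cmod x) j)).
    apply: ler_sum_nat => j /andP[nj _]; rewrite nuZ cmodX /= mulrC.
    by rewrite ler_wpM2r ?exprn_ge0 ?cmod_ge0 // rle // (leq_trans nj).
  apply: (@le_trans _ _ (series (geometric (t / (2 * (C + 1))) (cmod x)) n)).
    rewrite seriesEnat /= [leRHS](big_cat_nat (leq0n _) nn) /= lerDr.
    by apply: sumr_ge0 => j _; rewrite mulr_ge0 ?exprn_ge0 ?cmod_ge0 ?ltW.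
  rewrite -(cvg_lim _ (@cvg_geometric_series _ (t / (2 * (C + 1))) _ x1')) //.
  apply: nondecreasing_cvgn_le; last exact: is_cvg_geometric_series.
  by apply: nondecreasing_series => j _ _; rewrite /= mulr_ge0 ?exprn_ge0 ?cmod_ge0 ?ltW.
rewrite mulrDr lerD2l mulrA ler_pdivrMr ?subr_gt0 // [leRHS]mulrAC.
by apply: ler_wpM2r; [exact: ltW|exact: xC].
Unshelve. all: by end_near.
Qed.

Lemma taylor_at0 a : taylor a 0 = a.
Proof.
apply/funext => l; apply: cvg_mx_lim; rewrite -cvg_shiftS.
rewrite (_ : (fun n => _) = cst (a l)); first exact: cvg_cst.
apply/funext => n; rewrite seriesEnat /= big_nat_recl //= /taylor_term.
rewrite addn0 binn expr0 mulr1 scale1r.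
by rewrite big1 ?addr0 // => i _; rewrite expr0n /= mulr0 scale0r.
Qed.

(** Let T be the supremum of the parameters up to which both sides agree. If T < 1, both have power
    series in u around T. These agree at points accumulating at T from the left, hence have equal
    coefficients, and agreement passes beyond T. At T = 0 the coefficients agree by the definition
    of [taylor]. *)
Lemma analytic_continuation a rho y z :
  coef_bounded a rho -> coef_bounded (taylor a y) (cmod z) -> 0 < cmod z ->
  (forall t : R, 0 <= t < 1 -> cmod (y + t%:C%C * z) < rho) ->
  forall t : R, 0 <= t < 1 ->
    pseries_val a (y + t%:C%C * z) = pseries_val (taylor a y) (t%:C%C * z).
Proof.
move=> ha; have [b bE] : exists b, b = taylor a y by exists (taylor a y).
rewrite -bE => hb z0 hin.
pose eqv t := pseries_val a (y + t%:C%C * z) = pseries_val b (t%:C%C * z).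
have cmodt (t : R) : 0 <= t -> cmod (t%:C%C * z) = t * cmod z.
  by move=> t0; rewrite cmodM cmod_real ger0_norm.
have addt (t t' : R) : ((t + t')%:C%C * z = t%:C%C * z + t'%:C%C * z :> R[i]).
  by rewrite raddfD /= mulrDl.
(* Re-expansion around T is what propagates agreement on [0, T] past T. *)
have local (T : R) : 0 <= T < 1 -> exists s : R, [/\ 0 < s,
    coef_bounded (taylor a (y + T%:C%C * z)) s, coef_bounded (taylor b (T%:C%C * z)) s,
    forall u, cmod u <= s -> pseries_val a (y + T%:C%C * z + u) =
       pseries_val (taylor a (y + T%:C%C * z)) u &
    forall u, cmod u <= s -> pseries_val b (T%:C%C * z + u) =
       pseries_val (taylor b (T%:C%C * z)) u].
  move=> T01; have /andP[T0 T1] := T01.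
  have d1 : 0 < rho - cmod (y + T%:C%C * z) by rewrite subr_gt0 hin.
  have d2 : 0 < cmod z - cmod (T%:C%C * z).
    by rewrite cmodt // subr_gt0 gtr_pMl.
  pose s := Num.min (rho - cmod (y + T%:C%C * z)) (cmod z - cmod (T%:C%C * z)) / 2.
  have s0 : 0 < s by rewrite divr_gt0 // lt_min d1.
  have s2 : s < s * 2 by rewrite ltr_pMr // ltr1n.
  have s1' : s < rho - cmod (y + T%:C%C * z).
    by apply: lt_le_trans s2 _; rewrite /s mulfVK // ge_min lexx.
  have s2' : s < cmod z - cmod (T%:C%C * z).
    by apply: lt_le_trans s2 _; rewrite /s mulfVK // ge_min lexx orbT.
  have lt1 : cmod (y + T%:C%C * z) + s < rho by rewrite addrC -ltrBrDr.
  have lt2 : cmod (T%:C%C * z) + s < cmod z by rewrite addrC -ltrBrDr.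
  have [h1 _ h2] := taylor_shift ha s0 lt1.
  have [h3 _ h4] := taylor_shift hb s0 lt2.
  by exists s; split; [exact: s0|exact: h1|exact: h3|exact: h2|exact: h4].
have extend (T : R) : 0 <= T < 1 ->
    (T = 0 \/ (0 < T /\ forall t, 0 <= t < T -> eqv t)) ->
    exists2 d : R, 0 < d & forall t, T <= t <= T + d -> eqv t.
  move=> T01 hT; have [s [s0 h1 h3 h2 h4]] := local T T01.
  have /andP[T0 T1] := T01.
  have eqT : taylor a (y + T%:C%C * z) = taylor b (T%:C%C * z).
    case: hT => [->|[Tp hT]]; first by rewrite mul0r addr0 taylor_at0 bE.
    apply/funext => n; apply/eqP; rewrite -subr_eq0; apply/eqP; move: n.
    apply: (pseries_identity s0 (coef_boundedB (ltW s0) h1 h3)) => d d0.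
    (* The point T - m must lie in [0, T), and its offset m |z| must be below both d and s; halving
       makes the inequalities strict. *)
    pose m := Num.min T (Num.min (d / cmod z) (s / cmod z)) / 2.
    have m0 : 0 < m by rewrite divr_gt0 // !lt_min Tp !divr_gt0.
    have m2 : m < m * 2 by rewrite ltr_pMr // ltr1n.
    have mT : m < T by apply: lt_le_trans m2 _; rewrite /m mulfVK // ge_min lexx.
    have md : m < d / cmod z.
      by apply: lt_le_trans m2 _; rewrite /m mulfVK // !ge_min lexx !orbT.
    have ms : m < s / cmod z.
      by apply: lt_le_trans m2 _; rewrite /m mulfVK // !ge_min lexx !orbT.
    have cu : cmod ((- m)%:C%C * z) = m * cmod z.
      by rewrite cmodM cmod_real normrN gtr0_norm.
    have us : cmod ((- m)%:C%C * z) < s by rewrite cu -ltr_pdivlMr.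
    exists ((- m)%:C%C * z); rewrite cu; split; first exact: mulr_gt0.
      by rewrite -ltr_pdivlMr.
    rewrite (pseries_valB h1 h3 us) -(h2 _ (ltW us)) -(h4 _ (ltW us)).
    rewrite -addrA -addt.
    have -> : pseries_val a (y + (T - m)%:C%C * z) = pseries_val b ((T - m)%:C%C * z).
      by apply: hT; rewrite subr_ge0 (ltW mT) gtrBl.
    by rewrite subrr.
  exists (s / cmod z); first exact: divr_gt0.
  move=> t /andP[Tt tT]; rewrite /eqv -(subrK T t) [t - T + T]addrC addt addrA.
  have us : cmod ((t - T)%:C%C * z) <= s.
    by rewrite cmodt ?subr_ge0 // -ler_pdivlMr // lerBlDl.
  rewrite (h2 _ us) (h4 _ us) eqT; reflexivity.
pose E : set R := [set t | 0 <= t < 1 /\ forall t', 0 <= t' <= t -> eqv t'].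
have zero01 : 0 <= (0 : R) < 1 by rewrite lexx ltr01.
have [d0 d0p hd0] := extend 0 zero01 (or_introl erefl).
have E0 : E 0.
  split; first exact: zero01.
  by move=> t /andP[t0 t0']; apply: hd0; rewrite t0 add0r (le_trans t0' (ltW d0p)).
have Eub : ubound E 1 by move=> x [/andP[_ /ltW]].
have hE : has_sup E by split; [exists 0; exact: E0|exists 1; exact: Eub].
pose T := sup E.
have T0 : 0 <= T by apply: sup_upper_bound.
have below t : 0 <= t < T -> eqv t.
  move=> /andP[t0 tT].
  have [|e [_ he] te] := @sup_adherent _ E (T - t) _ hE; first by rewrite subr_gt0.
  by apply: he; rewrite t0 ltW //; move: te; rewrite opprB addrC subrK.
have [T1|T1] := ltP T 1; last first.
  by move=> t /andP[t0 t1]; apply: below; rewrite t0 (lt_le_trans t1).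
exfalso.
have T01 : 0 <= T < 1 by rewrite T0.
have [d dp hd] : exists2 d : R, 0 < d & forall t, T <= t <= T + d -> eqv t.
  apply: extend => //; have [T00|Tn0] := eqVneq T 0; first by left.
  by right; split; [rewrite lt_def Tn0|exact: below].
pose m := Num.min d ((1 - T) / 2).
have m0 : 0 < m by rewrite lt_min dp divr_gt0 // subr_gt0.
have : E (T + m).
  split; first apply/andP; first split.
  - by rewrite addr_ge0 // ltW.
  - rewrite -ltrBrDl (@le_lt_trans _ _ ((1 - T) / 2)) ?ge_min ?lexx ?orbT //.
    by rewrite ltr_pdivrMr // ltr_pMr ?ltr1n // subr_gt0.
  - move=> t /andP[t0 tm]; have [tT|Tt] := ltP t T; first by apply: below; rewrite t0.
    by apply: hd; rewrite Tt (le_trans tm) // lerD2l ge_min lexx.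
move=> /(sup_upper_bound hE); rewrite -/T gerDl leNgt => /negP; apply; exact: m0.
Qed.

End Rearrangement.

Section TaylorSum.
Variables (R : realType) (N : nat) (v : algnorm R N).
Local Notation MC := 'M[R[i]]_N.+1.
Implicit Types (a b e : nat -> MC) (w u z : R[i]) (rho K : R).
Local Notation coef_bounded := (coef_bounded v).

Lemma pseries_val_scale a w u :
  pseries_val (pseries_term a w) u = pseries_val a (u * w).
Proof.
rewrite /pseries_val; congr (limn (series _)); apply/funext => n.
by rewrite /pseries_term scalerA exprMn.
Qed.

Let tk (k : nat) : R := 1 - k.+1%:R^-1.

Let tk01 k : 0 <= tk k < 1.
Proof.
rewrite /tk subr_ge0 invf_le1 ?ltr0n // ler1n /= gtrBl invr_gt0 ltr0n.
by [].
Qed.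

Let tk_cvg (C : R) : (fun k => C * (1 - tk k)) @ \oo --> (0 : R).
Proof.
rewrite -(mulr0 C); apply: cvgMr.
rewrite (_ : (fun k => _) = @harmonic R); first exact: cvg_harmonic.
by apply/funext => k; rewrite /tk subKr.
Qed.

Let cmod_1tk k : cmod (1 - (tk k)%:C%C : R[i]) = 1 - tk k.
Proof.
have /andP[_ /ltW h] := tk01 k.
by rewrite -(rmorph1 (real_complex R)) -rmorphB cmod_real ger0_norm // subr_ge0.
Qed.

Lemma pseries_radial_limit a z (G : MC) : series (pseries_term a z) @ \oo --> G ->
  (fun k => pseries_val a ((tk k)%:C%C * z)) @ \oo --> G.
Proof.
move=> h; under eq_fun do rewrite -pseries_val_scale.
have hk k : cmod (tk k)%:C%C = tk k.
  by rewrite cmod_real ger0_norm //; case/andP: (tk01 k).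
apply: (@abel_stolz _ _ v _ _ _ 1 h) => [k|k|].
- by rewrite hk; case/andP: (tk01 k).
- by rewrite hk cmod_1tk mul1r.
- under eq_fun do rewrite cmod_1tk -[_ - _]mul1r; exact: tk_cvg.
Qed.

(** If |y + z| = rho, divide by y + z: with t = [tk k], |1 - w| = (1 - t) |z| / rho, while convexity
    gives 1 - |w| >= (1 - t) (rho - |y|) / rho. Hence a Stolz condition with constant |z| / (rho -
    |y|). If |y + z| < rho, continuity at an interior point suffices. *)
Lemma pseries_segment_limit a rho y z (F : MC) :
  coef_bounded a rho -> cmod y < rho -> cmod (y + z) <= rho ->
  series (pseries_term a (y + z)) @ \oo --> F ->
  (fun k => pseries_val a (y + (tk k)%:C%C * z)) @ \oo --> F.
Proof.
move=> ha yr; have r0 := le_lt_trans (cmod_ge0 y) yr.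
rewrite le_eqVlt => /orP[/eqP yzr|yzr] hF.
  have yz0 : y + z != 0.
    by apply: contraTneq r0 => yz; rewrite -yzr yz cmod0 ltxx.
  pose w k := (y + (tk k)%:C%C * z) / (y + z).
  have e k : pseries_val a (y + (tk k)%:C%C * z) =
             pseries_val (pseries_term a (y + z)) (w k).
    by rewrite pseries_val_scale /w divfK.
  under eq_fun do rewrite e.
  have ry0 : 0 < rho - cmod y by rewrite subr_gt0.
  have w1 k : cmod (1 - w k) = (cmod z / rho) * (1 - tk k).
    have -> : 1 - w k = z / (y + z) * (1 - (tk k)%:C%C) by rewrite /w; field.
    by rewrite !cmodM cmodV yzr cmod_1tk.
  have w2 k : (1 - tk k) * (rho - cmod y) / rho <= 1 - cmod (w k).
    have /andP[t0 t1] := tk01 k.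
    rewrite /w cmodM cmodV yzr ler_pdivrMr // [leRHS]mulrBl mul1r.
    rewrite divfK ?gt_eqF // lerBrDr.
    have -> : y + (tk k)%:C%C * z = (1 - (tk k)%:C%C) * y + (tk k)%:C%C * (y + z) by ring.
    apply: le_trans (lerD (lexx _) (cmodD _ _)) _.
    rewrite !cmodM cmod_1tk yzr cmod_real ger0_norm //.
    by rewrite le_eqVlt; apply/orP; left; apply/eqP; ring.
  apply: (@abel_stolz _ _ v _ _ _ (cmod z / (rho - cmod y)) hF) => [k|k|].
  - rewrite -subr_gt0; apply: lt_le_trans (w2 k).
    by rewrite divr_gt0 // mulr_gt0 // subr_gt0; case/andP: (tk01 k).
  - rewrite w1; apply: le_trans (ler_wpM2l _ (w2 k)).
      rewrite le_eqVlt; apply/orP; left; apply/eqP; field.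
      by rewrite !gt_eqF.
    by rewrite divr_ge0 ?cmod_ge0 // ltW.
  - under eq_fun do rewrite w1; exact: tk_cvg.
pose s := (rho - cmod (y + z)) / 2.
have d0 : 0 < rho - cmod (y + z) by rewrite subr_gt0.
have s0 : 0 < s by rewrite divr_gt0.
have s1 : cmod (y + z) + s < rho.
  by rewrite addrC -ltrBrDr ltr_pdivrMr // ltr_pMr // ltr1n.
have [h1 _ h2] := taylor_shift ha s0 s1.
have F0 : F = taylor a (y + z) 0%N.
  rewrite -pseries_val0 -h2 ?cmod0 ?ltW // addr0.
  by rewrite /pseries_val (cvg_mx_lim hF).
have [C HC] := pseries_val_near0 s0 h1.
apply/(cvg_nuP v).
apply: (@squeeze_cvgr _ _ _ _ (cst 0) (fun k => (C * cmod z) * (1 - tk k)));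
  [|exact: cvg_cst|exact: tk_cvg].
have t2 : 0 < s / 2 by rewrite divr_gt0.
have /cvgrPdist_le /(_ _ t2) H := tk_cvg (cmod z).
near=> k; rewrite nu_ge0 /=.
have e : cmod (((tk k)%:C%C - 1) * z) = cmod z * (1 - tk k).
  by rewrite -opprB cmodM cmodN cmod_1tk mulrC.
have small : cmod (((tk k)%:C%C - 1) * z) <= s / 2.
  have : `|0 - cmod z * (1 - tk k)| <= s / 2 by near: k.
  by rewrite sub0r normrN e; apply: le_trans; exact: ler_norm.
have -> : y + (tk k)%:C%C * z = y + z + ((tk k)%:C%C - 1) * z by ring.
rewrite h2; last by apply: le_trans small _; rewrite ler_pdivrMr // ler_pMr // ler1n.
by rewrite F0 -mulrA -e HC.
Unshelve. all: by end_near.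
Qed.

Theorem taylor_sum a rho y z (F G : MC) :
  coef_bounded a rho -> cmod y < rho ->
  series (pseries_term a (y + z)) @ \oo --> F ->
  series (pseries_term (taylor a y) z) @ \oo --> G -> F = G.
Proof.
move=> ha yr hF hG.
(* The continuation argument needs a segment of positive length. *)
have [z0|z0] := eqVneq z 0.
  pose s := (rho - cmod y) / 2.
  have d0 : 0 < rho - cmod y by rewrite subr_gt0.
  have s0 : 0 < s by rewrite divr_gt0.
  have s1 : cmod y + s < rho.
    by rewrite addrC -ltrBrDr ltr_pdivrMr // ltr_pMr // ltr1n.
  have [_ _ h2] := taylor_shift ha s0 s1.
  rewrite -(cvg_mx_lim hF) -(cvg_mx_lim hG).
  by apply: h2; rewrite z0 cmod0 ltW.
have zp : 0 < cmod z by rewrite lt_def cmod_ge0 andbT; apply: contra z0 => /eqP/cmod_eq0 ->.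
(* Convergence at y + z may reach beyond rho. In the disk of radius [rho'], y is interior and y + z
   at worst on the boundary, so by convexity the half-open segment stays inside. *)
pose rho' := Num.max rho (cmod (y + z)).
have ha' : coef_bounded a rho'.
  by rewrite /rho'; case: leP => _ //; exact: coef_bounded_cvg hF.
have yr' : cmod y < rho' by rewrite lt_max yr.
have yzr : cmod (y + z) <= rho' by rewrite le_max lexx orbT.
have inside (t : R) : 0 <= t < 1 -> cmod (y + t%:C%C * z) < rho'.
  move=> /andP[t0 t1].
  have -> : y + t%:C%C * z = (1 - t)%:C%C * y + t%:C%C * (y + z).
    by rewrite rmorphB /= rmorph1; ring.
  apply: le_lt_trans (cmodD _ _) _.
  rewrite !cmodM !cmod_real !ger0_norm ?subr_ge0 ?(ltW t1) //.
  have -> : rho' = (1 - t) * rho' + t * rho' by ring.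
  by apply: ltr_leD; [rewrite ltr_pM2l ?subr_gt0|rewrite ler_wpM2l].
have hb : coef_bounded (taylor a y) (cmod z) by exact: coef_bounded_cvg hG.
have E k := analytic_continuation ha' hb zp inside (tk01 k).
have lF := pseries_segment_limit ha' yr' yzr hF.
have lG := pseries_radial_limit hG.
apply: cvg_mx_unique lF _.
by under eq_fun do rewrite E.
Qed.

End TaylorSum.

(** Crude, but quadratic, which is all that the factors of Gauss's product and the derivative of the
    exponential require. For x < 1 it comes from (1 - x) e^x <= 1, multiplied by 1 + x. *)
Lemma expR_le_1DxDsq (R : realType) (x : R) : 0 <= x ->
  expR x <= 1 + x + x ^+ 2 * expR x.
Proof.
move=> x0; have e0 := expR_gt0 x.
have [x1|x1] := leP 1 x.
  apply: (@le_trans _ _ (x ^+ 2 * expR x)); last by rewrite lerDr addr_ge0.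
  by rewrite ler_peMl ?(ltW e0) // exprn_ege1.
rewrite -lerBlDr -{1}[expR x]mul1r -mulrBl.
have -> : 1 - x ^+ 2 = (1 + x) * (1 - x) by ring.
rewrite -mulrA ler_piMr ?addr_ge0 // -ler_pdivlMr // mul1r -expRN.
exact: expR_ge1Dx.
Qed.

(** * The matrix exponential *)

Section MatrixExponential.
Variables (R : realType) (N : nat).
Local Notation MC := 'M[R[i]]_N.+1.
Implicit Types (v : algnorm R N) (M X Y : MC).

Definition mxexp_term M : nat -> MC := fun k => k`!%:R^-1 *: M ^+ k.

Lemma nu_mxexp_term v M (rho : R) k : v M <= rho -> v (mxexp_term M k) <= exp_coeff rho k.
Proof.
move=> Mr; rewrite nuZ cmodV cmod_nat mulrC /exp_coeff /=.
rewrite ler_wpM2r ?invr_ge0 //; apply: le_trans (nuX _ _ _) _.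
by rewrite lerXn2r ?nnegrE ?nu_ge0 // (le_trans (nu_ge0 v M)).
Qed.

Lemma mxexp_cvg_tail v M (rho : R) : v M <= rho ->
  series (mxexp_term M) @ \oo --> mxexp M /\
  forall n, v (mxexp M - series (mxexp_term M) n) <= expR rho - series (exp_coeff rho) n.
Proof.
move=> Mr; have cv : series (exp_coeff rho) @ \oo --> expR rho by exact: is_cvg_series_exp_coeff.
have [L hL HL] := nu_dominated_series (fun k => nu_mxexp_term k Mr) cv.
by rewrite /mxexp (cvg_mx_lim hL); split.
Qed.

Lemma mxexp_cvg M : series (mxexp_term M) @ \oo --> mxexp M.
Proof. by case: (mxexp_cvg_tail (lexx (rownorm R N M))). Qed.

Arguments mxexp_cvg : clear implicits.

Lemma nu_mxexp v M : v (mxexp M) <= expR (v M).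
Proof.
have [_ /(_ 0%N)] := mxexp_cvg_tail (lexx (v M)).
by rewrite !seriesEnat /= !big_nil !subr0.
Qed.

Lemma nu_mxexp_linear v M (rho : R) : v M <= rho ->
  v (mxexp M - 1 - M) <= rho ^+ 2 * expR rho.
Proof.
move=> Mr; have [_ /(_ 2%N)] := mxexp_cvg_tail Mr.
rewrite !seriesEnat /= !big_nat_recr //= !big_nil !add0r /mxexp_term /exp_coeff /=.
rewrite !expr0 !expr1 invr1 !scale1r !divr1 opprD addrA => /le_trans; apply.
rewrite lerBlDl; exact: expR_le_1DxDsq (le_trans (nu_ge0 v M) Mr).
Qed.

Lemma mxexp_comm M X : X * M = M * X -> X * mxexp M = mxexp M * X.
Proof.
move=> XM; apply: cvg_mx_unique (cvg_mxMl (X := X) (mxexp_cvg M)) _.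
rewrite (_ : (fun n => _) = fun n => series (mxexp_term M) n * X).
  exact: cvg_mxMr (mxexp_cvg M).
apply/funext => n; rewrite !seriesEnat /= mulr_sumr mulr_suml; apply: eq_bigr => k _.
rewrite /mxexp_term -scalerAr -scalerAl; congr (_ *: _).
exact: (@commrX _ X M k XM).
Qed.

Lemma mxexpD X Y : X * Y = Y * X -> mxexp (X + Y) = mxexp X * mxexp Y.
Proof.
move=> XY; move: (rownorm R N) => v.
pose u i j := mxexp_term X i * mxexp_term Y j.
have bound n : \sum_(0 <= i < n) \sum_(0 <= j < n) v (u i j) <= expR (v X) * expR (v Y).
  apply: (@le_trans _ _ (series (exp_coeff (v X)) n * series (exp_coeff (v Y)) n)).
    rewrite !seriesEnat /= mulr_suml; apply: ler_sum => i _.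
    rewrite mulr_sumr; apply: ler_sum => j _.
    apply: le_trans (nuM _ _ _) _.
    by apply: ler_pM; rewrite ?nu_ge0 ?nu_mxexp_term.
  have h (x : R) : 0 <= x -> 0 <= series (exp_coeff x) n <= expR x.
    move=> x0; apply/andP; split.
      by rewrite seriesEnat /=; apply: sumr_ge0 => k _; exact: exp_coeff_ge0.
    apply: nondecreasing_cvgn_le; last exact: is_cvg_series_exp_coeff.
    by apply: nondecreasing_series => k _ _; exact: exp_coeff_ge0.
  have /andP[a1 a2] := h _ (nu_ge0 v X); have /andP[b1 b2] := h _ (nu_ge0 v Y).
  exact: ler_pM.
have [row [S [h1 h2 h3 _]]] := double_series bound.
have rowE : row = fun i => mxexp_term X i * mxexp Y.
  apply/funext => i; apply: cvg_mx_unique (h1 i) _.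
  rewrite (_ : series (u i) = fun n => mxexp_term X i * series (mxexp_term Y) n).
    exact: cvg_mxMl (mxexp_cvg Y).
  by apply/funext => n; rewrite !seriesEnat /= mulr_sumr.
have -> : mxexp X * mxexp Y = S.
  apply: cvg_mx_unique h2.
  rewrite rowE (_ : series _ = fun n => series (mxexp_term X) n * mxexp Y).
    exact: cvg_mxMr (mxexp_cvg X).
  by apply/funext => n; rewrite !seriesEnat /= mulr_suml.
apply: cvg_mx_unique (mxexp_cvg (X + Y)) _.
rewrite (_ : mxexp_term (X + Y) = fun k => \sum_(0 <= i < k.+1) u i (k - i)%N).
  exact: h3.
apply/funext => k; rewrite /mxexp_term addrC (exprDn_comm _ (esym XY)) scaler_sumr big_mkord.
apply: eq_bigr => i _; have ik : (i <= k)%N by rewrite -ltnS.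
have cYX : GRing.comm (Y ^+ (k - i)) (X ^+ i).
  by apply: commrX; apply: commr_sym; exact: commrX.
rewrite /u /mxexp_term -scalerAr -scalerAl scalerA -[_ *+ 'C(_, _)]scaler_nat scalerA cYX.
congr (_ *: _).
rewrite -(bin_fact ik) !natrM !invfM.
have b0 : ('C(k, i)%:R : R[i]) != 0 by rewrite pnatr_eq0 -lt0n bin_gt0.
rewrite mulrC mulrA; field.
by rewrite b0 !pnatr_eq0 -!lt0n !fact_gt0.
Qed.

Lemma mxexp0 : mxexp (0 : MC) = 1.
Proof.
apply: cvg_mx_lim; rewrite -cvg_shiftS.
rewrite (_ : (fun n => _) = cst 1); first exact: cvg_cst.
apply/funext => n; rewrite seriesEnat /= big_nat_recl //= expr0 invr1 scale1r.
by rewrite big1 ?addr0 // => i _; rewrite expr0n /= scaler0.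
Qed.

Lemma mxexpNK X : mxexp X * mxexp (- X) = 1.
Proof. by rewrite -mxexpD ?mulrN ?mulNr // subrr mxexp0. Qed.

Lemma cvg_scalar_mx (u : nat -> R[i]) (l : R[i]) :
  (fun n => complex.Re (u n)) @ \oo --> complex.Re l ->
  (fun n => complex.Im (u n)) @ \oo --> complex.Im l ->
  (fun n => (u n)%:M : MC) @ \oo --> (l%:M : MC).
Proof.
move=> hr hi; apply/(cvg_nuP (rownorm R N)); move: (rownorm R N) => v.
have d0 (f : nat -> R) a : f @ \oo --> a -> (fun n => `|f n - a|) @ \oo --> (0 : R).
  move=> h; rewrite -(normr0 R) -(subrr a).
  by apply: cvg_norm; apply: cvgB => //; exact: cvg_cst.
apply: (@squeeze_cvgr _ _ _ _ (cst 0) (fun n =>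
  `|complex.Re (u n) - complex.Re l| + `|complex.Im (u n) - complex.Im l|)).
- near=> n; rewrite nu_ge0 /= -raddfB nu_scalar; apply: le_trans (cmod_ReIm _) _.
  by rewrite !raddfB.
- exact: cvg_cst.
- by rewrite -[X in _ --> X]addr0; apply: cvgD; exact: d0.
Unshelve. all: by end_near.
Qed.

(** The right-hand side is shaped after [cos_coeff] and [sin_coeff]; for even k the factor
    [(odd k)%:R] cancels the term with [k.-1]. *)
Lemma imaginary_exprn (b : R) k : ((0 +i* b)%C : R[i]) ^+ k =
  (((~~ odd k)%:R * (-1) ^+ k./2 * b ^+ k) +i* ((odd k)%:R * (-1) ^+ k.-1./2 * b ^+ k))%C.
Proof.
elim: k => [|k IH]; first by rewrite !expr0 !mul1r !mul0r.
rewrite exprSr IH; apply/eqP; rewrite eq_complex /=; apply/andP; split; apply/eqP.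
  case: k {IH} => [|k] /=; first by rewrite !expr0 expr1; ring.
  rewrite uphalf_half; have [ko|ke] := boolP (odd k) => /=; first by ring.
  by rewrite add0n !exprS; ring.
by have [ko|ke] := boolP (odd k); rewrite /= ?exprSr; ring.
Qed.

Lemma scalar_exp_series (z : R[i]) n : series (mxexp_term (z%:M : MC)) n =
  (\sum_(0 <= k < n) z ^+ k / k`!%:R)%:M.
Proof.
rewrite seriesEnat /= raddf_sum /=; apply: eq_bigr => k _.
by rewrite /mxexp_term -[z%:M ^+ k]rmorphXn /= -mul_scalar_mx -scalar_mxM mulrC.
Qed.

(** Reconciles the polar form [cexp] with the exponential series, so that the scalar Gauss formula
    becomes the matrix one at a scalar matrix. *)
Lemma mxexp_scalar (z : R[i]) : mxexp (z%:M : MC) = (cexp z)%:M.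
Proof.
case: z => a b.
have nat_re (k : nat) : (k`!%:R : R[i])^-1 = ((k`!%:R)^-1)%:C%C.
  by rewrite fmorphV rmorph_nat.
have ha : mxexp ((a%:C%C)%:M : MC) = ((expR a)%:C%C)%:M.
  apply: cvg_mx_lim; rewrite (_ : series _ = fun n => (((series (exp_coeff a) n)%:C%C)%:M : MC)).
    apply: cvg_scalar_mx => /=; [exact: is_cvg_series_exp_coeff|exact: cvg_cst].
  apply/funext => n; rewrite scalar_exp_series seriesEnat /=; congr scalar_mx.
  by rewrite rmorph_sum /=; apply: eq_bigr => k _; rewrite nat_re -rmorphXn -rmorphM.
have hb : mxexp (((0 +i* b)%C)%:M : MC) = ((cos b +i* sin b)%C)%:M.
  apply: cvg_mx_lim; rewrite (_ : series _ = fun n =>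
      (((series (cos_coeff b) n +i* series (sin_coeff b) n)%C)%:M : MC)).
    apply: cvg_scalar_mx => /=.
      by rewrite unlock; exact: is_cvg_series_cos_coeff.
    by rewrite unlock; exact: is_cvg_series_sin_coeff.
  apply/funext => n; rewrite scalar_exp_series !seriesEnat /=.
  congr scalar_mx; elim: n => [|n IH]; first by rewrite !big_nil.
  rewrite !big_nat_recr //= IH imaginary_exprn nat_re.
  by apply/eqP; rewrite eq_complex /= !mulr0 subr0 add0r !eqxx.
have -> : ((a +i* b)%C)%:M = (a%:C%C)%:M + ((0 +i* b)%C)%:M :> MC.
  rewrite -raddfD; congr scalar_mx; apply/eqP; rewrite eq_complex /=.
  by rewrite addr0 add0r !eqxx.
rewrite mxexpD; last by rewrite -!mulmxE scalar_mxC.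
by rewrite ha hb /cexp /= -mulmxE -scalar_mxM.
Qed.

End MatrixExponential.
Arguments mxexp_cvg {R N} M.

(** * Gauss's product *)

Section InfiniteProducts.
Variables (R : realType) (N : nat) (v : algnorm R N).
Local Notation MC := 'M[R[i]]_N.+1.

(** If X Z = 0 then X = X (1 - Z), so |X| <= |X| |1 - Z| forces X = 0; a square matrix with zero
    kernel is invertible. The bound follows from Z^-1 = 1 + Z^-1 (1 - Z). *)
Lemma nu_unit (Z : MC) : v (1 - Z) < 1 ->
  Z \is a GRing.unit /\ v Z^-1 <= (1 - v (1 - Z))^-1.
Proof.
move=> q1; have Zu : Z \is a GRing.unit.
  have [//|nu] := boolP (Z \is a GRing.unit); suff : kermx Z == 0.
    by rewrite kermx_eq0 row_free_unit => h; rewrite -[_ \is a _]/(Z \in unitmx) h in nu.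
  set X := kermx Z; have XZ : X * Z = 0 by exact: mulmx_ker.
  have hX : X = X * (1 - Z) by rewrite mulrBr XZ subr0 mulr1.
  apply/eqP; apply: (@nu_eq0 _ _ v); apply/eqP; rewrite eq_le nu_ge0 andbT.
  have : v X <= v X * v (1 - Z) by rewrite {1}hX nuM.
  rewrite -subr_ge0 -{2}[v X]mulr1 -mulrBr; rewrite nmulr_lge0 //.
  by rewrite subr_lt0.
split => //; have h0 : 0 < 1 - v (1 - Z) by rewrite subr_gt0.
rewrite -[leRHS]mul1r ler_pdivlMr // mulrBr mulr1 lerBlDr.
apply: (@le_trans _ _ (v (1 + Z^-1 * (1 - Z)))).
  by rewrite mulrBr mulr1 mulVr // addrCA subrr addr0.
by apply: le_trans (nuD _ _ _) _; rewrite nu1 lerD2l nuM.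
Qed.

(** Turns errors of order k / m^2 into telescoping differences, whose sum from n on is at most 2 k /
    n. *)
Lemma inv_sq_le_telescope (m : nat) : (0 < m)%N ->
  (m%:R ^+ 2)^-1 <= 2 * (m%:R^-1 - m.+1%:R^-1) :> R.
Proof.
move=> m0; have m0' : 0 < m%:R :> R by rewrite ltr0n.
have m1' : 0 < m.+1%:R :> R by rewrite ltr0n.
have -> : 2 * (m%:R^-1 - m.+1%:R^-1) = 2 / (m%:R * m.+1%:R) :> R.
  rewrite -(natr1 m); field; rewrite natr1 !gt_eqF //.
rewrite ler_pdivlMr ?mulr_gt0 // mulrC ler_pdivrMr ?exprn_gt0 // expr2.
by rewrite mulrCA ler_pM2l // -natrM ler_nat; lia.
Qed.

Variables (H E : nat -> MC) (k : R) (n : nat).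
Hypothesis n0 : (0 < n)%N.
Hypothesis k0 : 0 <= k.
Hypothesis HE : forall m, (n <= m)%N -> H m.+1 = H m * (1 + E m).
Hypothesis Ek : forall m, (n <= m)%N -> v (E m) <= k / m%:R ^+ 2.

Let B := v (H n) * expR (2 * k / n%:R).

(** The factor [expR (2 * k / m%:R)] prepays all the steps from m on. This weighted norm does not
    increase, which makes the induction close. *)
Let Hbound m : (n <= m)%N -> v (H m) * expR (2 * k / m%:R) <= B.
Proof.
elim: m => [|m IH]; first by rewrite leqn0 => /eqP n00; move: (n0); rewrite n00.
rewrite leq_eqVlt => /orP[/eqP <- //|nm]; rewrite ltnS in nm.
apply: le_trans (IH nm); rewrite HE //.
have m0 : (0 < m)%N by exact: leq_trans n0 nm.
apply: (@le_trans _ _ (v (H m) * expR (k / m%:R ^+ 2) * expR (2 * k / m.+1%:R))).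
  rewrite ler_wpM2r ?expR_ge0 //; apply: le_trans (nuM _ _ _) _.
  rewrite ler_wpM2l ?nu_ge0 //; apply: le_trans (nuD _ _ _) _; rewrite nu1.
  by apply: le_trans (expR_ge1Dx _); rewrite lerD2l Ek.
rewrite -mulrA -expRD ler_wpM2l ?nu_ge0 // ler_expR -lerBrDr -mulrBr.
by rewrite -mulrA mulrCA ler_wpM2l // inv_sq_le_telescope.
Qed.

Lemma nu_prod_le m : (n <= m)%N -> v (H m) <= v (H n) * expR (2 * k / n%:R).
Proof.
move=> nm; apply: le_trans (Hbound nm); rewrite ler_peMr ?nu_ge0 //.
by rewrite -expR0 ler_expR divr_ge0 ?mulr_ge0.
Qed.

Let Hdiff m : (n <= m)%N ->
  v (H m.+1 - H m) <= B * (2 * k) * (m%:R^-1 - m.+1%:R^-1).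
Proof.
move=> nm; rewrite HE // mulrDr mulr1 addrAC subrr add0r.
apply: le_trans (nuM _ _ _) _; rewrite -mulrA.
apply: ler_pM; rewrite ?nu_ge0 ?nu_prod_le //; apply: le_trans (Ek nm) _.
by rewrite -mulrA mulrCA ler_wpM2l // inv_sq_le_telescope // (leq_trans n0).
Qed.

Lemma prod_cvg : exists2 L : MC, H @ \oo --> L &
  forall m, (n <= m)%N -> v (L - H m) <= v (H n) * expR (2 * k / n%:R) * (2 * k) / m%:R.
Proof.
have tail (m : nat) : (n <= m)%N -> exists2 L : MC, H @ \oo --> L &
    v (L - H m) <= B * (2 * k) / m%:R.
  move=> nm.
  pose u j := H (j + m).+1 - H (j + m)%N.
  pose f j := B * (2 * k) * ((j + m)%:R^-1 - (j + m).+1%:R^-1).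
  have uf j : v (u j) <= f j by apply: Hdiff; rewrite (leq_trans nm) // leq_addl.
  have sf : series f = fun j => B * (2 * k) * (m%:R^-1 - (j + m)%:R^-1).
    apply/funext; elim => [|j IH].
      by rewrite seriesEnat /= big_nil add0n subrr mulr0.
    move: IH; rewrite !seriesEnat /= => IH; rewrite big_nat_recr //= IH /f.
    by rewrite addSn; ring.
  have su : series u = fun j => H (j + m)%N - H m.
    apply/funext; elim => [|j IH].
      by rewrite seriesEnat /= big_nil add0n subrr.
    move: IH; rewrite !seriesEnat /= => IH; rewrite big_nat_recr //= IH /u addSn.
    by rewrite addrC addrA subrK.
  have fl : series f @ \oo --> B * (2 * k) / m%:R.
    rewrite sf (_ : B * (2 * k) / m%:R = B * (2 * k) * (m%:R^-1 - 0)); last by rewrite subr0.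
    apply: cvgMr; apply: cvgB; first exact: cvg_cst.
    have h := @cvg_harmonic R; rewrite -(cvg_shiftn m) in h.
    rewrite -cvg_shiftS; apply: cvg_trans h; apply: near_eq_cvg; near=> j.
    by rewrite /= addSn.
  have [L hL HL] := nu_dominated_series uf fl.
  exists (L + H m).
    rewrite -(cvg_shiftn m).
    rewrite (_ : (fun j => _) = fun j => series u j + H m).
      exact: cvg_mxD hL (cvg_cst _).
    by apply/funext => j; rewrite su subrK.
  have := HL 0%N; rewrite !seriesEnat /= !big_nil !subr0 addrK.
  by [].
have [L hL _] := tail n (leqnn n).
exists L => // m nm; have [L' hL' h] := tail m nm.
by rewrite (cvg_mx_unique hL hL').
Unshelve. all: by end_near.
Qed.

End InfiniteProducts.

(* Otherwise unification unfolds the limit defining mxexp and diverges. *)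
Opaque mxexp.

Section GaussProduct.
Variables (R : realType) (N : nat).
Local Notation MC := 'M[R[i]]_N.+1.
Implicit Types (v : algnorm R N) (M X Y : MC).

Lemma pochmxS M n : pochmx M n.+1 = pochmx M n * (M + n%:R%:M).
Proof. by rewrite /pochmx big_ord_recr. Qed.

Lemma pochmx0 M : pochmx M 0 = 1.
Proof. by rewrite /pochmx big_ord0. Qed.

Lemma pochmxD M l m : pochmx M (l + m) = pochmx M l * pochmx (M + l%:R%:M) m.
Proof.
elim: m => [|m IH]; first by rewrite addn0 pochmx0 mulr1.
by rewrite addnS !pochmxS IH -mulrA -addrA -raddfD -natrD.
Qed.

Lemma pochmx_comm X M n : X * M = M * X -> X * pochmx M n = pochmx M n * X.
Proof.
move=> XM; rewrite /pochmx; apply: commr_prod => i _; apply: commrD => //.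
by rewrite /GRing.comm -!mulmxE scalar_mxC.
Qed.

Lemma pochmx_unit M n : (forall k, M + k%:R%:M \is a GRing.unit) ->
  pochmx M n \is a GRing.unit.
Proof.
move=> h; elim: n => [|n IH]; first by rewrite pochmx0 unitr1.
by rewrite pochmxS unitrMr ?h.
Qed.

(** The reciprocal of Gauss's approximation n! n^M / (M (M + 1) ... (M + n)): without inverses of
    matrices, it makes sense for every M. *)
Definition gauss_mx (n : nat) M : MC :=
  n`!%:R^-1 *: (pochmx M n.+1 * mxexp ((- ln n%:R)%:C%C *: M)).

Definition rgauss M : MC := limn (gauss_mx ^~ M).

Lemma gauss_comm X M n : X * M = M * X -> X * gauss_mx n M = gauss_mx n M * X.
Proof.
move=> XM; rewrite /gauss_mx -scalerAr -scalerAl; congr (_ *: _).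
rewrite mulrA (pochmx_comm _ XM) -!mulrA; congr (_ * _); apply: mxexp_comm.
by rewrite -scalerAr -scalerAl XM.
Qed.

(** The factor passing from n to n + 1 is (1 + M / (n + 1)) (n / (n + 1))^M. Its first-order terms
    nearly cancel, since ln (n + 1) - ln n differs from 1 / (n + 1) by O(1 / n^2). *)
Definition gauss_step M (n : nat) : MC :=
  (1 + (n.+1%:R^-1 : R[i]) *: M) * mxexp ((ln n%:R - ln n.+1%:R : R)%:C%C *: M) - 1.

Lemma gauss_mxS M n : gauss_mx n.+1 M = gauss_mx n M * (1 + gauss_step M n).
Proof.
rewrite /gauss_step addrC subrK /gauss_mx pochmxS -scalerAl.
have -> : (- ln n.+1%:R : R)%:C%C *: M =
    (- ln n%:R : R)%:C%C *: M + (ln n%:R - ln n.+1%:R : R)%:C%C *: M.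
  by rewrite -scalerDl -rmorphD /= addKr.
set X := (- ln n%:R : R)%:C%C *: M; set Y := (ln n%:R - ln n.+1%:R : R)%:C%C *: M.
rewrite mxexpD; last by rewrite /X /Y -!scalerAr -!scalerAl scalerA mulrC -scalerA.
have e : n.+1%:R *: (1 + (n.+1%:R^-1 : R[i]) *: M) = M + n.+1%:R%:M.
  by rewrite scalerDr scalerA divff ?pnatr_eq0 // scale1r scalemx1 addrC.
have c : (M + n.+1%:R%:M) * mxexp X = mxexp X * (M + n.+1%:R%:M).
  apply: mxexp_comm; rewrite /X -scalerAr -scalerAl; congr (_ *: _).
  by rewrite mulrDl mulrDr -!mulmxE scalar_mxC.
rewrite -!mulrA [(M + _) * (mxexp X * _)]mulrA c -e.
rewrite -!mulrA -!scalerAl -!scalerAr scalerA factS natrM invfM.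
by rewrite mulrAC mulVf ?pnatr_eq0 // mul1r.
Qed.

Lemma ln_step (n : nat) : (0 < n)%N ->
  n.+1%:R^-1 <= ln n.+1%:R - ln n%:R :> R /\ ln n.+1%:R - ln n%:R <= n%:R^-1 :> R.
Proof.
move=> n0; have p0 : 0 < n%:R :> R by rewrite ltr0n.
have p1 : 0 < n.+1%:R :> R by rewrite ltr0n.
split.
  rewrite -opprB -ln_div ?posrE // lerNr -{1}(subKr 1 (n%:R / n.+1%:R)).
  have -> : 1 - (1 - n%:R / n.+1%:R) = 1 + (- n.+1%:R^-1) :> R.
    by rewrite -[n.+1%:R]natr1; field; rewrite natr1 gt_eqF.
  by apply: le_ln1Dx; rewrite ltrN2 invf_lt1 // ltr1n.
rewrite -ln_div ?posrE //.
have -> : n.+1%:R / n%:R = 1 + n%:R^-1 :> R.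
  by rewrite -natr1 mulrDl divff ?gt_eqF // mul1r.
by apply: le_ln1Dx; apply: lt_le_trans (ltrN10 _) _; rewrite invr_ge0 ltW.
Qed.

(** In units of (r / n)^2: 1 for the first-order terms, 1 for their product, and 2 e for the
    remainder of the exponential, multiplied by [1 + a *: M], of norm at most 2. *)
Definition gauss_const : R := 2 + 2 * expR 1.

Lemma nu_gauss_step v M (r : R) (n : nat) : 1 <= r -> r <= n%:R -> v M <= r ->
  v (gauss_step M n) <= gauss_const * r ^+ 2 / n%:R ^+ 2.
Proof.
move=> r1 rn Mr; have p0 : 0 < n%:R :> R by apply: lt_le_trans rn; apply: lt_le_trans r1.
have n0 : (0 < n)%N by rewrite -(ltr0n R).
have r0 : 0 <= r by apply: le_trans r1.
have [l1 l2] := ln_step n0.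
set h := ln n.+1%:R - ln n%:R in l1 l2.
have h0 : 0 <= h by apply: le_trans l1; rewrite invr_ge0.
set X := (ln n%:R - ln n.+1%:R : R)%:C%C *: M.
have Xn : v X <= r / n%:R.
  rewrite /X nuZ cmod_real -normrN opprB ger0_norm // mulrC.
  by apply: ler_pM => //; exact: nu_ge0.
have q1 : r / n%:R <= 1 by rewrite ler_pdivrMr // mul1r.
pose D := mxexp X - 1 - X.
have hD : v D <= (r / n%:R) ^+ 2 * expR 1.
  apply: le_trans (nu_mxexp_linear Xn) _.
  by rewrite ler_wpM2l ?sqr_ge0 // ler_expR.
pose a : R[i] := n.+1%:R^-1.
have ca : cmod a = n.+1%:R^-1 by rewrite /a cmodV cmod_nat.
have an : cmod a <= n%:R^-1.
  by rewrite ca lef_pV2 ?posrE ?ltr0n // ler_nat.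
have aM : v (a *: M) <= r / n%:R.
  by rewrite nuZ mulrC; apply: ler_pM => //; [exact: nu_ge0|exact: cmod_ge0].
have -> : gauss_step M n = (a *: M + X) + (a *: M) * X + (1 + a *: M) * D.
  rewrite /gauss_step -/X -/a.
  have -> : mxexp X = D + (1 + X) by rewrite /D [1 + X]addrC addrA !subrK.
  have e2 : (1 + a *: M) * (1 + X) = 1 + (a *: M + X + a *: M * X).
    by rewrite mulrDl mul1r mulrDr mulr1 -!addrA; congr (1 + _); rewrite addrCA.
  by rewrite mulrDr e2 [X in _ + X - 1]addrC addrA addrK addrC.
have h1 : v (a *: M + X) <= r / n%:R ^+ 2.
  rewrite /X -scalerDl nuZ mulrC.
  have -> : a + (ln n%:R - ln n.+1%:R : R)%:C%C = (n.+1%:R^-1 - h)%:C%C.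
    by rewrite /a /h opprB [RHS](rmorphD (real_complex R)) fmorphV rmorph_nat.
  rewrite cmod_real; apply: ler_pM => //; first exact: nu_ge0.
  rewrite ler0_norm ?subr_le0 // opprB.
  apply: (@le_trans _ _ (n%:R^-1 - n.+1%:R^-1)); first by rewrite lerD2r.
  have p1 : 0 < n.+1%:R :> R by rewrite ltr0n.
  have -> : n%:R^-1 - n.+1%:R^-1 = (n%:R * n.+1%:R)^-1 :> R.
    by rewrite -[n.+1%:R]natr1; field; rewrite natr1 !gt_eqF.
  by rewrite lef_pV2 ?posrE ?mulr_gt0 // expr2 ler_pM2l // ler_nat.
have h2 : v ((a *: M) * X) <= (r / n%:R) ^+ 2.
  by apply: le_trans (nuM _ _ _) _; rewrite expr2; apply: ler_pM; rewrite ?nu_ge0.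
have h3 : v ((1 + a *: M) * D) <= 2 * ((r / n%:R) ^+ 2 * expR 1).
  apply: le_trans (nuM _ _ _) _; apply: ler_pM; rewrite ?nu_ge0 //.
  by apply: le_trans (nuD _ _ _) _; rewrite nu1 lerD2l (le_trans aM).
apply: le_trans (nuD _ _ _) _.
have h4 : r / n%:R ^+ 2 <= (r / n%:R) ^+ 2.
  by rewrite expr_div_n ler_wpM2r ?invr_ge0 ?sqr_ge0 // expr2 ler_peMl.
have -> : gauss_const * r ^+ 2 / n%:R ^+ 2 =
    ((r / n%:R) ^+ 2 + (r / n%:R) ^+ 2) + 2 * ((r / n%:R) ^+ 2 * expR 1).
  by rewrite /gauss_const expr_div_n; ring.
apply: lerD h3; apply: le_trans (nuD _ _ _) _; apply: lerD => //.
exact: le_trans h1 h4.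
Qed.

Lemma gauss_const_ge0 : 0 <= gauss_const.
Proof. by rewrite addr_ge0 // mulr_ge0 // expR_ge0. Qed.

(** The starting index n also bounds the norm of M. The errors are then k / m^2 with k =
    [gauss_const * n%:R ^+ 2], and their total effect exp(2 k / n) is only exponential in n. The
    decay of 1/Gamma along n P + Q rests on this. *)
Lemma rgauss_cvg_tail v M (n : nat) : (0 < n)%N -> v M <= n%:R ->
  gauss_mx ^~ M @ \oo --> rgauss M /\
  forall m, (n <= m)%N ->
    v (gauss_mx m M) <= v (gauss_mx n M) * expR (2 * gauss_const * n%:R) /\
    v (rgauss M - gauss_mx m M) <= v (gauss_mx n M) *
      expR (2 * gauss_const * n%:R) * (2 * (gauss_const * n%:R ^+ 2)) / m%:R.
Proof.
move=> n0 nM; have p0 : 0 < n%:R :> R by rewrite ltr0n.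
have k0 : 0 <= gauss_const * n%:R ^+ 2 by rewrite mulr_ge0 ?gauss_const_ge0 ?sqr_ge0.
have HE m : (n <= m)%N -> gauss_mx m.+1 M = gauss_mx m M * (1 + gauss_step M m).
  by move=> _; exact: gauss_mxS.
have Ek m : (n <= m)%N -> v (gauss_step M m) <= gauss_const * n%:R ^+ 2 / m%:R ^+ 2.
  by move=> nm; apply: nu_gauss_step => //; rewrite ?ler1n ?ler_nat.
have e : 2 * (gauss_const * n%:R ^+ 2) / n%:R = 2 * gauss_const * n%:R.
  by field; rewrite gt_eqF.
have [L hL HL] := prod_cvg n0 k0 HE Ek.
have <- : L = rgauss M by rewrite /rgauss (cvg_mx_lim hL).
split; first exact: hL.
move=> m nm; rewrite -e; split; last exact: HL.
exact: (nu_prod_le n0 k0 HE Ek nm).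
Qed.

Lemma ex_nat_ge (x : R) : exists2 n : nat, (0 < n)%N & x <= n%:R.
Proof.
exists (Num.bound x).+1 => //; apply: le_trans (ler_norm x) _.
apply: le_trans (ltW (archi_boundP (normr_ge0 x))) _.
by rewrite ler_nat -[X in (_ <= X)%N]/((Num.bound x).+1) /Num.bound normr_id leqnSn.
Qed.

Lemma rgauss_cvg M : gauss_mx ^~ M @ \oo --> rgauss M.
Proof.
have [n n0 nM] := ex_nat_ge (rownorm R N M).
by case: (rgauss_cvg_tail n0 nM).
Qed.

Lemma nu_rgauss v M (n : nat) : (0 < n)%N -> v M <= n%:R ->
  v (rgauss M) <= v (gauss_mx n M) * expR (2 * gauss_const * n%:R).
Proof.
move=> n0 nM; have [h H] := rgauss_cvg_tail n0 nM.
apply: (cvg_nu_le h); near=> m; apply: (H m _).1.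
by near: m; exact: nbhs_infty_ge.
Unshelve. all: by end_near.
Qed.

Lemma nu_gauss_mx v M (r : R) (n : nat) : v M <= r -> (0 < n)%N ->
  v (gauss_mx n M) <= (\prod_(k < n.+1) (r + k%:R)) * expR (ln n%:R * r).
Proof.
move=> Mr n0; have r0 : 0 <= r by apply: le_trans Mr; exact: nu_ge0.
rewrite /gauss_mx nuZ cmodV cmod_nat; apply: le_trans (ler_piMl _ _) _.
- exact: nu_ge0.
- by rewrite invf_le1 ?ltr0n ?fact_gt0 // ler1n fact_gt0.
apply: le_trans (nuM _ _ _) _; apply: ler_pM; rewrite ?nu_ge0 //.
  apply: le_trans (nu_prod _ _ _ _) _; apply: ler_prod => k _; rewrite nu_ge0 /=.
  apply: le_trans (nuD _ _ _) _; apply: lerD => //.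
  by rewrite nu_scalar cmod_nat.
apply: le_trans (nu_mxexp _ _) _; rewrite ler_expR nuZ cmod_real normrN.
rewrite ger0_norm ?ln_ge0 ?ler1n //; rewrite ler_wpM2l // ln_ge0 // ler1n //.
Qed.

Lemma rgauss_cvg_unif v (r e : R) : 0 < e -> exists2 m : nat, (0 < m)%N &
  forall M, v M <= r -> v (rgauss M - gauss_mx m M) <= e.
Proof.
move=> e0; have [n n0 rn] := ex_nat_ge r.
pose K := (\prod_(k < n.+1) (n%:R + k%:R)) * expR (ln n%:R * n%:R) *
  expR (2 * gauss_const * n%:R) * (2 * (gauss_const * n%:R ^+ 2)).
have [m0 m00 hm0] := ex_nat_ge (K / e).
exists (maxn n m0) => [|M Mr]; first by rewrite leq_max n0.
have nM := le_trans Mr rn; have [h H] := rgauss_cvg_tail n0 nM.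
apply: le_trans (H _ (leq_maxl _ _)).2 _.
have mp : 0 < (maxn n m0)%:R :> R by rewrite ltr0n leq_max n0.
rewrite ler_pdivrMr // (@le_trans _ _ K) //.
  apply: ler_wpM2r; first by rewrite !mulr_ge0 ?gauss_const_ge0 ?sqr_ge0.
  by apply: ler_wpM2r; [exact: expR_ge0|exact: nu_gauss_mx].
rewrite mulrC -ler_pdivrMr // (le_trans hm0) // ler_nat.
exact: leq_maxr.
Qed.

Lemma rgauss_comm X M : X * M = M * X -> X * rgauss M = rgauss M * X.
Proof.
move=> XM; apply: cvg_mx_unique (cvg_mxMl (X := X) (rgauss_cvg (M := M))) _.
under eq_fun do rewrite (gauss_comm _ XM).
exact: cvg_mxMr (rgauss_cvg (M := M)).
Qed.

Lemma mxexp_small M : (fun n => mxexp ((ln n.+1%:R - ln n%:R : R)%:C%C *: M)) @ \oo --> (1 : MC).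
Proof.
apply/(cvg_nuP (rownorm R N)); move: (rownorm R N) => v.
have h0 : (fun n => v M * n%:R^-1) @ \oo --> (0 : R).
  rewrite -(mulr0 (v M)); apply: cvgMr; rewrite -cvg_shiftS; exact: cvg_harmonic.
have h1 : (fun n => v M * n%:R^-1 + (v M * n%:R^-1) ^+ 2 * expR (v M * n%:R^-1)) @ \oo --> (0 : R).
  rewrite -[X in _ --> X]addr0; apply: cvgD => //.
  rewrite -[X in _ --> X](mul0r (expR 0)); apply: cvgM.
    by rewrite -[X in _ --> X](mul0r 0); under eq_fun do rewrite expr2; apply: cvgM.
  by apply: continuous_cvg h0; exact: continuous_expR.
apply: (@squeeze_cvgr _ _ _ _ (cst 0) _ _ _ _ _ h1); last exact: cvg_cst.
near=> n; rewrite nu_ge0 /=.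
have n0 : (0 < n)%N by near: n; exact: nbhs_infty_gt.
have [l1 l2] := ln_step n0.
set X := _ *: M; have XM : v X <= v M * n%:R^-1.
  rewrite /X nuZ cmod_real ger0_norm; last by apply: le_trans l1; rewrite invr_ge0.
  by rewrite mulrC ler_wpM2l ?nu_ge0.
have -> : mxexp X - 1 = X + (mxexp X - 1 - X) by rewrite [RHS]addrC subrK.
by apply: le_trans (nuD _ _ _) _; apply: lerD => //; exact: nu_mxexp_linear.
Unshelve. all: by end_near.
Qed.

(** The functional equation of 1/Gamma. Exactly, for n > 0, M times the n-th product at M + 1 is the
    (n + 1)-th product at M times [w n] = ((n + 1) / n) ((n + 1) / n)^M, which tends to 1. *)
Lemma rgauss_rec M : rgauss M = M * rgauss (M + 1).
Proof.
apply: esym; apply: cvg_mx_unique (cvg_mxMl (X := M) (rgauss_cvg (M := M + 1))) _.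
pose w n : MC := (n.+1%:R / n%:R : R[i]) *: mxexp ((ln n.+1%:R - ln n%:R : R)%:C%C *: M).
have hw : w @ \oo --> (1 : MC).
  have hs : (fun n => ((n.+1%:R / n%:R)%:M : MC)) @ \oo --> (1%:M : MC).
    have e n : (n.+1%:R / n%:R : R[i]) = (n.+1%:R / n%:R : R)%:C%C.
      by rewrite fmorph_div !rmorph_nat.
    under eq_fun do rewrite e.
    apply: (cvg_scalar_mx (l := 1)) => /=; last exact: cvg_cst.
    rewrite -cvg_shiftS.
    have : (fun n => 1 + harmonic n) @ \oo --> (1 + 0 : R).
      by apply: cvgD; [exact: cvg_cst|exact: cvg_harmonic].
    rewrite addr0; apply: cvg_trans; apply: near_eq_cvg; near=> n.
    by rewrite /harmonic /= -[n.+2%:R]natr1 mulrDl divff ?pnatr_eq0 // mul1r.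
  have := cvg_mxM hs (mxexp_small M); rewrite mulr1; apply: cvg_trans.
  by apply: near_eq_cvg; near=> n; exact: mul_scalar_mx.
have h1 : (fun n => gauss_mx n.+1 M) @ \oo --> rgauss M.
  rewrite (cvg_shiftS (gauss_mx ^~ M)); exact: rgauss_cvg.
have := cvg_mxM h1 hw; rewrite mulr1; apply: cvg_trans; apply: near_eq_cvg; near=> n.
have n0 : (0 < n)%N by near: n; exact: nbhs_infty_gt.
rewrite /gauss_mx /w -!scalerAl -!scalerAr scalerA.
have -> : pochmx M n.+2 = M * pochmx (M + 1) n.+1.
  by rewrite -[n.+2]/(1 + n.+1)%N pochmxD pochmxS pochmx0 mul1r raddf0 addr0.
set t := (- ln n%:R : R)%:C%C.
have -> : (- ln n.+1%:R : R)%:C%C *: M =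
    t *: M - (ln n.+1%:R - ln n%:R : R)%:C%C *: M.
  by rewrite -scalerBl -rmorphB /= opprB addrA addNr add0r.
set Y := (ln n.+1%:R - ln n%:R : R)%:C%C *: M.
have cY : t *: M * (- Y) = (- Y) * (t *: M).
  by rewrite /Y mulrN mulNr -!scalerAr -!scalerAl scalerA mulrC -scalerA.
rewrite mxexpD // -!mulrA.
have hY := mxexpNK (- Y); rewrite opprK in hY.
rewrite [X in mxexp (t *: M) * X]hY.
rewrite mulr1 scalerDr mxexpD; last first.
  by rewrite -scalerAr mulr1 -[RHS]scalerAl mul1r.
have -> : mxexp (t *: (1 : MC)) = ((n%:R^-1 : R[i])%:M : MC).
  rewrite scalemx1 mxexp_scalar /cexp /t /= cos0 sin0.
  congr (_%:M); rewrite expRN lnK ?posrE ?ltr0n //.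
  rewrite -(rmorph_nat (real_complex R)) -fmorphV.
  by apply/eqP; rewrite eq_complex /= !mulr0 !mul0r !mulr1 subr0 addr0 !eqxx.
rewrite [_ * _%:M](_ : _ = n%:R^-1 *: mxexp (t *: M)); last first.
  by rewrite -[RHS]mul_scalar_mx -scalar_mxC.
rewrite -!scalerAr scalerA; congr (_ *: _).
rewrite factS natrM invfM; field.
by rewrite nat1r !pnatr_eq0 -!lt0n fact_gt0 n0.
Unshelve. all: by end_near.
Qed.

Lemma rgauss_pochmx M l : rgauss M = pochmx M l * rgauss (M + l%:R%:M).
Proof.
elim: l => [|l IH]; first by rewrite pochmx0 mul1r raddf0 addr0.
rewrite pochmxS -mulrA IH; congr (_ * _); rewrite rgauss_rec.
congr (_ * rgauss _); rewrite -addrA; congr (M + _).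
by rewrite -(natr1 l) raddfD.
Qed.

Lemma mxexp_unit X : mxexp X \is a GRing.unit.
Proof.
apply/unitrP; exists (mxexp (- X)); split; last exact: mxexpNK.
have h := mxexpNK (- X); rewrite opprK in h; exact: h.
Qed.

Lemma gauss_mx_unit n M : (forall k, M + k%:R%:M \is a GRing.unit) ->
  gauss_mx n M \is a GRing.unit.
Proof.
move=> h; rewrite /gauss_mx scaler_unit; last first.
  by rewrite unitfE invr_eq0 pnatr_eq0 -lt0n fact_gt0.
by rewrite unitrMr ?mxexp_unit // pochmx_unit.
Qed.

(** Each finite product is invertible, but a limit of units need not be. The product restarted from
    a large index n has value 1 there and a limit at distance below 1 from it, hence an invertible
    limit. *)
Lemma rgauss_unit M : (forall k, M + k%:R%:M \is a GRing.unit) ->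
  rgauss M \is a GRing.unit.
Proof.
move=> hM; have [v _] : exists v, v = rownorm R N by exists (rownorm R N).
have [r r0 rM] := ex_nat_ge (v M).
pose k := gauss_const * r%:R ^+ 2.
have k0 : 0 <= k by rewrite mulr_ge0 ?gauss_const_ge0 ?sqr_ge0.
have [m m0 hm] := ex_nat_ge (expR (2 * k) * (2 * k) + 1).
pose n := maxn m r; have n0 : (0 < n)%N by rewrite leq_max m0.
have gu := gauss_mx_unit n hM.
pose H j := (gauss_mx n M)^-1 * gauss_mx j M.
have HE j : (n <= j)%N -> H j.+1 = H j * (1 + gauss_step M j).
  by move=> _; rewrite /H gauss_mxS mulrA.
have Ek j : (n <= j)%N -> v (gauss_step M j) <= k / j%:R ^+ 2.
  move=> nj; apply: nu_gauss_step => //; rewrite ?ler1n ?ler_nat //.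
  by apply: leq_trans nj; rewrite leq_maxr.
have [L hL /(_ n (leqnn n)) HL] := prod_cvg n0 k0 HE Ek.
have Hn : H n = 1 by rewrite /H mulVr.
have LE : L = (gauss_mx n M)^-1 * rgauss M.
  exact: cvg_mx_unique hL (cvg_mxMl (rgauss_cvg (M := M))).
have nR : 0 < n%:R :> R by rewrite ltr0n.
have Lu : L \is a GRing.unit.
  apply: (@nu_unit _ _ v _ _).1; rewrite nu_subC -{1}Hn.
  apply: le_lt_trans HL _; rewrite Hn nu1 mul1r ltr_pdivrMr // mul1r.
  apply: (@le_lt_trans _ _ (expR (2 * k) * (2 * k))).
    have k2 : 0 <= 2 * k by exact: mulr_ge0.
    apply: ler_wpM2r => //; rewrite ler_expR ler_pdivrMr //.
    by apply: ler_peMr => //; rewrite ler1n.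
  apply: (@lt_le_trans _ _ (m%:R)); first by apply: lt_le_trans hm; rewrite ltrDl.
  by rewrite ler_nat leq_maxl.
have -> : rgauss M = gauss_mx n M * L by rewrite LE mulrA mulrV // mul1r.
by rewrite unitrMl.
Qed.

End GaussProduct.

(** * The contour integral of the reciprocal Gamma function *)

Section RealIntegrals.
Variable R : realType.
Local Notation mu := (@lebesgue_measure R).
Implicit Types (f g F : R -> R).

Lemma Rintegral_FTC2 F f (a b : R) : a < b ->
  (forall x, a <= x <= b -> is_derive x 1 F (f x)) ->
  (forall x, a <= x <= b -> {for x, continuous f}) ->
  \int[mu]_(x in `[a, b]) f x = F b - F a.
Proof.
move=> ab dF cf.
have cF x : a <= x <= b -> {for x, continuous F}.
  move=> xab; apply: differentiable_continuous; apply/derivable1_diffP.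
  by have [] := dF x xab.
have lt x : x \in `]a, b[ -> a <= x <= b.
  by rewrite in_itv /= => /andP[/ltW -> /ltW ->].
rewrite /Rintegral (@continuous_FTC2 _ f F a b ab) //.
- apply: continuous_in_subspaceT => x; rewrite inE /= in_itv /= => xab.
  exact: cf.
- split.
  + by move=> x /lt xab; have [] := dF x xab.
  + by apply: cvg_at_right_filter; apply: cF; rewrite lexx ltW.
  + by apply: cvg_at_left_filter; apply: cF; rewrite lexx ltW.
- move=> x /lt xab; by rewrite derive1E; have [_ ->] := dF x xab.
Qed.

Lemma Rintegral_dominated (D : set R) (p : nat -> R -> R) f g : measurable D ->
  (forall n, measurable_fun D (p n)) -> (forall t, D t -> p ^~ t @ \oo --> f t) ->
  mu.-integrable D (EFin \o g) -> (forall n t, D t -> `|p n t| <= g t) ->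
  (fun n => \int[mu]_(t in D) p n t) @ \oo --> \int[mu]_(t in D) f t.
Proof.
move=> mD mp pf ig pg.
have mf : measurable_fun D f by exact: measurable_fun_cvg mp pf.
have me (h : R -> R) : measurable_fun D h -> measurable_fun D (EFin \o h).
  by move=> mh; apply/measurable_EFinP.
have intp n : mu.-integrable D (EFin \o p n).
  apply: le_integrable ig => //; first exact: me.
  by move=> t Dt; rewrite /= lee_fin (le_trans (pg n t Dt)) // ler_norm.
have [intf _ h] : [/\ mu.-integrable D (EFin \o f),
    [sequence (\int[mu]_(x in D) `|(p n x)%:E - (f x)%:E|)%E]_n @ \oo --> 0%E &
    [sequence (\int[mu]_(x in D) (p n x)%:E)%E]_n @ \oo --> (\int[mu]_(x in D) (f x)%:E)%E].
  apply: (@dominated_convergence _ _ R mu D mD (fun n => EFin \o p n)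
    (EFin \o f) (EFin \o g)) => //.
  - by move=> n; exact: me.
  - exact: me.
  - apply: aeW => t Dt; apply: cvg_EFin; first exact: nearW.
    exact: (pf t Dt).
  - by apply: aeW => t n Dt; rewrite /= lee_fin pg.
apply: fine_cvg; rewrite fineK; last exact: integrable_fin_num.
exact: h.
Qed.

End RealIntegrals.

Section ContourIntegrals.
Variable R : realType.
Local Notation mu := (@lebesgue_measure R).
Implicit Types (f g : R -> R[i]) (h : R -> R).

Definition ccontinuous f :=
  continuous (fun t => complex.Re (f t)) /\ continuous (fun t => complex.Im (f t)).

Lemma continuous_integrable_itv h (a b : R) : continuous h ->
  mu.-integrable `[a, b] (EFin \o h).
Proof.
move=> ch; apply: continuous_compact_integrable; first exact: segment_compact.
exact: continuous_subspaceT.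
Qed.

Lemma ccontinuousD f g : ccontinuous f -> ccontinuous g ->
  ccontinuous (fun t => f t + g t).
Proof.
move=> [f1 f2] [g1 g2]; split=> t.
  by under eq_fun do rewrite raddfD /=; exact: cvgD (f1 t) (g1 t).
by under eq_fun do rewrite raddfD /=; exact: cvgD (f2 t) (g2 t).
Qed.

Lemma cReM (c d : R[i]) :
  complex.Re (c * d) = complex.Re c * complex.Re d - complex.Im c * complex.Im d.
Proof. by case: c => c1 c2; case: d. Qed.

Lemma cImM (c d : R[i]) :
  complex.Im (c * d) = complex.Re c * complex.Im d + complex.Im c * complex.Re d.
Proof. by case: c => c1 c2; case: d. Qed.

Lemma ccontinuousM f g : ccontinuous f -> ccontinuous g ->
  ccontinuous (fun t => f t * g t).
Proof.
move=> [f1 f2] [g1 g2]; split=> t.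
  under eq_fun do rewrite cReM.
  exact: cvgB (cvgM (f1 t) (g1 t)) (cvgM (f2 t) (g2 t)).
under eq_fun do rewrite cImM.
exact: cvgD (cvgM (f1 t) (g2 t)) (cvgM (f2 t) (g1 t)).
Qed.

Lemma ccontinuous_cst (c : R[i]) : ccontinuous (fun=> c).
Proof. by split=> t; exact: cvg_cst. Qed.

Lemma ccontinuous_sum n (F : nat -> R -> R[i]) : (forall k, ccontinuous (F k)) ->
  ccontinuous (fun t => \sum_(0 <= k < n) F k t).
Proof.
move=> hF; elim: n => [|n IH].
  by under eq_fun do rewrite big_nil; exact: ccontinuous_cst.
by under eq_fun do rewrite big_nat_recr //=; exact: ccontinuousD.
Qed.

Lemma cintegralD (a b : R) f g : ccontinuous f -> ccontinuous g ->
  cintegral `[a, b] (fun t => f t + g t) = cintegral `[a, b] f + cintegral `[a, b] g.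
Proof.
move=> [f1 f2] [g1 g2]; rewrite /cintegral.
under eq_Rintegral do rewrite raddfD /=.
rewrite RintegralD //; [|exact: continuous_integrable_itv..].
under [X in (_ +i* X)%C]eq_Rintegral do rewrite raddfD /=.
by rewrite RintegralD //; exact: continuous_integrable_itv.
Qed.

Lemma cintegralZ (a b : R) (c : R[i]) f : ccontinuous f ->
  cintegral `[a, b] (fun t => c * f t) = c * cintegral `[a, b] f.
Proof.
move=> [f1 f2]; rewrite /cintegral.
have i1 := continuous_integrable_itv a b f1.
have i2 := continuous_integrable_itv a b f2.
have iZ (r : R) h : mu.-integrable `[a, b] (EFin \o h) ->
    mu.-integrable `[a, b] (EFin \o (fun t => r * h t)).
  move=> ih; rewrite (_ : EFin \o _ = (fun t => r%:E * (EFin \o h) t)%E).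
    by apply: (@integrableZl _ _ R mu _ _ r (EFin \o h)).
  by apply/funext => t; rewrite /= EFinM.
under eq_Rintegral do rewrite cReM.
rewrite RintegralB //; [|exact: iZ..].
under [X in (_ +i* X)%C]eq_Rintegral do rewrite cImM.
rewrite RintegralD //; [|exact: iZ..].
by rewrite !RintegralZl //; case: c => c1 c2; apply/eqP; rewrite eq_complex /= !eqxx.
Qed.

Lemma cintegral_sum (a b : R) n (F : nat -> R -> R[i]) : (forall k, ccontinuous (F k)) ->
  cintegral `[a, b] (fun t => \sum_(0 <= k < n) F k t) =
  \sum_(0 <= k < n) cintegral `[a, b] (F k).
Proof.
move=> hF; elim: n => [|n IH].
  rewrite [RHS]big_nil -[RHS](mul0r (cintegral `[a, b] (F 0%N))) -cintegralZ //.
  by congr cintegral; apply/funext => t; rewrite big_nil mul0r.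
rewrite big_nat_recr //= -IH -cintegralD //; last exact: ccontinuous_sum.
by congr cintegral; apply/funext => t; rewrite big_nat_recr.
Qed.

Definition cis (t : R) : R[i] := (cos t +i* sin t)%C.

Lemma cexp_imaginary (t : R) : cexp (0 +i* t)%C = cis t.
Proof. by rewrite /cexp /cis /= expR0 rmorph1 mul1r. Qed.

Lemma cisD (s t : R) : cis (s + t) = cis s * cis t.
Proof.
by rewrite /cis cosD sinD; apply/eqP; rewrite eq_complex /= addrC !eqxx addrC !eqxx.
Qed.

Lemma cis0 : cis 0 = 1. Proof. by rewrite /cis cos0 sin0. Qed.

Lemma cisX (t : R) n : cis t ^+ n = cis (n%:R * t).
Proof.
elim: n => [|n IH]; first by rewrite expr0 mul0r cis0.
by rewrite exprS IH -cisD -nat1r mulrDl mul1r.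
Qed.

Lemma cis_neq0 (t : R) : cis t != 0.
Proof.
apply/negP => /eqP t0; have := cisD t (- t).
by rewrite subrr cis0 t0 mul0r => /eqP; rewrite oner_eq0.
Qed.

Lemma cisV (t : R) : (cis t)^-1 = cis (- t).
Proof. by apply: (mulfI (cis_neq0 t)); rewrite divff ?cis_neq0 // -cisD subrr cis0. Qed.

Lemma cmod_cis (t : R) : cmod (cis t) = 1.
Proof. by rewrite /cis /cmod /= cos2Dsin2 sqrtr1. Qed.

Lemma ccontinuous_cis (k : R) : ccontinuous (fun t => cis (k * t)).
Proof.
have ck : continuous (fun t : R => k * t) by move=> t; apply: cvgMr; exact: cvg_id.
by split=> t; apply: continuous_comp (ck t) _; [exact: continuous_cos|exact: continuous_sin].
Qed.

Lemma cintegral_cis (k : R) : k != 0 -> cis (k * (2 * pi)) = 1 ->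
  cintegral `[0, 2 * pi] (fun t => cis (k * t)) = 0.
Proof.
move=> k0 [ck sk]; rewrite /cintegral.
have p2 : 0 < 2 * pi :> R by rewrite mulr_gt0 // pi_gt0.
have [c1 c2] := ccontinuous_cis k.
have d (t : R) : is_derive t 1 ( *%R k) k.
  by apply: is_derive_eq; rewrite /GRing.scale /= mulr1.
have dsin (t : R) : is_derive t 1 (fun t => k^-1 * sin (k * t)) (cos (k * t)).
  apply: is_derive_eq.
  by rewrite /GRing.scale /=; field.
have dcos (t : R) : is_derive t 1 (fun t => - k^-1 * cos (k * t)) (sin (k * t)).
  apply: is_derive_eq.
  by rewrite /GRing.scale /=; field.
have I1 : \int[mu]_(t in `[0, 2 * pi]) cos (k * t) = 0.
  rewrite (Rintegral_FTC2 p2 (fun t _ => dsin t) (fun t _ => c1 t)).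
  by rewrite sk !mulr0 sin0 mulr0 subrr.
have I2 : \int[mu]_(t in `[0, 2 * pi]) sin (k * t) = 0.
  rewrite (Rintegral_FTC2 p2 (fun t _ => dcos t) (fun t _ => c2 t)).
  by rewrite ck mulr0 cos0 subrr.
by rewrite I1 I2.
Qed.

(** Orthogonality of the exponentials on the circle: the one contour integral that is computed
    outright. *)
Lemma cintegral_cis_diff (a b : nat) :
  cintegral `[0, 2 * pi] (fun t => cis ((a%:R - b%:R) * t)) = (a == b)%:R * (2 * pi)%:C%C.
Proof.
have p2 : 0 < 2 * pi :> R by rewrite mulr_gt0 // pi_gt0.
have [<-|ab] := eqVneq a b.
  rewrite subrr (_ : (fun t => cis _) = cst 1); last first.
    by apply/funext => t; rewrite mul0r cis0.
  rewrite /cintegral /= !Rintegral_cst //= lebesgue_measure_itv /= lte_fin p2.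
  by rewrite /= subr0 !mul0r !mul1r.
have period (n : nat) : cis (n%:R * (2 * pi)) = 1.
  by rewrite -cisX mulr_natl /cis cos2pi sin2pi expr1n.
rewrite mul0r cintegral_cis //; first by rewrite subr_eq0 eqr_nat.
by rewrite mulrBl cisD -cisV !period invr1 mulr1.
Qed.

End ContourIntegrals.

Section HolomorphicCalculus.
Variables (R : realType) (N : nat).
Local Notation MC := 'M[R[i]]_N.+1.
Implicit Types (M X L : MC).

(** Dominated convergence passes measurability from the [p m] to [g], so that the continuity of the
    resolvent and of 1/Gamma on the circle is never at issue. The majorant is |p 0| plus two uniform
    errors. *)
Lemma cintegral_unif_limit (a b C : R) (p : nat -> R -> R[i]) (g : R -> R[i]) :
  (forall m, ccontinuous (p m)) ->
  (forall m t, cmod (g t - p m t) <= C / m.+1%:R) ->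
  (fun m => cmod (cintegral `[a, b] (p m) - cintegral `[a, b] g)) @ \oo --> (0 : R).
Proof.
move=> cp gp; have C0 : 0 <= C.
  by have := le_trans (cmod_ge0 _) (gp 0%N 0); rewrite divr1.
have h0 : (fun m : nat => C / m.+1%:R) @ \oo --> (0 : R).
  by rewrite -(mulr0 C); apply: cvgMr; exact: cvg_harmonic.
have part (phi : R[i] -> R) : (forall c d, phi (c - d) = phi c - phi d) ->
    (forall c, `|phi c| <= cmod c) -> (forall m, continuous (fun t => phi (p m t))) ->
    (fun m => \int[lebesgue_measure]_(t in `[a, b]) phi (p m t)) @ \oo -->
    \int[lebesgue_measure]_(t in `[a, b]) phi (g t).
  move=> phiB phic cphi.
  have dist m t : `|phi (g t) - phi (p m t)| <= C / m.+1%:R.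
    by rewrite -phiB; apply: le_trans (phic _) (gp m t).
  apply: (@Rintegral_dominated _ _ _ _ (fun t => `|phi (p 0%N t)| + (C + C))) => //.
  - by move=> n; apply: measurable_funTS; exact: continuous_measurable_fun.
  - move=> t _; apply/cvgrPdist_le => e e0.
    have /cvgrPdist_le /(_ e e0) H := h0.
    apply: filterS H => m; rewrite sub0r normrN => /(le_trans (ler_norm _)).
    exact: le_trans (dist m t).
  - apply: continuous_integrable_itv => t; apply: cvgD; last exact: cvg_cst.
    by apply: cvg_norm; exact: cphi.
  - move=> m t _.
    have -> : phi (p m t) = phi (p 0%N t) + ((phi (g t) - phi (p 0%N t)) - (phi (g t) - phi (p m t))).
      by ring.
    apply: le_trans (ler_normD _ _) _; rewrite lerD2l.
    apply: le_trans (ler_normB _ _) _; apply: lerD; apply: le_trans (dist _ _) _.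
      by rewrite divr1.
    by rewrite ler_pdivrMr // ler_peMr // ler1n.
have hr := part (@complex.Re R) (raddfB _) (@cmod_Re R) (fun m => (cp m).1).
have hi := part (@complex.Im R) (raddfB _) (@cmod_Im R) (fun m => (cp m).2).
have d0 (f : nat -> R) l : f @ \oo --> l -> (fun n => `|f n - l|) @ \oo --> (0 : R).
  move=> h; rewrite -(normr0 R) -(subrr l).
  by apply: cvg_norm; apply: cvgB => //; exact: cvg_cst.
have dri := cvgD (d0 _ _ hr) (d0 _ _ hi); rewrite addr0 in dri.
apply: (@squeeze_cvgr _ _ _ _ (cst 0) (fun m =>
  `|(\int[lebesgue_measure]_(t in `[a, b]) complex.Re (p m t)) -
    \int[lebesgue_measure]_(t in `[a, b]) complex.Re (g t)| +
  `|(\int[lebesgue_measure]_(t in `[a, b]) complex.Im (p m t)) -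
    \int[lebesgue_measure]_(t in `[a, b]) complex.Im (g t)|));
  [|exact: cvg_cst|exact: dri].
by near=> m; apply/andP; split; [exact: cmod_ge0|exact: cmod_ReIm].
Unshelve. all: by end_near.
Qed.

Lemma enclosing_radius_gt M : max_row_sum M < enclosing_radius M.
Proof.
rewrite /enclosing_radius; apply: (@le_lt_trans _ _ (\sum_i \sum_j cmod (M i j))); last first.
  by rewrite ltrDr.
apply: max_row_sum_le => [|i].
  by apply: sumr_ge0 => i _; apply: sumr_ge0 => j _; exact: cmod_ge0.
rewrite [leRHS](bigD1 i) //= lerDl.
by apply: sumr_ge0 => k _; apply: sumr_ge0 => j _; exact: cmod_ge0.
Qed.

Lemma horner_mx_sum M (q : {poly R[i]}) :
  horner_mx M q = \sum_(0 <= k < size q) q`_k *: M ^+ k.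
Proof.
rewrite -{1}[q]coefK poly_def raddf_sum big_mkord /=; apply: eq_bigr => k _.
by rewrite horner_mxZ rmorphXn /= horner_mx_X.
Qed.

Section CircleResolvent.
Variables (v : algnorm R N) (M : MC) (rho : R).
Hypothesis Mrho : v M < rho.

Let rho0 : 0 < rho. Proof. exact: le_lt_trans (nu_ge0 v M) Mrho. Qed.
Let kappa := v M / rho.
Let kappa0 : 0 <= kappa. Proof. by rewrite divr_ge0 ?nu_ge0 ?ltW. Qed.
Let kappa1 : kappa < 1. Proof. by rewrite ltr_pdivrMr // mul1r. Qed.

(** The factor w stems from dw = i w dtheta, and w (w - M)^-1 = (1 - M / w)^-1 is a Neumann series
    of ratio |M| / rho on the circle. *)
Lemma resolvent_neumann w B : cmod w = rho ->
  v (w *: (w%:M - M)^-1) <= (1 - v M / rho)^-1 /\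
  v (w *: (w%:M - M)^-1 - \sum_(0 <= b < B) (w ^+ b)^-1 *: M ^+ b) <=
    (v M / rho) ^+ B / (1 - v M / rho).
Proof.
move=> wr; have w0 : w != 0.
  by apply: contraTneq rho0 => w0; rewrite -wr w0 cmod0 ltxx.
pose Z := w^-1 *: M.
have vZ : v Z = kappa by rewrite nuZ cmodV wr mulrC.
have [|Zu Zn] := @nu_unit _ _ v (1 - Z); first by rewrite subKr vZ.
rewrite subKr vZ -/kappa in Zn.
have wM : w%:M - M = w *: (1 - Z).
  by rewrite scalerBr scalemx1 /Z scalerA divff // scale1r.
have e : w *: (w%:M - M)^-1 = (1 - Z)^-1.
  by rewrite wM invrZ ?unitfE // scalerA divff // scale1r.
rewrite e; split; first exact: Zn.
have -> : (1 - Z)^-1 - \sum_(0 <= b < B) (w ^+ b)^-1 *: M ^+ b = Z ^+ B * (1 - Z)^-1.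
  apply: (mulIr Zu); rewrite mulrBl mulVr // mulrVK //.
  have -> : \sum_(0 <= b < B) (w ^+ b)^-1 *: M ^+ b = \sum_(0 <= b < B) Z ^+ b.
    by apply: eq_bigr => b _; rewrite /Z exprZn exprVn.
  elim: B => [|B IH]; first by rewrite big_nil mul0r subr0 expr0.
  rewrite big_nat_recr //= mulrDl opprD addrA IH mulrBr mulr1 -exprSr.
  by rewrite opprB addrC subrK.
apply: le_trans (nuM _ _ _) _; apply: ler_pM; rewrite ?nu_ge0 //.
by rewrite -/kappa -vZ nuX.
Qed.

Hypothesis entry : forall X i j, cmod (X i j) <= v X.

(** Replacing f by a polynomial q and the resolvent by a partial Neumann sum turns the integrand
    into a trigonometric polynomial. By orthogonality only equal powers of w and w^-1 survive, and
    they add up to q(M). *)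
Lemma circle_integral_resolvent (f : R[i] -> R[i]) L i j :
  (forall e : R, 0 < e -> exists q : {poly R[i]},
    (forall w, cmod w = rho -> cmod (f w - q.[w]) <= e) /\ v (L - horner_mx M q) <= e) ->
  cintegral `[0, 2 * pi] (fun t => let w := rho%:C%C * cis t in
    'i%C * (f w * (w *: (w%:M - M)^-1) i j)) = 'i%C * ((2 * pi)%:C%C * L i j).
Proof.
move=> approx; set g := (fun t : R => _).
have e0 (m : nat) : 0 < m.+1%:R^-1 :> R by rewrite invr_gt0 ltr0n.
pose q m := projT1 (cid (approx _ (e0 m))).
have qP m : (forall w, cmod w = rho -> cmod (f w - (q m).[w]) <= m.+1%:R^-1) /\
    v (L - horner_mx M (q m)) <= m.+1%:R^-1.
  by rewrite /q; case: cid.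
pose Q m := \sum_(0 <= a < size (q m)) cmod (q m)`_a * rho ^+ a.
have Q0 m : 0 <= Q m.
  by apply: sumr_ge0 => a _; rewrite mulr_ge0 ?cmod_ge0 ?exprn_ge0 ?ltW.
have qQ m w : cmod w = rho -> cmod (q m).[w] <= Q m.
  move=> wr; rewrite horner_coef -(big_mkord xpredT (fun a => (q m)`_a * w ^+ a)).
  by apply: le_trans (cmod_sum _ _ _) _; apply: ler_sum => a _; rewrite cmodM cmodX wr.
(* The truncation must contain every power up to the degree of q, so that the integral is exactly
   q(M), and leave a remainder small against the bound [Q m] of q on the circle. *)
have exB m : exists B, (size (q m) <= B)%N /\ Q m * kappa ^+ B <= m.+1%:R^-1.
  have h : (fun B => Q m * kappa ^+ B) @ \oo --> (0 : R).
    rewrite -(mulr0 (Q m)); apply: cvgMr; apply: cvg_expr.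
    by rewrite ger0_norm.
  have /cvgrPdist_le /(_ _ (e0 m)) [B0 _ HB] := h.
  exists (maxn (size (q m)) B0); split; first exact: leq_maxl.
  have := HB (maxn (size (q m)) B0) (leq_maxr _ _).
  by rewrite /= sub0r normrN => /(le_trans (ler_norm _)).
pose B m := projT1 (cid (exB m)).
have BP m : (size (q m) <= B m)%N /\ Q m * kappa ^+ B m <= m.+1%:R^-1.
  by rewrite /B; case: cid.
pose co m a b : R[i] := (q m)`_a * (M ^+ b) i j * (rho ^+ a / rho ^+ b)%:C%C.
pose p m t := 'i%C * \sum_(0 <= a < size (q m)) \sum_(0 <= b < B m)
  co m a b * cis ((a%:R - b%:R) * t).
have cterm m a b : ccontinuous (fun t => co m a b * cis ((a%:R - b%:R) * t)).
  by apply: ccontinuousM; [exact: ccontinuous_cst|exact: ccontinuous_cis].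
have cinner m a : ccontinuous (fun t => \sum_(0 <= b < B m) co m a b * cis ((a%:R - b%:R) * t)).
  by apply: ccontinuous_sum => b; exact: cterm.
have cp m : ccontinuous (p m).
  apply: ccontinuousM; first exact: ccontinuous_cst.
  by apply: ccontinuous_sum => a; exact: cinner.
have intp m : cintegral `[0, 2 * pi] (p m) =
    'i%C * ((2 * pi)%:C%C * (horner_mx M (q m)) i j).
  rewrite /p cintegralZ; last by apply: ccontinuous_sum => a; exact: cinner.
  congr ('i%C * _); rewrite (cintegral_sum _ _ _ (cinner m)).
  rewrite horner_mx_sum summxE mulr_sumr; apply: eq_big_nat => a /andP[_ aq].
  rewrite (cintegral_sum _ _ _ (cterm m a)).
  have aB : (a < B m)%N by apply: leq_trans aq (BP m).1.
  rewrite (bigD1_seq a) ?mem_index_iota ?iota_uniq //= big1 => [|b ba].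
    rewrite addr0 (cintegralZ _ _ _ (ccontinuous_cis _)) cintegral_cis_diff eqxx mul1r.
    rewrite /co divff ?expf_neq0 ?gt_eqF // rmorph1 mulr1 mxE.
    by rewrite mulrC.
  rewrite (cintegralZ _ _ _ (ccontinuous_cis _)) cintegral_cis_diff eq_sym (negbTE ba).
  by rewrite mul0r mulr0.
have gp m t : cmod (g t - p m t) <= (2 / (1 - kappa)) / m.+1%:R.
  rewrite /g /=; set w := rho%:C%C * cis t.
  have wr : cmod w = rho by rewrite cmodM cmod_cis mulr1 cmod_real gtr0_norm.
  have k1 : 0 < 1 - kappa by rewrite subr_gt0.
  have [h1 h2] := resolvent_neumann (B m) wr; rewrite -/kappa in h1 h2.
  set Y := w *: (w%:M - M)^-1 in h1 h2 *.
  set S := \sum_(0 <= b < B m) (w ^+ b)^-1 *: M ^+ b in h2.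
  have -> : p m t = 'i%C * ((q m).[w] * S i j).
    rewrite /p; congr ('i%C * _); rewrite horner_coef.
    rewrite -(big_mkord xpredT (fun a => (q m)`_a * w ^+ a)) mulr_suml.
    apply: eq_bigr => a _; rewrite /S summxE mulr_sumr; apply: eq_bigr => b _.
    rewrite mxE /co mulrBl cisD -cisV -!cisX /w !exprMn invfM.
    by rewrite fmorph_div 2!(rmorphXn (real_complex R)); ring.
  rewrite -mulrBr cmodM.
  have -> : cmod 'i%C = 1 :> R by rewrite /cmod /= expr0n /= add0r expr1n sqrtr1.
  rewrite mul1r.
  have -> : f w * Y i j - (q m).[w] * S i j =
      (f w - (q m).[w]) * Y i j + (q m).[w] * (Y - S) i j.
    by rewrite !mxE; ring.
  apply: le_trans (cmodD _ _) _; rewrite !cmodM.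
  have -> : 2 / (1 - kappa) / m.+1%:R =
     m.+1%:R^-1 * (1 - kappa)^-1 + m.+1%:R^-1 * (1 - kappa)^-1 :> R by ring.
  apply: lerD.
    apply: ler_pM; rewrite ?cmod_ge0 //; first exact: (qP m).1.
    exact: le_trans (entry _ _ _) h1.
  apply: (@le_trans _ _ (Q m * (kappa ^+ B m / (1 - kappa)))).
    apply: ler_pM; rewrite ?cmod_ge0 //; first exact: qQ.
    exact: le_trans (entry _ _ _) h2.
  by rewrite mulrA ler_wpM2r ?invr_ge0 ?(ltW k1) //; exact: (BP m).2.
have lim1 := cintegral_unif_limit 0 (2 * pi) cp gp.
have pi0 : 0 <= 2 * pi :> R by rewrite mulr_ge0 ?pi_ge0.
have lim2 : (fun m => (2 * pi) * m.+1%:R^-1) @ \oo --> (0 : R).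
  by rewrite -(mulr0 (2 * pi)); apply: cvgMr; exact: cvg_harmonic.
have lim : (fun m => cmod (cintegral `[0, 2 * pi] (p m) - cintegral `[0, 2 * pi] g) +
    (2 * pi) * m.+1%:R^-1) @ \oo --> (0 : R).
  by rewrite -[X in _ --> X]addr0; exact: cvgD lim1 lim2.
apply/eqP; rewrite -subr_eq0; apply/eqP; apply: cmod_eq0.
apply/eqP; rewrite eq_le cmod_ge0 andbT.
apply: (cvgr_to_ge lim); near=> m; rewrite intp.
set cg := cintegral _ g.
have -> : cg - 'i%C * ((2 * pi)%:C%C * L i j) =
    - ('i%C * ((2 * pi)%:C%C * (horner_mx M (q m)) i j) - cg) -
    'i%C * ((2 * pi)%:C%C * (L - horner_mx M (q m)) i j).
  by rewrite !mxE; ring.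
apply: le_trans (cmodD _ _) _; rewrite !cmodN; apply: lerD => //.
rewrite !cmodM cmod_real ger0_norm //.
have -> : cmod 'i%C = 1 :> R by rewrite /cmod /= expr0n /= add0r expr1n sqrtr1.
by rewrite mul1r ler_wpM2l // (le_trans (entry _ _ _)) // (qP m).2.
Unshelve. all: by end_near.
Qed.

End CircleResolvent.

Lemma holomorphic_calculus_approx (f : R[i] -> R[i]) M L :
  (forall e : R, 0 < e -> exists q : {poly R[i]},
    (forall w, cmod w = enclosing_radius M -> cmod (f w - q.[w]) <= e) /\
    rownorm R N (L - horner_mx M q) <= e) ->
  holomorphic_calculus f M = L.
Proof.
move=> approx.
have entry X i j : cmod (X i j) <= rownorm R N X.
  apply: le_trans (le_max_row_sum X i).
  by rewrite (bigD1 j) //= lerDl; apply: sumr_ge0 => k _; exact: cmod_ge0.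
have main := @circle_integral_resolvent (rownorm R N) M (enclosing_radius M)
  (enclosing_radius_gt M) entry f L _ _ approx.
have pi0 : (2 * pi)%:C%C != 0 :> R[i].
  by rewrite fmorph_eq0 gt_eqF // mulr_gt0 // pi_gt0.
have i0 : 'i%C != 0 :> R[i] by rewrite eq_complex /= oner_eq0 andbF.
apply/matrixP => i j; rewrite /holomorphic_calculus /circle_integral /mxintegral !mxE.
rewrite (_ : cintegral _ _ = 'i%C * ((2 * pi)%:C%C * L i j)).
  by rewrite [X in _ * X]mulrCA [X in _ * X]mulrA mulKf // mulf_neq0.
rewrite -main; congr cintegral; apply/funext => t.
by rewrite !mxE cexp_imaginary /= mxE; ring.
Qed.

End HolomorphicCalculus.

(** * The contour integral agrees with Gauss's product *)

Section ReciprocalGamma.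
Variables (R : realType) (N : nat).
Local Notation MC := 'M[R[i]]_N.+1.
Implicit Types (v : algnorm R N) (M X : MC) (w : R[i]).

Lemma cmod_cvg_lim (s : nat -> R[i]) (l : R[i]) :
  (fun n => cmod (s n - l)) @ \oo --> (0 : R) -> limn s = l.
Proof.
move=> h; apply: cvg_lim; first exact: norm_hausdorff.
apply/cvgrPdist_lt => e e0.
have [e' e'0 ee'] : exists2 e' : R, 0 < e' & e = e'%:C%C.
  case: e e0 => a b; rewrite ltcE /= => /andP[/eqP -> a0].
  by exists a.
have /cvgrPdist_lt /(_ _ e'0) H := h.
rewrite ee'; apply: filterS H => n; rewrite sub0r normrN ger0_norm ?cmod_ge0 //.
by rewrite cmodE ltcR -cmodN opprB.
Qed.

Definition rgamma_seq w (n : nat) : R[i] :=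
  (\prod_(k < n.+1) (w + k%:R)) / (n`!%:R * cexp (w * (ln n%:R)%:C%C)).

Lemma pochmx_scalar w n : pochmx (w%:M : MC) n = (\prod_(k < n) (w + k%:R))%:M.
Proof.
rewrite /pochmx; elim: n => [|n IH]; first by rewrite !big_ord0.
by rewrite !big_ord_recr /= IH -raddfD /= -mulmxE -scalar_mxM.
Qed.

Lemma gauss_mx_scalar w n : gauss_mx n (w%:M : MC) = (rgamma_seq w n)%:M.
Proof.
have cN (c : R[i]) : cexp (- c) = (cexp c)^-1.
  have := mxexpNK (c%:M : MC); rewrite -raddfN !mxexp_scalar -mulmxE -scalar_mxM.
  move=> /matrixP /(_ 0 0); rewrite !mxE /= mulr1n => h.
  have c0 : cexp c != 0.
    by apply: contra_eq_neq h => ->; rewrite mul0r eq_sym oner_neq0.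
  by apply: (mulfI c0); rewrite h divff.
rewrite /gauss_mx pochmx_scalar scale_scalar_mx mxexp_scalar -mulmxE -scalar_mxM.
rewrite scale_scalar_mx /rgamma_seq mulrC -mulrA; congr (_%:M); congr (_ * _).
by rewrite invfM mulrC -cN; congr (_ * cexp _); rewrite rmorphN mulNr mulrC.
Qed.

Lemma rgauss_scalar w : rgauss (w%:M : MC) = (rgamma w)%:M.
Proof.
have h := @rgauss_cvg R N (w%:M).
have /cvg_mx_entryP /(_ 0 0) h00 := h.
have e : rgamma w = rgauss (w%:M : MC) 0 0.
  apply: cmod_cvg_lim; apply: cvg_trans h00; apply: near_eq_cvg; near=> n.
  by rewrite gauss_mx_scalar !mxE /= mulr1n.
apply: cvg_mx_unique h _.
apply/(cvg_nuP (rownorm R N)); move: (rownorm R N) => v.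
apply: cvg_trans h00; apply: near_eq_cvg; near=> n.
by rewrite gauss_mx_scalar -raddfB nu_scalar e !mxE /= mulr1n.
Unshelve. all: by end_near.
Qed.

(** Gauss's product with its exponential factor cut after J terms: the explicit polynomial at which
    the contour integral is evaluated. *)
Definition gauss_poly (m J : nat) : {poly R[i]} :=
  m`!%:R^-1 *: ((\prod_(k < m.+1) ('X + (k%:R)%:P)) *
    (\sum_(0 <= j < J) (j`!%:R^-1 * ((- ln m%:R : R)%:C%C) ^+ j) *: 'X^j)).

Lemma horner_gauss_poly X m J : horner_mx X (gauss_poly m J) =
  m`!%:R^-1 *: (pochmx X m.+1 * series (mxexp_term ((- ln m%:R : R)%:C%C *: X)) J).
Proof.
rewrite /gauss_poly horner_mxZ rmorphM /=; congr (_ *: (_ * _)).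
  rewrite rmorph_prod /pochmx; apply: eq_bigr => k _.
  by rewrite rmorphD /= horner_mx_X horner_mx_C.
rewrite rmorph_sum seriesEnat /=; apply: eq_bigr => j _.
by rewrite horner_mxZ rmorphXn /= horner_mx_X /mxexp_term exprZn scalerA.
Qed.

Lemma horner_mx_scalar w (q : {poly R[i]}) : horner_mx (w%:M : MC) q = (q.[w])%:M.
Proof.
elim/poly_ind: q => [|q c IH]; first by rewrite rmorph0 horner0 raddf0.
rewrite rmorphD rmorphM /= IH horner_mx_X horner_mx_C hornerMXaddC raddfD /=.
by rewrite -mulmxE -scalar_mxM.
Qed.

Lemma gauss_poly_approx v (r : R) m (e : R) : 0 < e -> (0 < m)%N -> exists J,
  forall X, v X <= r -> v (gauss_mx m X - horner_mx X (gauss_poly m J)) <= e.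
Proof.
move=> e0 m0; pose c := ln m%:R : R.
have c0 : 0 <= c by rewrite ln_ge0 // ler1n.
pose K := \prod_(k < m.+1) (`|r| + k%:R).
have K0 : 0 <= K by apply: prodr_ge0 => k _; rewrite addr_ge0.
have h : (fun J => K * (expR (c * `|r|) - series (exp_coeff (c * `|r|)) J)) @ \oo --> (0 : R).
  rewrite -(mulr0 K) -(subrr (expR (c * `|r|))); apply: cvgMr; apply: cvgB; first exact: cvg_cst.
  exact: is_cvg_series_exp_coeff.
have /cvgrPdist_le /(_ _ e0) [J _ HJ] := h.
exists J => X Xr.
have XR : v X <= `|r| by apply: le_trans Xr (ler_norm r).
have := HJ J (leqnn _); rewrite /= sub0r normrN => /(le_trans (ler_norm _)) hJ; apply: le_trans hJ.
rewrite horner_gauss_poly /gauss_mx -scalerBr -mulrBr nuZ cmodV cmod_nat.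
apply: le_trans (ler_piMl (nu_ge0 _ _) _) _.
  by rewrite invf_le1 ?ltr0n ?fact_gt0 // ler1n fact_gt0.
apply: le_trans (nuM _ _ _) _; apply: ler_pM; rewrite ?nu_ge0 //.
  apply: le_trans (nu_prod _ _ _ _) _; apply: ler_prod => k _; rewrite nu_ge0 /=.
  by apply: le_trans (nuD _ _ _) _; apply: lerD => //; rewrite nu_scalar cmod_nat.
have cX : v ((- ln m%:R : R)%:C%C *: X) <= c * `|r|.
  by rewrite nuZ cmod_real normrN ger0_norm // ler_wpM2l.
by have [_ /(_ J)] := mxexp_cvg_tail cX.
Qed.

(** A single estimate, over all matrices X of norm at most the radius, serves twice: at X = M, and
    at the scalar matrices [w%:M] with w on the circle, where [rgauss] is the scalar 1/Gamma. *)
Theorem rgammamxE M : rgammamx M = rgauss M.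
Proof.
apply: holomorphic_calculus_approx => e e0.
have vM := ltW (enclosing_radius_gt M); rewrite -[max_row_sum M]/(rownorm R N M) in vM.
move: (rownorm R N) vM => v; set rho := enclosing_radius M => vM.
have e2 : 0 < e / 2 by rewrite divr_gt0.
have [m m0 Hm] := rgauss_cvg_unif v rho e2.
have [J HJ] := gauss_poly_approx v rho e2 m0.
have key X : v X <= rho -> v (rgauss X - horner_mx X (gauss_poly m J)) <= e.
  move=> Xr; rewrite -(subrK (gauss_mx m X) (rgauss X)) -addrA.
  by apply: le_trans (nuD _ _ _) _; rewrite (splitr e); apply: lerD; [exact: Hm|exact: HJ].
exists (gauss_poly m J); split; last exact: key.
move=> w wr; have := key w%:M; rewrite rgauss_scalar horner_mx_scalar -raddfB !nu_scalar.
by apply; rewrite wr.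
Qed.

End ReciprocalGamma.

(** * The incomplete Gamma function *)

Section PowerDerivative.
Variables (R : realType) (N : nat) (v : algnorm R N).
Local Notation MC := 'M[R[i]]_N.+1.

Variables (phi : MC -> R) (C : R).
Hypothesis phiD : forall X Y, phi (X + Y) = phi X + phi Y.
Hypothesis phiZ : forall (r : R) X, phi (r%:C%C *: X) = r * phi X.
Hypothesis phi_le : forall X, `|phi X| <= C * v X.

Lemma is_derive_intro (f : R -> R) (a l : R) :
  (fun h => h^-1 * (f (h + a) - f a)) @ (0 : R)^' --> l -> is_derive a 1 f l.
Proof.
move=> h.
have h' : (fun h => h^-1 *: ((f \o shift a) (h *: (1 : R)) - f a)) @ (0 : R)^' --> l.
  apply: cvg_trans h; apply: near_eq_cvg; near=> h.
  by rewrite /= /GRing.scale /= mulr1.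
apply: DeriveDef; first by apply/cvg_ex; exists l.
exact: cvg_lim.
Unshelve. all: by end_near.
Qed.

(** The error of the difference quotient is h^-1 times [phi] of (e^(hX) - 1 - hX) Z, at most K |h|
    by the quadratic remainder. The right factor [W] will hold the inverse Pochhammer symbols. *)
Lemma is_derive_mxexp (X W : MC) (s : R) :
  is_derive s 1 (fun t => phi (mxexp (t%:C%C *: X) * W)) (phi (X * mxexp (s%:C%C *: X) * W)).
Proof.
apply: is_derive_intro.
pose K := C * (v X ^+ 2 * expR (v X) * v (mxexp (s%:C%C *: X) * W)).
apply/cvgrPdist_le => e e0.
have C0 : 0 <= C by have := le_trans (normr_ge0 _) (phi_le 1); rewrite nu1 mulr1.
have K0 : 0 <= K by rewrite !mulr_ge0 ?sqr_ge0 ?expR_ge0 ?nu_ge0.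
near=> h.
have h0 : h != 0 by near: h; exact: nbhs_dnbhs_neq.
have h1 : `|h| <= 1 by near: h; apply: dnbhs0_le.
have hK : `|h| <= e / (K + 1).
  by near: h; apply: dnbhs0_le; rewrite divr_gt0 // ltr_wpDl.
pose Y := h%:C%C *: X; pose Z := mxexp (s%:C%C *: X) * W.
have phiB A B : phi (A - B) = phi A - phi B.
  by rewrite phiD -scaleN1r -(rmorph1 (real_complex R)) -rmorphN phiZ mulN1r.
have eq1 : phi (X * mxexp (s%:C%C *: X) * W) -
    h^-1 * (phi (mxexp ((h + s)%:C%C *: X) * W) - phi (mxexp (s%:C%C *: X) * W)) =
    - (h^-1 * phi ((mxexp Y - 1 - Y) * Z)).
  have e1 : mxexp ((h + s)%:C%C *: X) * W = mxexp Y * Z.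
    rewrite rmorphD /= scalerDl mxexpD; last first.
      by rewrite -!scalerAr -!scalerAl scalerA mulrC -scalerA.
    exact: esym (mulrA _ _ _).
  have e2 : X * mxexp (s%:C%C *: X) * W = X * Z by exact: esym (mulrA _ _ _).
  apply: etrans (congr2 (fun A B => phi A - h^-1 * (phi B - phi Z)) e2 e1) _.
  move: Z (mxexp Y) {e1 e2} => Z F.
  rewrite !mulrBl mul1r !phiB /Y -scalerAl phiZ.
  by rewrite mulrBr; field.
rewrite eq1 normrN normrM normfV.
have vY : v Y <= `|h| * v X by rewrite nuZ cmod_real.
have bound : `|phi ((mxexp Y - 1 - Y) * Z)| <= `|h| ^+ 2 * K.
  apply: le_trans (phi_le _) _; rewrite /K mulrCA; apply: ler_wpM2l => //.
  apply: le_trans (nuM _ _ _) _; rewrite mulrA; apply: ler_wpM2r; first exact: nu_ge0.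
  apply: le_trans (nu_mxexp_linear vY) _.
  rewrite exprMn -mulrA; do 2 (apply: ler_wpM2l; first exact: sqr_ge0).
  by rewrite ler_expR ler_piMl ?nu_ge0.
have hp : 0 < `|h| by rewrite normr_gt0.
rewrite mulrC ler_pdivrMr //; apply: le_trans bound _.
rewrite expr2 -mulrA mulrC ler_wpM2r //.
apply: (@le_trans _ _ (`|h| * (K + 1))); first by rewrite ler_wpM2l // lerDl.
by rewrite -ler_pdivlMr // ltr_wpDl.
Unshelve. all: by end_near.
Qed.

Lemma is_derive_rpow (X W : MC) (t : R) : 0 < t ->
  is_derive t 1 (fun u => phi (mxexp ((ln u)%:C%C *: X) * W))
    (t^-1 * phi (X * mxexp ((ln t)%:C%C *: X) * W)).
Proof.
move=> t0.
have dln := is_derive1_ln t0.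
have dg := is_derive_mxexp X W (ln t).
by have := is_derive1_comp dg dln; rewrite mulrC.
Qed.

End PowerDerivative.

Section RealDerivatives.
Variable R : realType.
Implicit Types (f g : R -> R).

Lemma is_derive_fun_exprn f n (x df : R) : is_derive x 1 f df ->
  is_derive x 1 (fun u => f u ^+ n) (n%:R * f x ^+ n.-1 * df).
Proof. by move=> h; have := is_deriveX n h; rewrite exprfctE. Qed.

Lemma is_derive_fun_mul f g (x df dg : R) : is_derive x 1 f df -> is_derive x 1 g dg ->
  is_derive x 1 (fun u => f u * g u) (f x * dg + g x * df).
Proof. by move=> h1 h2; exact: is_deriveM h1 h2. Qed.

Lemma is_derive_fun_add f g (x df dg : R) : is_derive x 1 f df -> is_derive x 1 g dg ->
  is_derive x 1 (fun u => f u + g u) (df + dg).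
Proof. by move=> h1 h2; exact: is_deriveD h1 h2. Qed.

Lemma is_derive_continuous f (x df : R) : is_derive x 1 f df -> {for x, continuous f}.
Proof.
by move=> [h _]; apply: differentiable_continuous; apply/derivable1_diffP.
Qed.

End RealDerivatives.

Section TruncatedGamma.
Variables (R : realType) (N : nat) (v : algnorm R N).
Local Notation MC := 'M[R[i]]_N.+1.
(* phi is the real or imaginary part of an entry: the library integrates and
   differentiates real functions only. *)
Variables (phi : MC -> R) (C : R).
Hypothesis phiD : forall X Y, phi (X + Y) = phi X + phi Y.
Hypothesis phiZ : forall (r : R) X, phi (r%:C%C *: X) = r * phi X.
Hypothesis phi_le : forall X, `|phi X| <= C * v X.
Variable (M : MC).
Hypothesis M_unit : forall k, M + k%:R%:M \is a GRing.unit.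

Let E (t : R) : MC := mxexp ((ln t)%:C%C *: M).
Let V (j : nat) : MC := (pochmx M j)^-1.

(** Tends to 1 as n grows, so that [trunc_coef n j t] tends to e^(-t) t^j. The sums built on it are
    finite versions of the series t^M e^(-t) sum_j t^j (M)_(j+1)^-1 of the lower incomplete Gamma
    function. *)
Definition falling_ratio (n j : nat) : R := (n ^_ j)%:R / n%:R ^+ j.

Definition trunc_coef (n j : nat) (t : R) : R :=
  falling_ratio n j * (1 - t / n%:R) ^+ (n - j) * t ^+ j.

Let EM t : E t * M = M * E t.
Proof. by apply: esym; apply: mxexp_comm; rewrite -scalerAr -scalerAl. Qed.

Let VS j : V j = M * V j.+1 + j%:R *: V j.+1.
Proof.
rewrite -[j%:R *: _]mul_scalar_mx -[_ *m _]/(j%:R%:M * V j.+1) -mulrDl /V.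
have Pu := pochmx_unit j M_unit; have PSu := pochmx_unit j.+1 M_unit.
apply: (mulIr Pu); rewrite mulVr //; apply: (mulrI Pu).
rewrite mulr1 -mulrA.
have c : pochmx M j * (M + j%:R%:M) = (M + j%:R%:M) * pochmx M j.
  apply: esym; apply: pochmx_comm.
  by rewrite mulrDl mulrDr; congr (_ + _); exact: esym (scalar_mxC _ _).
have -> : (M + j%:R%:M) * ((pochmx M j.+1)^-1 * pochmx M j) = 1.
  apply: (mulIr (M_unit j)).
  by rewrite -!mulrA -pochmxS mulVr // mulr1 mul1r.
by rewrite mulr1.
Qed.

Let d n j t := trunc_coef n j t * t^-1 * phi (E t * V j).

(** Differentiating t^(M + j) brings down M + j, which turns [V j.+1] into [V j] by [VS];
    differentiating (1 - t/n)^(n - j) gives the next term. The derivatives thus telescope, and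
    [d n n.+1] vanishes with the falling factorial. *)
Lemma is_derive_trunc_term n j (t : R) : (0 < n)%N -> (j <= n)%N -> 0 < t ->
  is_derive t 1 (fun u => trunc_coef n j u * phi (E u * V j.+1)) (d n j t - d n j.+1 t).
Proof.
move=> n0 jn t0.
have n0' : n%:R != 0 :> R by rewrite pnatr_eq0 -lt0n.
have t0' : t != 0 by rewrite gt_eqF.
have dphi := is_derive_rpow phiD phiZ phi_le M (V j.+1) t0.
rewrite -/(E t) in dphi.
have d1 : is_derive t 1 (fun u : R => 1 - u / n%:R) (- n%:R^-1).
  by apply: is_derive_eq; rewrite /GRing.scale /=; ring.
have d2 := is_derive_fun_exprn (n - j) d1.
have d3 := is_derive_fun_exprn j (is_derive_id t (1 : R)).
have d4 := is_derive_fun_mul (is_derive_fun_mul (is_derive_fun_mul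
  (is_derive_cst (falling_ratio n j) t 1) d2) d3) dphi.
apply: (is_derive_eq (f' := _) d4).
have ratioS : falling_ratio n j.+1 = falling_ratio n j * ((n - j)%:R / n%:R).
  by rewrite /falling_ratio ffactnSr natrM exprSr invfM; ring.
have phiV : phi (E t * V j) = phi (M * E t * V j.+1) + j%:R * phi (E t * V j.+1).
  rewrite VS mulrDr mulrA EM phiD -scalerAr -phiZ rmorph_nat.
  by [].
rewrite /d /trunc_coef phiV ratioS /=.
have -> : (1 - t / n%:R) ^+ (n - j.+1) = (1 - t / n%:R) ^+ (n - j).-1 by rewrite subnS.
have tj : j%:R * t ^+ j.-1 = j%:R * t ^+ j / t.
  by case: (j) => [|k]; rewrite ?mul0r // -mulrA exprSr mulfK.
rewrite exprSr tj; set p := phi _; set q := phi (E t * _).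
move: ((1 - t / n%:R) ^+ _) ((1 - t / n%:R) ^+ _) (t ^+ j) => a b c.
by field; rewrite n0' t0'.
Qed.

Lemma gauss_mxV n : (gauss_mx n M)^-1 =
  n`!%:R *: (mxexp ((ln n%:R : R)%:C%C *: M) * (pochmx M n.+1)^-1).
Proof.
have f0 : (n`!%:R : R[i])^-1 \is a GRing.unit.
  by rewrite unitfE invr_eq0 pnatr_eq0 -lt0n fact_gt0.
have Pu := pochmx_unit n.+1 M_unit.
have Xu := mxexp_unit ((- ln n%:R : R)%:C%C *: M).
have XV : (mxexp ((- ln n%:R : R)%:C%C *: M))^-1 = mxexp ((ln n%:R : R)%:C%C *: M).
  apply: (mulIr Xu); rewrite mulVr; last exact: Xu.
  by rewrite rmorphN /= scaleNr mxexpNK.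
have PXu : pochmx M n.+1 * mxexp ((- ln n%:R : R)%:C%C *: M) \is a GRing.unit.
  by rewrite (unitrMl _ Xu).
by rewrite /gauss_mx (invrZ f0 PXu) (invrM Pu Xu) XV invrK.
Qed.

Lemma phi_sum n (c : nat -> R) (X : nat -> MC) :
  phi (\sum_(0 <= j < n) (c j)%:C%C *: X j) = \sum_(0 <= j < n) c j * phi (X j).
Proof.
elim: n => [|n IH]; last by rewrite !big_nat_recr //= phiD phiZ IH.
by rewrite !big_nil -(scale0r (0 : MC)) -(rmorph0 (real_complex R)) phiZ mul0r.
Qed.

Lemma continuous_phi_rpow W (t : R) : 0 < t ->
  {for t, continuous (fun u : R => phi (E u * W))}.
Proof. by move=> t0; exact: is_derive_continuous (is_derive_rpow phiD phiZ phi_le M W t0). Qed.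

Lemma continuous_phi_rpow1 (t : R) : 0 < t ->
  {for t, continuous (fun u : R => u^-1 * phi (E u))}.
Proof.
move=> t0; apply: cvgM; first by apply: cvgV; [rewrite gt_eqF|exact: cvg_id].
have h : {for t, continuous (fun u : R => phi (E u * 1))} by exact: continuous_phi_rpow.
by move: h; rewrite (_ : (fun u : R => phi (E u * 1)) = phi \o E) //; apply/funext => u;
  rewrite mulr1.
Qed.

(* Repeated integration by parts: each step lowers the exponent of 1 - t / n
   and leaves one term of the sum.  At t = n only the term j = n survives: it
   is Gauss's approximation of Gamma(M). *)
Lemma Rintegral_truncated (x : R) n : 0 < x -> x < n%:R ->
  \int[lebesgue_measure]_(t in `[x, n%:R])
    ((1 - t / n%:R) ^+ n * (t^-1 * phi (E t))) =
  phi ((gauss_mx n M)^-1 -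
    \sum_(0 <= j < n.+1) (trunc_coef n j x)%:C%C *: (E x * V j.+1)).
Proof.
move=> x0 xn.
have n0 : (0 < n)%N by rewrite -(ltr0n R) (lt_trans x0).
have n0' : n%:R != 0 :> R by rewrite pnatr_eq0 -lt0n.
pose Phi (t : R) := \sum_(0 <= j < n.+1) trunc_coef n j t * phi (E t * V j.+1).
have part m (t : R) : (m <= n.+1)%N -> 0 < t -> is_derive t 1
    (fun u => \sum_(0 <= j < m) trunc_coef n j u * phi (E u * V j.+1)) (d n 0 t - d n m t).
  move=> + t0; elim: m => [|m IH] mn.
    rewrite subrr (_ : (fun u => _) = cst 0); first exact: is_derive_cst.
    by apply/funext => u; rewrite big_nil.
  rewrite (_ : (fun u => _) = fun u => \sum_(0 <= j < m) trunc_coef n j u * phi (E u * V j.+1)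
      + trunc_coef n m u * phi (E u * V m.+1)); last first.
    by apply/funext => u; rewrite big_nat_recr.
  have := is_derive_fun_add (IH (ltnW mn)) (is_derive_trunc_term n0 mn t0).
  by rewrite addrA subrK.
have dPhi (t : R) : 0 < t -> is_derive t 1 Phi ((1 - t / n%:R) ^+ n * (t^-1 * phi (E t))).
  move=> t0; have := part n.+1 t (leqnn _) t0.
  have -> : d n n.+1 t = 0.
    by rewrite /d /trunc_coef /falling_ratio ffact_small // !mul0r.
  rewrite subr0 /d /trunc_coef /falling_ratio ffactn0 expr0 divr1 mul1r subn0 expr0 mulr1.
  have e : E t * V 0 = E t by rewrite /V pochmx0 invr1 mulr1.
  by rewrite (congr1 phi e) mulrA => h; exact: h.
have -> : \int[lebesgue_measure]_(t in `[x, n%:R])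
    ((1 - t / n%:R) ^+ n * (t^-1 * phi (E t))) = Phi n%:R - Phi x.
  apply: (Rintegral_FTC2 xn).
    by move=> t /andP[xt _]; apply: dPhi; exact: lt_le_trans xt.
  move=> t /andP[xt _]; have t0 : 0 < t by exact: lt_le_trans xt.
  apply: cvgM; last exact: continuous_phi_rpow1.
  have d1 : is_derive t 1 (fun u : R => 1 - u / n%:R) (- n%:R^-1).
    by apply: is_derive_eq; rewrite /GRing.scale /=; ring.
  exact: is_derive_continuous (is_derive_fun_exprn n d1).
have phiN X : phi (- X) = - phi X.
  by rewrite -scaleN1r -(rmorph1 (real_complex R)) -rmorphN phiZ mulN1r.
rewrite phiD phiN (phi_sum n.+1 (fun j => trunc_coef n j x) (fun j => E x * V j.+1)).
congr (_ - _); rewrite /Phi big_nat_recr //= big_nat big1 => [|j /andP[_ jn]]; last first.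
  by rewrite /trunc_coef divff // subrr expr0n subn_eq0 leqNgt jn /= mulr0 !mul0r.
rewrite add0r /trunc_coef divff // subrr subnn expr0 mulr1 /falling_ratio ffactnn.
rewrite divfK ?expf_neq0 // gauss_mxV -(rmorph_nat (real_complex R)) phiZ.
by [].
Qed.

End TruncatedGamma.

Section ExponentialLimit.
Variable R : realType.
Local Notation mu := (@lebesgue_measure R).
Implicit Types (psi : R -> R) (x t : R).

Lemma bernoulli_ineq (a : R) n : 0 <= a <= 1 -> 1 - n%:R * a <= (1 - a) ^+ n.
Proof.
move=> /andP[a0 a1]; elim: n => [|n IH]; first by rewrite mul0r subr0 expr0.
have b0 : 0 <= 1 - a by rewrite subr_ge0.
rewrite exprSr; apply: le_trans (ler_wpM2r b0 IH).
rewrite -natr1 -subr_ge0 (_ : _ - _ = n%:R * (a * a)); last by ring.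
by rewrite mulr_ge0 ?mulr_ge0.
Qed.

(** For the lower bound, e^t >= (1 + t/n)^n gives (1 - t/n)^n e^t >= (1 - t^2/n^2)^n, and
    Bernoulli's inequality concludes. Both limit and majorant of the truncated integrand come from
    here. *)
Lemma expRN_bounds t n : 0 <= t -> (0 < n)%N -> t <= n%:R ->
  (1 - t ^+ 2 / n%:R) * expR (- t) <= (1 - t / n%:R) ^+ n /\
  (1 - t / n%:R) ^+ n <= expR (- t).
Proof.
move=> t0 n0 tn; have np : 0 < n%:R :> R by rewrite ltr0n.
have q0 : 0 <= t / n%:R by rewrite divr_ge0.
have q1 : t / n%:R <= 1 by rewrite ler_pdivrMr // mul1r.
have b0 : 0 <= 1 - t / n%:R by rewrite subr_ge0.
have eN (c : R) : expR (c / n%:R) ^+ n = expR c.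
  by rewrite -expRM_natl mulrC divfK // gt_eqF.
split; last first.
  rewrite -(eN (- t)) mulNr; apply: lerXn2r; rewrite ?nnegrE ?expR_ge0 //.
  exact: expR_ge1Dx.
rewrite expRN ler_pdivrMr ?expR_gt0 // -(eN t) -exprMn.
apply: (@le_trans _ _ ((1 - (t / n%:R) ^+ 2) ^+ n)).
  have -> : t ^+ 2 / n%:R = n%:R * (t / n%:R) ^+ 2 by field; rewrite gt_eqF.
  by apply: bernoulli_ineq; rewrite sqr_ge0 expr_le1.
apply: lerXn2r; rewrite ?nnegrE ?mulr_ge0 ?expR_ge0 //.
  by rewrite subr_ge0 expr_le1.
have -> : 1 - (t / n%:R) ^+ 2 = (1 - t / n%:R) * (1 + t / n%:R) by ring.
by rewrite ler_wpM2l // expR_ge1Dx.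
Qed.

Lemma integrable_scale (D : set R) (r : R) (h : R -> R) : measurable D ->
  mu.-integrable D (EFin \o h) -> mu.-integrable D (EFin \o (fun t => r * h t)).
Proof.
move=> mD ih; rewrite (_ : EFin \o _ = (fun t => r%:E * (EFin \o h) t)%E).
  by apply: (@integrableZl _ _ R mu _ _ r (EFin \o h)).
by apply/funext => t; rewrite /= EFinM.
Qed.

Lemma integrable_expR_half x (K : R) :
  mu.-integrable `[x, +oo[ (EFin \o (fun t => K * expR (- (t / 2)))).
Proof.
have c : continuous (fun t : R => expR (- (t / 2))).
  move=> t; apply: continuous_comp; last exact: continuous_expR.
  by apply: cvgN; apply: cvgMl; exact: cvg_id.
have dF (t : R) : is_derive t 1 (fun u : R => - 2 * expR (- (u / 2))) (expR (- (t / 2))).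
  apply: is_derive_eq; rewrite /GRing.scale /=. by field.
suff h : mu.-integrable `[x, +oo[ (EFin \o (fun t => expR (- (t / 2)))).
  exact: (integrable_scale K (measurable_itv _) h).
apply/integrableP; split.
  by apply/measurable_EFinP; apply: measurable_funTS; exact: continuous_measurable_fun.
under eq_integral do rewrite /= ger0_norm ?expR_ge0 //.
rewrite (@ge0_continuous_FTC2y _ _ (fun u : R => - 2 * expR (- (u / 2))) x 0).
- by rewrite -EFinB ltry.
- by move=> t _; exact: expR_ge0.
- exact: continuous_subspaceT.
- rewrite -(mulr0 (- 2)); apply: cvgMr.
  apply: (@cvg_comp _ _ _ (fun u : R => u / 2) (fun u => expR (- u))); last exact: cvgr_expR.
  by apply: gt0_cvgMly => //; exact: cvg_id.
- by move=> t _; have [] := dF t.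
- by apply: cvg_at_right_filter; exact: is_derive_continuous (dF x).
- by move=> t _; rewrite derive1E; have [_ ->] := dF t.
Qed.

(** Extended by 0 beyond n, the integrands live on a common half-line and are dominated by K
    e^(-t/2): half of the decay of e^(-t) is given up to the growth of [psi]. *)
Lemma Rintegral_truncated_limit psi x (K : R) : 0 < x ->
  (forall t, 0 < t -> {for t, continuous psi}) ->
  (forall t, x <= t -> `|psi t| <= K * expR (t / 2)) ->
  (fun n : nat => \int[mu]_(t in `[x, n%:R]) ((1 - t / n%:R) ^+ n * psi t)) @ \oo -->
  \int[mu]_(t in `[x, +oo[) (expR (- t) * psi t).
Proof.
move=> x0 cpsi psiK.
have mpsi : measurable_fun `[x, +oo[ psi.
  have m0 : measurable_fun (`]0%R, +oo[%classic : set R) psi.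
    apply: open_continuous_measurable_fun; first exact: interval_open.
    by move=> t; rewrite inE /= in_itv /= andbT => /cpsi.
  apply: measurable_funS m0 => //.
  by move=> t /=; rewrite !in_itv /= !andbT; exact: lt_le_trans.
pose f (n : nat) (t : R) := (1 - t / n%:R) ^+ n * psi t.
pose p n := f n \_ `]-oo, n%:R].
have pE n : \int[mu]_(t in `[x, +oo[) p n t = \int[mu]_(t in `[x, n%:R]) f n t.
  rewrite -Rintegral_mkcondr; congr Rintegral; apply/seteqP; split => t /=;
    rewrite !in_itv /= ?andbT; first by case=> -> ->.
  by move=> /andP[-> ->].
have lim : (fun n => \int[mu]_(t in `[x, +oo[) p n t) @ \oo -->
    \int[mu]_(t in `[x, +oo[) (expR (- t) * psi t).
  apply: (@Rintegral_dominated _ _ _ _ (fun t => K * expR (- (t / 2)))) => //.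
  - move=> n; apply/measurable_restrict => //.
    apply: measurable_funS (_ : measurable_fun `[x, +oo[ (f n)) => //.
    apply: measurable_funM => //; apply: measurable_funTS.
    apply: continuous_measurable_fun => t.
    have d1 : is_derive t 1 (fun u : R => 1 - u / n%:R) (- n%:R^-1).
      by apply: is_derive_eq; rewrite /GRing.scale /=; ring.
    exact: is_derive_continuous (is_derive_fun_exprn n d1).
  - move=> t; rewrite /= in_itv /= andbT => xt.
    have t0 : 0 <= t by rewrite (le_trans (ltW x0)).
    have h : (fun n : nat => (1 - t / n%:R) ^+ n) @ \oo --> expR (- t).
      have h1 : (fun n : nat => (1 - t ^+ 2 / n%:R) * expR (- t)) @ \oo --> (1 - t ^+ 2 * 0) * expR (- t).
        apply: cvgMl; apply: cvgB; first exact: cvg_cst.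
        by apply: cvgMr; rewrite -cvg_shiftS; exact: cvg_harmonic.
      rewrite mulr0 subr0 mul1r in h1.
      apply: (squeeze_cvgr _ h1 (cvg_cst _)); near=> n.
      have n0 : (0 < n)%N by near: n; exact: nbhs_infty_gt.
      have tn : t <= n%:R by near: n; exact: nbhs_infty_ger.
      by have [-> ->] := expRN_bounds t0 n0 tn.
    have hm : (fun n : nat => (1 - t / n%:R) ^+ n * psi t) @ \oo --> expR (- t) * psi t.
      exact: cvgMl.
    apply: cvg_trans hm; apply: near_eq_cvg; near=> n.
    have tn : t <= n%:R by near: n; exact: nbhs_infty_ger.
    by rewrite /p patchE mem_set //= in_itv /=.
  - exact: integrable_expR_half.
  - move=> n t; rewrite /= in_itv /= andbT => xt.
    have K0 : 0 <= K * expR (- (t / 2)).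
      have := le_trans (normr_ge0 _) (psiK t xt).
      by rewrite pmulr_lge0 ?expR_gt0 // => k0; rewrite mulr_ge0 ?expR_ge0.
    rewrite /p patchE; case: ifPn => [|_]; last by rewrite normr0.
    rewrite inE /= in_itv /= => tn.
    have t0 : 0 < t by rewrite (lt_le_trans x0).
    have n0 : (0 < n)%N by rewrite -(ltr0n R) (lt_le_trans t0).
    have [_ h] := expRN_bounds (ltW t0) n0 tn.
    have b0 : 0 <= (1 - t / n%:R) ^+ n.
      by rewrite exprn_ge0 // subr_ge0 ler_pdivrMr ?ltr0n // mul1r.
    rewrite /f normrM (ger0_norm b0).
    apply: le_trans (ler_pM b0 (normr_ge0 _) h (psiK t xt)) _.
    by rewrite mulrCA -expRD (_ : - t + t / 2 = - (t / 2)) //; lra.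
apply: cvg_trans lim; apply: near_eq_cvg; near=> n; exact: pE.
Unshelve. all: by end_near.
Qed.

End ExponentialLimit.

Section IncompleteGamma.
Variables (R : realType) (N : nat).
Local Notation MC := 'M[R[i]]_N.+1.
Local Notation mu := (@lebesgue_measure R).
Implicit Types (v : algnorm R N) (M : MC) (x t : R).

Local Notation rpow M t := (mxexp ((ln t)%:C%C *: M)).

Lemma rpowmx_sub1 M t : 0 < t -> rpowmx t (M - 1%:M) = (t^-1)%:C%C *: rpow M t.
Proof.
move=> t0; rewrite /rpowmx scalerBr mxexpD; last first.
  by rewrite -scaleNr -!scalerAr -!scalerAl mulr1 mul1r scalerA mulrC -scalerA.
have -> : mxexp (- ((ln t)%:C%C *: (1%:M : MC))) = ((t^-1)%:C%C)%:M.
  rewrite -scaleNr -rmorphN scalemx1 mxexp_scalar /cexp /= expRN lnK ?posrE //.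
  by rewrite cos0 sin0; congr (_%:M); rewrite mulr1.
by rewrite -[RHS]mul_scalar_mx -scalar_mxC.
Qed.

(** The slope 1/a is free. With a = 2 |M| + 1, the bound exp(|M| |ln t|) on t^M is at most a
    constant times e^(t/2). *)
Lemma norm_ln_le x t (a : R) : 0 < a -> 0 < x -> x <= t ->
  `|ln t| <= `|ln x| + `|ln a| + t / a.
Proof.
move=> a0 x0 xt; have t0 : 0 < t by exact: lt_le_trans xt.
have q0 : 0 <= t / a by rewrite divr_ge0 ?ltW.
have [l0|l0] := leP 0 (ln t); last first.
  have : ln x <= ln t by rewrite ler_ln ?posrE.
  rewrite ltr0_norm // => h; rewrite -addrA; apply: ler_wpDr; first by rewrite addr_ge0.
  by have := ler_norm (- ln x); rewrite normrN; lra.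
rewrite ger0_norm //.
have e : ln t = ln (t / a) + ln a by rewrite ln_div ?posrE // subrK.
have h1 : ln (t / a) < t / a by apply: ln_sublinear; rewrite divr_gt0.
have h2 := ler_norm (ln a); have h3 := normr_ge0 (ln x).
by rewrite e; lra.
Qed.

Section Component.
Variables (v : algnorm R N) (phi : MC -> R) (C : R).
Hypothesis phiD : forall X Y, phi (X + Y) = phi X + phi Y.
Hypothesis phiZ : forall (r : R) X, phi (r%:C%C *: X) = r * phi X.
Hypothesis phi_le : forall X, `|phi X| <= C * v X.

Lemma phi_rpow_le M x : 0 < x -> exists K : R, forall t, x <= t ->
  `|t^-1 * phi (rpow M t)| <= K * expR (t / 2).
Proof.
move=> x0; pose q := v M; pose a := 2 * q + 1.
have q0 : 0 <= q := nu_ge0 v M.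
have a0 : 0 < a by rewrite ltr_wpDl ?mulr_ge0.
have C0 : 0 <= C by have := le_trans (normr_ge0 _) (phi_le 1); rewrite nu1 mulr1.
exists (x^-1 * (C * expR (q * (`|ln x| + `|ln a|)))) => t xt.
have t0 : 0 < t by exact: lt_le_trans xt.
rewrite normrM -!mulrA; apply: ler_pM => //.
  by rewrite ger0_norm ?invr_ge0 ?(ltW t0) // lef_pV2 ?posrE.
apply: le_trans (phi_le _) _; apply: ler_wpM2l => //.
apply: le_trans (nu_mxexp _ _) _; rewrite -expRD ler_expR nuZ cmod_real -/q mulrC.
apply: le_trans (ler_wpM2l q0 (norm_ln_le a0 x0 xt)) _.
rewrite mulrDr lerD2l mulrCA ler_wpM2l ?(ltW t0) //.
by rewrite ler_pdivrMr // /a; lra.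
Qed.

Lemma phi_incgamma_limit M x : (forall k, M + k%:R%:M \is a GRing.unit) -> 0 < x ->
  (fun n => phi ((gauss_mx n M)^-1 - \sum_(0 <= j < n.+1)
      (trunc_coef n j x)%:C%C *: (rpow M x * (pochmx M j.+1)^-1))) @ \oo -->
  \int[mu]_(t in `[x, +oo[) (expR (- t) * (t^-1 * phi (rpow M t))).
Proof.
move=> Mu x0; have [K HK] := phi_rpow_le M x0.
have cont t : 0 < t -> {for t, continuous (fun u : R => u^-1 * phi (rpow M u))}.
  by move=> t0; exact: continuous_phi_rpow1 phiD phiZ phi_le M t t0.
have h := @Rintegral_truncated_limit R (fun t => t^-1 * phi (rpow M t)) x K x0 cont HK.
apply: cvg_trans h; apply: near_eq_cvg; near=> n.
have xn : x < n%:R by near: n; exact: nbhs_infty_gtr.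
exact: (Rintegral_truncated phiD phiZ phi_le Mu x0 xn).
Unshelve. all: by end_near.
Qed.

End Component.

(** The integral starts at x > 0, so that M enters only through the invertibility of all M + k;
    Gauss's approximation of Gamma(M) appears as the boundary term at t = n. *)
Lemma incgammamx_limit M x : (forall k, M + k%:R%:M \is a GRing.unit) -> 0 < x ->
  (fun n => (gauss_mx n M)^-1 - \sum_(0 <= j < n.+1)
      (trunc_coef n j x)%:C%C *: (rpow M x * (pochmx M j.+1)^-1)) @ \oo -->
  incgammamx M x.
Proof.
move=> Mu x0; pose G (n : nat) : MC := (gauss_mx n M)^-1 - \sum_(0 <= j < n.+1)
      (trunc_coef n j x)%:C%C *: (rpow M x * (pochmx M j.+1)^-1).
apply/(@cvg_mx_entryP _ _ G) => i j.
have entry (X : MC) : cmod (X i j) <= 1 * rownorm R N X.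
  rewrite mul1r; apply: le_trans (le_max_row_sum X i).
  by rewrite (bigD1 j) //= lerDl; apply: sumr_ge0 => k _; exact: cmod_ge0.
have incE (psi : R[i] -> R) : (forall (r : R) c, psi (r%:C%C * c) = r * psi c) ->
    \int[mu]_(t in `[x, +oo[) psi (((expR (- t))%:C%C *: rpowmx t (M - 1%:M)) i j) =
    \int[mu]_(t in `[x, +oo[) (expR (- t) * (t^-1 * psi (rpow M t i j))).
  move=> psiZ; apply: eq_Rintegral => t; rewrite inE /= in_itv /= andbT => xt.
  by rewrite rpowmx_sub1 ?(lt_le_trans x0) // !mxE !psiZ.
have ReZ (r : R) c : complex.Re (r%:C%C * c) = r * complex.Re c.
  by rewrite cReM /= mul0r subr0.
have ImZ (r : R) c : complex.Im (r%:C%C * c) = r * complex.Im c.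
  by rewrite cImM /= mul0r addr0.
have hrD (X Y : MC) : complex.Re ((X + Y) i j) = complex.Re (X i j) + complex.Re (Y i j).
  by rewrite mxE raddfD.
have hrZ (r : R) (X : MC) : complex.Re ((r%:C%C *: X) i j) = r * complex.Re (X i j).
  by rewrite mxE ReZ.
have hr_le (X : MC) : `|complex.Re (X i j)| <= 1 * rownorm R N X.
  exact: le_trans (cmod_Re _) (entry X).
have hr : (fun n => complex.Re (G n i j)) @ \oo --> _ :=
  @phi_incgamma_limit _ (fun X => complex.Re (X i j)) _ hrD hrZ hr_le M x Mu x0.
have hiD (X Y : MC) : complex.Im ((X + Y) i j) = complex.Im (X i j) + complex.Im (Y i j).
  by rewrite mxE raddfD.
have hiZ (r : R) (X : MC) : complex.Im ((r%:C%C *: X) i j) = r * complex.Im (X i j).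
  by rewrite mxE ImZ.
have hi_le (X : MC) : `|complex.Im (X i j)| <= 1 * rownorm R N X.
  exact: le_trans (cmod_Im _) (entry X).
have hi : (fun n => complex.Im (G n i j)) @ \oo --> _ :=
  @phi_incgamma_limit _ (fun X => complex.Im (X i j)) _ hiD hiZ hi_le M x Mu x0.
rewrite -(incE _ ReZ) in hr; rewrite -(incE _ ImZ) in hi.
have d0 (f : nat -> R) l : f @ \oo --> l -> (fun n => `|f n - l|) @ \oo --> (0 : R).
  move=> h; rewrite -(normr0 R) -(subrr l).
  by apply: cvg_norm; apply: cvgB => //; exact: cvg_cst.
apply: (@squeeze_cvgr _ _ _ _ (cst 0) (fun n =>
  `|complex.Re (G n i j) - complex.Re (incgammamx M x i j)| +
  `|complex.Im (G n i j) - complex.Im (incgammamx M x i j)|)).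
- by near=> n; apply/andP; split; [exact: cmod_ge0|apply: le_trans (cmod_ReIm _) _; rewrite !raddfB].
- exact: cvg_cst.
- rewrite -[X in _ --> X]addr0; apply: cvgD.
    by rewrite /incgammamx /mxintegral mxE; exact: d0 hr.
  by rewrite /incgammamx /mxintegral mxE; exact: d0 hi.
Unshelve. all: by end_near.
Qed.

Lemma trunc_coef_le n j x : 0 <= x -> x <= n%:R -> (j <= n)%N ->
  `|trunc_coef n j x| <= x ^+ j.
Proof.
move=> x0 xn jn.
have fr : 0 <= falling_ratio R n j <= 1.
  rewrite divr_ge0 ?exprn_ge0 //=.
  elim: j jn => [|j IH] jn; first by rewrite /falling_ratio ffactn0 expr0 divr1.
  have -> : falling_ratio R n j.+1 = falling_ratio R n j * ((n - j)%:R / n%:R).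
    by rewrite /falling_ratio ffactnSr natrM exprSr invfM; ring.
  rewrite mulr_ile1 ?divr_ge0 ?exprn_ge0 //; first exact: IH (ltnW jn).
  by rewrite ler_pdivrMr ?mul1r ?ler_nat ?leq_subr // ltr0n; lia.
have /andP[f0 f1] := fr.
have [n0|n0] := posnP n.
  have j0 : j = 0%N by lia.
  by rewrite /trunc_coef n0 j0 /= !expr0 !mulr1 ger0_norm /falling_ratio ffactn0 ?expr0 divr1.
have b : 0 <= 1 - x / n%:R <= 1.
  rewrite subr_ge0 ler_pdivrMr ?ltr0n // mul1r xn /= gerBl divr_ge0 //.
have /andP[b0 b1] := b.
rewrite /trunc_coef ger0_norm ?mulr_ge0 ?exprn_ge0 //.
apply: ler_piMl; first exact: exprn_ge0.
by rewrite mulr_ile1 ?exprn_ge0 // exprn_ile1.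
Qed.

(** Multiplied by [gauss_mx n M], Gauss's approximation cancels exactly, and only the finite sum is
    left. Under the assumption on the Pochhammer symbols it is bounded by |x^M| times a partial sum
    of e^x. *)
Lemma nu_one_sub_incgamma v M x : (forall k, M + k%:R%:M \is a GRing.unit) -> 0 < x ->
  (forall j, v (pochmx M j.+1)^-1 <= j`!%:R^-1) ->
  v (1 - incgammamx M x * rgauss M) <= v (rpow M x) * expR x * v (rgauss M).
Proof.
move=> Mu x0 hV.
pose S n : MC := \sum_(0 <= j < n.+1)
  (trunc_coef n j x)%:C%C *: (rpow M x * (pochmx M j.+1)^-1).
have h : (fun n => ((gauss_mx n M)^-1 - S n) * gauss_mx n M) @ \oo -->
    incgammamx M x * rgauss M.
  exact: (cvg_mxM (incgammamx_limit Mu x0) (rgauss_cvg (M := M))).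
have lim1 : (fun n => v (1 - ((gauss_mx n M)^-1 - S n) * gauss_mx n M)) @ \oo -->
    v (1 - incgammamx M x * rgauss M).
  by apply: cvg_nu; exact: cvg_mxB (cvg_cst _) h.
have lim2 : (fun n => v (rpow M x) * expR x * v (gauss_mx n M)) @ \oo -->
    v (rpow M x) * expR x * v (rgauss M).
  by apply: cvgMr; apply: cvg_nu; exact: rgauss_cvg.
apply: (ler_cvg_to lim1 lim2); near=> n.
have xn : x <= n%:R by near: n; exact: nbhs_infty_ger.
rewrite mulrBl mulVr ?gauss_mx_unit // subKr /S.
apply: le_trans (nuM _ _ _) _; apply: ler_wpM2r; first exact: nu_ge0.
apply: le_trans (nu_sum _ _ _ _) _.
apply: (@le_trans _ _ (v (rpow M x) * series (exp_coeff x) n.+1)); last first.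
  apply: ler_wpM2l; first exact: nu_ge0.
  apply: nondecreasing_cvgn_le; last exact: is_cvg_series_exp_coeff.
  by apply: nondecreasing_series => k _ _; apply: exp_coeff_ge0; exact: ltW.
rewrite seriesEnat /= mulr_sumr; apply: ler_sum_nat => j /andP[_ jn].
rewrite nuZ cmod_real mulrCA; apply: ler_pM => //; first exact: nu_ge0.
  by apply: trunc_coef_le => //; exact: ltW.
apply: le_trans (nuM _ _ _) _; apply: ler_wpM2l; first exact: nu_ge0.
exact: hV.
Unshelve. all: by end_near.
Qed.

End IncompleteGamma.

(** * Asymptotics of the incomplete Gamma ratio *)

Section AdaptedNorm.
Variables (R : realType) (N : nat).
Local Notation MC := 'M[R[i]]_N.+1.
Implicit Types (P T U : MC).

Lemma triangular_reduction P : exists U, U \is a GRing.unit /\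
  (forall i j : 'I_N.+1, (i < j)%N -> (U * P * U^-1) i j = 0) /\
  (forall i, eigenvalue P ((U * P * U^-1) i i)).
Proof.
have [U Uu trig] := Schur P (ltn0Sn N).
have Uunit : U \in unitmx by exact: unitarymx_unit.
have {}trig : is_trig_mx (conjmx U P) by exact: trig.
rewrite conjumx // in trig.
exists U; split; first exact: Uunit.
pose T := U * P * U^-1; have trigT : is_trig_mx T by exact: trig.
split=> [i j ij|i].
  by move/is_trig_mxP : trigT; apply.
have : eigenvalue T (T i i).
  rewrite eigenvalue_root_char char_poly_trig // /root horner_prod.
  by apply/prodf_eq0; exists i => //; rewrite hornerXsubC subrr.
move=> /eigenvalueP [w wT w0]; apply/eigenvalueP; exists (w *m U).
  rewrite -mulmxA scalemxAl -wT /T -!mulmxE !mulmxA.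
  by rewrite mulmxKV.
by apply: contraNneq w0 => wU; rewrite -(mulmxK Uunit w) wU mul0mx.
Qed.

(** The square is 1 - 2 h Re a + h^2 |a|^2 <= 1 - 2 h d + h d = 1 - h d <= (1 - h d / 2)^2. *)
Lemma cmod_one_sub_le (h d : R) (a : R[i]) : 0 < h -> 0 < d -> d <= complex.Re a ->
  h * cmod a ^+ 2 <= d -> h * d <= 2 -> cmod (1 - h%:C%C * a) <= 1 - h * d / 2.
Proof.
move=> h0 d0 da ha hd; have b0 : 0 <= 1 - h * d / 2 by lra.
rewrite -(ler_sqr (cmod_ge0 _) b0).
case: a da ha => a b /= da ha.
rewrite /cmod /= in ha *; rewrite sqr_sqrtr ?addr_ge0 ?sqr_ge0 // in ha.
rewrite sqr_sqrtr ?addr_ge0 ?sqr_ge0 // !mul0r subr0 addr0 sub0r sqrrN.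
have h2 : h * (h * (a ^+ 2 + b ^+ 2)) <= h * d by rewrite ler_pM2l.
have h3 : h * d <= h * a by rewrite ler_pM2l.
have h4 : 0 <= (h * d) ^+ 2 by exact: sqr_ge0.
by nra.
Qed.

(* In a triangular basis of P, a diagonal rescaling makes the off-diagonal
   entries as small as desired in the row-sum norm. *)
Theorem adapted_norm P : positive_stable P -> exists (v : algnorm R N) (h q : R),
  [/\ 0 < h, 0 <= q < 1 & v (1 - h%:C%C *: P) <= q].
Proof.
move=> stab; have [U [Uu [trig eig]]] := triangular_reduction P.
pose T := U * P * U^-1.
pose tau := \sum_i \sum_j cmod (T i j).
have tau0 : 0 <= tau by apply: sumr_ge0 => i _; apply: sumr_ge0 => j _; exact: cmod_ge0.
have row_tau i : \sum_j cmod (T i j) <= tau.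
  rewrite /tau [leRHS](bigD1 i) //= lerDl.
  by apply: sumr_ge0 => k _; apply: sumr_ge0 => j _; exact: cmod_ge0.
have T_tau i j : cmod (T i j) <= tau.
  apply: le_trans (row_tau i); rewrite (bigD1 j) //= lerDl.
  by apply: sumr_ge0 => k _; exact: cmod_ge0.
have [d d0 hd] : exists2 d : R, 0 < d & forall i, d <= complex.Re (T i i).
  pose i0 := [arg min_(i < ord0) complex.Re (T i i)]%O.
  exists (complex.Re (T i0 i0)); first exact: stab (eig i0).
  by move=> i; rewrite /i0; case: arg_minP => // k _ /(_ i isT).
have D0 : 0 < tau ^+ 2 + d ^+ 2 + 1 by rewrite ltr_wpDl // addr_ge0 ?sqr_ge0.
(* Small enough for both [htau] and [hd1], which [cmod_one_sub_le] needs for the diagonal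
   entries. *)
pose h := d / (tau ^+ 2 + d ^+ 2 + 1); have h0 : 0 < h by rewrite divr_gt0.
have hd1 : h * d <= 1.
  rewrite /h mulrAC ler_pdivrMr // mul1r -expr2.
  by have := sqr_ge0 tau; lra.
have htau : h * tau ^+ 2 <= d.
  rewrite /h mulrAC ler_pdivrMr // ler_pM2l //.
  by have := sqr_ge0 d; lra.
have E0 : 0 < 4 * tau + 4 * d by rewrite ltr_wpDl ?mulr_ge0 ?mulr_gt0.
(* Off the diagonal a row then contributes at most h d / 4, half of the gain h d / 2 on the
   diagonal; what remains is q = 1 - h d / 4. *)
pose eta := d / (4 * tau + 4 * d); have eta0 : 0 < eta by rewrite divr_gt0.
have eta1 : eta <= 1 by rewrite ler_pdivrMr // mul1r; lra.
have eta_tau : eta * tau <= d / 4.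
  rewrite /eta mulrAC ler_pdivrMr // mulrAC -mulrA ler_pM2l //.
  by lra.
pose D : MC := diag_mx (\row_i (eta ^+ i)%:C%C).
pose D' : MC := diag_mx (\row_i (eta ^- i)%:C%C).
have etan0 n : eta ^+ n != 0 by rewrite expf_neq0 // gt_eqF.
have DD' : D * D' = 1.
  rewrite -mulmxE mulmx_diag -[1]/(1%:M) -diag_const_mx; congr diag_mx.
  by apply/rowP => j; rewrite !mxE -rmorphM /= divff // rmorph1.
have Du : D \is a GRing.unit.
  by apply: (mulmx1_unit (DD' : D *m D' = 1%:M)).1.
have DV : D^-1 = D' by apply: (mulrI Du); rewrite mulrV.
pose W := D * U.
have Wu : W \in unitmx by rewrite -[_ \in _]/(W \is a GRing.unit) unitrMl.
pose q := 1 - h * d / 4.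
exists (conjnorm (rownorm R N) Wu), h, q; split => //.
  rewrite /q; have : 0 < h * d by rewrite mulr_gt0.
  by move=> ?; apply/andP; split; lra.
rewrite /=.
have Wu' : W \is a GRing.unit by exact: Wu.
have WV : W^-1 = U^-1 * D' by rewrite /W (invrM Du Uu) DV.
have conjP : W * P * W^-1 = D * T * D' by rewrite WV /W /T !mulrA.
have -> : W * (1 - h%:C%C *: P) * W^-1 = 1 - h%:C%C *: (D * T * D').
  by rewrite mulrBr mulr1 mulrBl (mulrV Wu') -scalerAr -scalerAl conjP.
have DTD i j : (D * T * D') i j = (eta ^+ i / eta ^+ j)%:C%C * T i j.
  rewrite -!mulmxE mul_mx_diag mxE mul_diag_mx !mxE rmorphM /=.
  by ring.
apply: max_row_sum_le => [|i]; first by rewrite /q; have : 0 < h * d by [rewrite mulr_gt0]; lra.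
rewrite (bigD1 i) //=.
have -> : (1 - h%:C%C *: (D * T * D')) i i = 1 - h%:C%C * T i i.
  by rewrite mxE [(1 : MC) i i]mxE eqxx mxE mxE DTD divff // rmorph1 mul1r.
have diag_le := cmod_one_sub_le h0 d0 (hd i).
have {}diag_le : cmod (1 - h%:C%C * T i i) <= 1 - h * d / 2.
  apply: diag_le; last by lra.
  apply: le_trans htau; rewrite ler_pM2l //.
  by apply: lerXn2r; rewrite ?nnegrE ?cmod_ge0.
have off_le : \sum_(j < N.+1 | j != i) cmod ((1 - h%:C%C *: (D * T * D')) i j) <= h * (eta * tau).
  apply: (@le_trans _ _ (\sum_(j < N.+1 | j != i) h * eta * cmod (T i j))); last first.
    rewrite -mulr_sumr -mulrA; apply: ler_wpM2l; first exact: ltW.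
    apply: ler_wpM2l; first exact: ltW.
    apply: le_trans (row_tau i); rewrite [leRHS](bigD1 i) //= lerDr; exact: cmod_ge0.
  apply: ler_sum => j ji.
  have -> : (1 - h%:C%C *: (D * T * D')) i j = - (h%:C%C * (D * T * D') i j).
    by rewrite mxE [(1 : MC) i j]mxE eq_sym (negbTE ji) add0r mxE mxE.
  rewrite cmodN DTD !cmodM !cmod_real gtr0_norm // -mulrA ler_pM2l //.
  have [ij|ij|ij] := ltngtP i j.
  - by rewrite [T i j]trig // cmod0 !mulr0.
  - apply: ler_wpM2r; first exact: cmod_ge0.
    rewrite ger0_norm ?divr_ge0 ?exprn_ge0 ?(ltW eta0) //.
    rewrite ler_pdivrMr ?exprn_gt0 // -exprS.
    by apply: ler_wiXn2l => //; exact: ltW.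
  - by rewrite -(inj_eq val_inj) /= ij eqxx in ji.
have : h * (eta * tau) <= h * (d / 4) by rewrite ler_pM2l.
by rewrite /q; lra.
Qed.

End AdaptedNorm.

Section GammaRatio.
Variables (R : realType) (N : nat) (v : algnorm R N).
Local Notation MC := 'M[R[i]]_N.+1.
Variables (P Q : MC) (h q : R).
Hypothesis PQ : P * Q = Q * P.
Hypothesis h0 : 0 < h.
Hypothesis q01 : 0 <= q < 1.
Hypothesis Wq : v (1 - h%:C%C *: P) <= q.

Let W : MC := 1 - h%:C%C *: P.
(** Since P = (1 - W) / h with |W| <= q, P behaves in this norm as if its real part were at least
    [delta]. *)
Let delta := (1 - q) / h.
Let delta0 : 0 < delta.
Proof. by have /andP[_ q1] := q01; rewrite divr_gt0 // subr_gt0. Qed.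

Let PE : P = (h^-1)%:C%C *: (1 - W).
Proof.
rewrite /W opprB addrCA subrr addr0 scalerA -rmorphM mulVf ?gt_eqF //.
by rewrite rmorph1 scale1r.
Qed.

(** e^(-sP) = e^(-s/h) e^((s/h) W), and the second factor is at most e^(q s/h). *)
Lemma nu_mxexp_decay (s : R) : 0 <= s -> v (mxexp ((- s)%:C%C *: P)) <= expR (- (delta * s)).
Proof.
move=> s0.
have -> : (- s)%:C%C *: P = (- (s / h))%:C%C%:M + (s / h)%:C%C *: W.
  rewrite {1}PE scalerA -rmorphM scalerBr scalemx1 mulNr.
  by rewrite [in X in _ - X]rmorphN scaleNr opprK.
rewrite mxexpD; last first.
  by rewrite -!mulmxE -scalar_mxC.
have sh : 0 <= s / h by rewrite divr_ge0 // ltW.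
apply: le_trans (nuM _ _ _) _.
have h1 : v (mxexp ((- (s / h))%:C%C%:M)) <= expR (- (s / h)).
  rewrite mxexp_scalar nu_scalar /cexp cmodM [complex.Re _]/= [complex.Im _]/= cos0 sin0.
  rewrite cmod_real ger0_norm ?expR_ge0 //.
  by rewrite [X in _ * X](_ : _ = 1) ?mulr1 // -[RHS](cmod1 R).
have h2 : v (mxexp ((s / h)%:C%C *: W)) <= expR (s / h * q).
  apply: le_trans (nu_mxexp _ _) _; rewrite ler_expR nuZ cmod_real ger0_norm //.
  by rewrite ler_wpM2l.
apply: le_trans (ler_pM (nu_ge0 _ _) (nu_ge0 _ _) h1 h2) _.
rewrite -expRD ler_expR le_eqVlt; apply/orP; left; apply/eqP.
by rewrite /delta; field; rewrite gt_eqF.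
Qed.

(** Write n P + Q + k = c (1 - Z) with c = k + n/h. Then c (1 - |Z|) >= k + delta n - |Q| >= k + 1;
    the 1 added to |Q| in the hypothesis is what yields k + 1 and, in products, the factorials. *)
Lemma nu_resolvent_shift (n k : nat) : v Q + 1 <= delta * n%:R ->
  n%:R *: P + Q + k%:R%:M \is a GRing.unit /\
  v (n%:R *: P + Q + k%:R%:M)^-1 <= k.+1%:R^-1.
Proof.
move=> nQ; set M := _ + _ + _.
have vQ0 := nu_ge0 v Q.
have n0 : 0 < n%:R :> R.
  have : 0 < delta * n%:R by apply: lt_le_trans nQ; rewrite ltr_wpDl.
  by rewrite pmulr_rgt0.
pose c := k%:R + n%:R / h; have c0 : 0 < c by rewrite ltr_wpDl // divr_gt0.
pose Z := (c^-1)%:C%C *: ((n%:R / h)%:C%C *: W - Q).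
have hq : n%:R / h - n%:R / h * q = delta * n%:R.
  by rewrite /delta; field; rewrite gt_eqF.
have vZ : v Z <= c^-1 * (n%:R / h * q + v Q).
  rewrite nuZ cmod_real gtr0_norm ?invr_gt0 // ler_pM2l ?invr_gt0 //.
  apply: le_trans (nuB _ _ _) _; rewrite lerD2r nuZ cmod_real.
  by rewrite gtr0_norm ?divr_gt0 // ler_pM2l ?divr_gt0.
have ME : M = c%:C%C *: (1 - Z).
  rewrite /Z scalerBr scalerA -rmorphM divff ?gt_eqF // rmorph1 scale1r.
  rewrite /M {1}PE scalerA -(rmorph_nat (real_complex R)) -rmorphM scalerBr.
  rewrite /c rmorphD scalerDl (rmorph_nat (real_complex R)) !scalemx1.
  move: (_ *: W) (_%:M) (_%:M) => X Y Z'.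
  by rewrite opprB addrC -!addrA; congr (_ + (_ + _)); rewrite addrC.
have c1 : k%:R + 1 <= c - (n%:R / h * q + v Q) by rewrite /c; lra.
have k0 : 0 <= k%:R :> R by [].
have vZ1 : v (1 - (1 - Z)) < 1.
  rewrite subKr; apply: le_lt_trans vZ _; rewrite mulrC ltr_pdivrMr // mul1r; lra.
have [Zu Zn] := nu_unit vZ1; rewrite subKr in Zn vZ1.
have cu : (c%:C%C : R[i]) \is a GRing.unit by rewrite unitfE fmorph_eq0 gt_eqF.
rewrite ME scaler_unit //; split; first exact: Zu.
rewrite invrZ // nuZ cmodV cmod_real gtr0_norm //.
apply: le_trans (ler_wpM2l _ Zn) _; first by rewrite invr_ge0 ltW.
have p1 : 0 < 1 - v Z by rewrite subr_gt0.
rewrite -invfM lef_pV2 ?posrE ?mulr_gt0 //.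
rewrite mulrBr mulr1 -natr1; apply: le_trans c1 _; rewrite lerD2l lerN2.
by rewrite -ler_pdivlMl.
Qed.

Lemma shifted_units (n : nat) : v Q + 1 <= delta * n%:R ->
  forall k, n%:R *: P + Q + k%:R%:M \is a GRing.unit.
Proof. by move=> nQ k; case: (nu_resolvent_shift k nQ). Qed.

Lemma nu_pochmx_inv (n j : nat) : v Q + 1 <= delta * n%:R ->
  v (pochmx (n%:R *: P + Q) j.+1)^-1 <= j`!%:R^-1.
Proof.
move=> nQ; have Mu := shifted_units nQ.
apply: (@le_trans _ _ (j.+1`!%:R^-1)); last first.
  by rewrite lef_pV2 ?posrE ?ltr0n ?fact_gt0 // ler_nat factS leq_pmull.
elim: j.+1 => [|k IH]; first by rewrite pochmx0 invr1 nu1 invr1.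
rewrite pochmxS invrM ?pochmx_unit // factS natrM invfM.
apply: le_trans (nuM _ _ _) _; apply: ler_pM; rewrite ?nu_ge0 //.
by case: (nu_resolvent_shift k nQ).
Qed.

(** All L + 1 factors are at most 2 L; (2 L)^L / L! and the leftover 2 L are each at most e^(2
    L). *)
Lemma gauss_prefactor_le (L : nat) : (0 < L)%N ->
  L`!%:R^-1 * \prod_(k < L.+1) (L%:R + k%:R) <= expR (4 * L%:R) :> R.
Proof.
move=> L0; have Lp : 0 < L%:R :> R by rewrite ltr0n.
have f0 : 0 < L`!%:R :> R by rewrite ltr0n fact_gt0.
apply: (@le_trans _ _ (L`!%:R^-1 * (2 * L%:R) ^+ L.+1)).
  rewrite ler_wpM2l ?invr_ge0 ?(ltW f0) //.
  rewrite -[X in _ ^+ X](card_ord L.+1) -prodr_const; apply: ler_prod => k _.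
  rewrite addr_ge0 //=.
  have : k%:R <= L%:R :> R by rewrite ler_nat -ltnS.
  by lra.
have [l lE] : exists l, L = l.+1 by exists L.-1; rewrite prednK.
have h1 : (2 * L%:R) ^+ L / L`!%:R <= expR (2 * L%:R) :> R.
  have := @expR_ge1Dxn R (2 * L%:R) l; rewrite -lE mulr_ge0 // => /(_ isT).
  by apply: le_trans; rewrite lerDr.
have h2 : 2 * L%:R <= expR (2 * L%:R) :> R.
  by apply: le_trans (expR_ge1Dx _); rewrite lerDr.
rewrite exprS (_ : 4 * L%:R = 2 * L%:R + 2 * L%:R :> R); last by ring.
rewrite expRD mulrCA mulrC [_^-1 * _]mulrC mulrC.
by apply: ler_pM => //; rewrite ?mulr_ge0 ?exprn_ge0 ?invr_ge0 ?mulr_ge0.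
Qed.

(** Gauss's product is started at L = c n, which dominates the norm of n P + Q. Every contribution
    is then exponential in n, except L^(-nP), whose norm e^(- delta n ln L) decays
    superexponentially. *)
Lemma nu_rgauss_decay (n c : nat) : (0 < n)%N -> (0 < c)%N -> v P + v Q <= c%:R ->
  v (rgauss (n%:R *: P + Q)) <=
  expR ((c * n)%:R * (4 + 2 * gauss_const R + v Q) - delta * n%:R * ln n%:R).
Proof.
move=> n0 c0 cPQ; set M := _ + Q; set L := (c * n)%N.
have L0 : (0 < L)%N by rewrite muln_gt0 c0.
have n1 : 1 <= n%:R :> R by rewrite ler1n.
have ML : v M <= L%:R.
  apply: le_trans (nuD _ _ _) _; rewrite nuZ cmod_nat /L natrM mulrC.
  apply: (@le_trans _ _ ((v P + v Q) * n%:R)).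
    by rewrite mulrDl lerD2l ler_peMr ?nu_ge0.
  by rewrite ler_wpM2r.
have lL0 : 0 <= ln L%:R :> R by rewrite ln_ge0 // ler1n.
apply: le_trans (nu_rgauss L0 ML) _.
have E1 : v (mxexp ((- ln L%:R)%:C%C *: M)) <= expR (- (delta * (n%:R * ln L%:R)) + ln L%:R * v Q).
  have -> : (- ln L%:R : R)%:C%C *: M = (- (n%:R * ln L%:R))%:C%C *: P + (- ln L%:R)%:C%C *: Q.
    rewrite scalerDr scalerA -(rmorph_nat (real_complex R)) -rmorphM; congr (_%:C%C *: _ + _).
    by rewrite mulNr mulrC.
  rewrite mxexpD; last by rewrite -!scalerAr -!scalerAl PQ scalerA mulrC -scalerA.
  rewrite expRD; apply: le_trans (nuM _ _ _) _; apply: ler_pM; rewrite ?nu_ge0 //.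
    by apply: nu_mxexp_decay; rewrite mulr_ge0.
  apply: le_trans (nu_mxexp _ _) _; rewrite ler_expR nuZ cmod_real normrN.
  by rewrite ger0_norm.
have E2 : v (gauss_mx L M) <= expR (4 * L%:R) *
    expR (- (delta * (n%:R * ln L%:R)) + ln L%:R * v Q).
  rewrite /gauss_mx nuZ cmodV cmod_nat.
  apply: (@le_trans _ _ (L`!%:R^-1 * ((\prod_(k < L.+1) (L%:R + k%:R)) *
     expR (- (delta * (n%:R * ln L%:R)) + ln L%:R * v Q)))).
    apply: ler_wpM2l; first by rewrite invr_ge0.
    apply: le_trans (nuM _ _ _) _; apply: ler_pM; rewrite ?nu_ge0 //.
    apply: le_trans (nu_prod _ _ _ _) _; apply: ler_prod => k _; rewrite nu_ge0 /=.
    by apply: le_trans (nuD _ _ _) _; apply: lerD => //; rewrite nu_scalar cmod_nat.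
  by rewrite mulrA ler_wpM2r ?expR_ge0 // gauss_prefactor_le.
apply: le_trans (ler_wpM2r (expR_ge0 _) E2) _.
rewrite -!expRD ler_expR.
have lnL : ln L%:R <= L%:R :> R by apply: ltW; apply: ln_sublinear; rewrite ltr0n.
have lnn : ln n%:R <= ln L%:R :> R by rewrite ler_ln ?posrE ?ltr0n // ler_nat leq_pmull.
have h1 : ln L%:R * v Q <= L%:R * v Q by rewrite ler_wpM2r ?nu_ge0.
have h2 : delta * (n%:R * ln n%:R) <= delta * (n%:R * ln L%:R).
  by rewrite ler_pM2l // ler_pM2l // ltr0n.
have -> : delta * n%:R * ln n%:R = delta * (n%:R * ln n%:R) by rewrite mulrA.
have -> : L%:R * (4 + 2 * gauss_const R + v Q) =
  4 * L%:R + 2 * gauss_const R * L%:R + L%:R * v Q by ring.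
lra.
Qed.

Lemma incgamma_ratio (x : R) : 0 < x -> exists n0 : nat, forall n : nat, (n0 <= n)%N ->
  v (1 - incgammamx (n%:R *: P + Q) x * rgauss (n%:R *: P + Q)) <= 1 / 2.
Proof.
move=> x0.
have [c c0 hc] := ex_nat_ge (v P + v Q).
have [n1 n10 hn1] := ex_nat_ge ((v Q + 1) / delta).
(* [A] collects the exponential rates: that of 1/Gamma, that of x^M, and x <= x n for e^x. Once
   delta ln n >= A + 1, the product is at most e^(-n) <= e^(-1) <= 1/2. *)
pose A := c%:R * (4 + 2 * gauss_const R + v Q) + `|ln x| * c%:R + x.
have [n2 n20 hn2] := ex_nat_ge (expR ((A + 1) / delta)).
exists (maxn n1 n2) => n; rewrite geq_max => /andP[nn1 nn2].
have n0 : (0 < n)%N by exact: leq_trans nn1.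
have np : 1 <= n%:R :> R by rewrite ler1n.
have nQ : v Q + 1 <= delta * n%:R.
  rewrite mulrC -ler_pdivrMr //; apply: le_trans hn1 _; by rewrite ler_nat.
have lnA : A + 1 <= delta * ln n%:R.
  rewrite mulrC -ler_pdivrMr // -ler_expR lnK ?posrE ?ltr0n //.
  by apply: le_trans hn2 _; rewrite ler_nat.
set M := _ + Q.
have Mu : forall k, M + k%:R%:M \is a GRing.unit := shifted_units nQ.
apply: le_trans (nu_one_sub_incgamma Mu x0 (fun j => nu_pochmx_inv j nQ)) _.
have e1 : v (mxexp ((ln x)%:C%C *: M)) <= expR (`|ln x| * c%:R * n%:R).
  apply: le_trans (nu_mxexp _ _) _; rewrite ler_expR nuZ cmod_real -mulrA.
  apply: ler_wpM2l => //; apply: le_trans (nuD _ _ _) _; rewrite nuZ cmod_nat.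
  apply: (@le_trans _ _ ((v P + v Q) * n%:R)); last by rewrite ler_wpM2r.
  by rewrite mulrDl mulrC lerD2l ler_peMr ?nu_ge0.
have e2 := nu_rgauss_decay n0 c0 hc; rewrite -/M in e2.
apply: (@le_trans _ _ (expR (`|ln x| * c%:R * n%:R) * expR x *
  expR ((c * n)%:R * (4 + 2 * gauss_const R + v Q) - delta * n%:R * ln n%:R))).
  by apply: ler_pM; rewrite ?mulr_ge0 ?nu_ge0 ?expR_ge0 // ler_wpM2r ?expR_ge0.
rewrite -!expRD; apply: (@le_trans _ _ (expR (- 1))).
  rewrite ler_expR natrM.
  have xn : x <= x * n%:R by rewrite ler_peMr // ltW.
  have h1 : (A + 1) * n%:R <= delta * ln n%:R * n%:R by rewrite ler_wpM2r.
  rewrite /A in h1.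
  have := h1; set a := `|ln x|; set b := gauss_const R; set e := ln n%:R; set m := n%:R.
  by move=> hh; nra.
rewrite expRN div1r lef_pV2 ?posrE ?expR_gt0 //.
by apply: le_trans (expR_ge1Dx _); lra.
Qed.

End GammaRatio.

(** * The radius of convergence *)

Section Radius.
Variable R : realType.
Implicit Types (u D E : nat -> R) (rho eta : R).

Lemma eventually_nonincreasing_bounded u n0 :
  (forall n, (n0 <= n)%N -> u n.+1 <= u n) -> exists K, forall n, u n <= K.
Proof.
move=> h; exists (\sum_(i < n0.+1) `|u i|) => n.
have small m : (m <= n0)%N -> u m <= \sum_(i < n0.+1) `|u i|.
  rewrite -ltnS => hm; apply: le_trans (ler_norm _) _.
  by rewrite (bigD1 (Ordinal hm)) //= lerDl sumr_ge0.
have [|/ltnW n0n] := leqP n n0; first exact: small.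
rewrite -(subnKC n0n); elim: (n - n0)%N => [|k IH].
  by rewrite addn0 small.
by rewrite addnS; apply: le_trans (h _ _) IH; rewrite leq_addr.
Qed.

(* D n and E n stand for the norms of d_n and d_n^-1. *)
Variables (r s a : nat) (D E : nat -> R).
Hypothesis D0 : forall n, 0 <= D n.
Hypothesis E0 : forall n, 0 <= E n.
Hypothesis DE : forall n, 1 <= D n * E n.
Hypothesis DS : forall n, (a < n)%N ->
  D n.+1 <= D n * ((n%:R + a%:R) ^+ r / (n%:R - a%:R) ^+ s).
Hypothesis ES : forall n, (a < n)%N ->
  E n.+1 <= E n * ((n%:R + a%:R) ^+ s / (n%:R - a%:R) ^+ r).

Let bounded_at rho := exists K, forall n, D n * rho ^+ n / n`!%:R <= K.

Lemma bounded_of_ratio rho n0 : 0 <= rho -> (a < n0)%N ->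
  (forall n, (n0 <= n)%N ->
     rho * (n%:R + a%:R) ^+ r <= (n%:R - a%:R) ^+ s * n.+1%:R) ->
  bounded_at rho.
Proof.
move=> rho0 an0 h; apply: (@eventually_nonincreasing_bounded _ n0) => n n0n.
have an : (a < n)%N by exact: leq_trans n0n.
have p : 0 < n%:R - a%:R :> R by rewrite subr_gt0 ltr_nat.
apply: (@le_trans _ _ (D n * ((n%:R + a%:R) ^+ r / (n%:R - a%:R) ^+ s) * rho ^+ n.+1 / n.+1`!%:R)).
  rewrite ler_wpM2r ?invr_ge0 // ler_wpM2r ?exprn_ge0 //; exact: DS.
have -> : D n * ((n%:R + a%:R) ^+ r / (n%:R - a%:R) ^+ s) * rho ^+ n.+1 / n.+1`!%:R =
  D n * rho ^+ n / n`!%:R * (rho * (n%:R + a%:R) ^+ r / ((n%:R - a%:R) ^+ s * n.+1%:R)).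
  rewrite exprS factS natrM; field.
  have f0 : n`!%:R != 0 :> R by rewrite pnatr_eq0 -lt0n fact_gt0.
  by rewrite f0 nat1r pnatr_eq0 /= expf_neq0 // gt_eqF.
rewrite ler_piMr ?divr_ge0 ?mulr_ge0 ?exprn_ge0 //.
by rewrite ler_pdivrMr ?mul1r ?h // mulr_gt0 ?exprn_gt0.
Qed.

(** By [ES], the quantities E (l + m) m! / eta^m eventually do not increase, hence are bounded.
    Their product with the sequence of the statement is D E >= 1, so that sequence cannot tend to
    0. *)
Lemma no_decay_of_ratio eta l n0 : 0 < eta -> (a < l)%N ->
  (forall m, (n0 <= m)%N ->
     m.+1%:R * ((l + m)%:R + a%:R) ^+ s <= eta * ((l + m)%:R - a%:R) ^+ r) ->
  ~ ((fun m => eta ^+ m / m`!%:R * D (l + m)) @ \oo --> (0 : R)).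
Proof.
move=> eta0 al h.
have [K HK] : exists K, forall m, E (l + m) * m`!%:R / eta ^+ m <= K.
  apply: (@eventually_nonincreasing_bounded _ n0) => m n0m.
  have an : (a < l + m)%N by exact: leq_trans (leq_addr _ _).
  have p : 0 < (l + m)%:R - a%:R :> R by rewrite subr_gt0 ltr_nat.
  rewrite addnS; set n := (l + m)%N in p an *.
  apply: (@le_trans _ _ (E n * ((n%:R + a%:R) ^+ s / (n%:R - a%:R) ^+ r) * m.+1`!%:R / eta ^+ m.+1)).
    rewrite ler_wpM2r ?invr_ge0 ?exprn_ge0 ?(ltW eta0) // ler_wpM2r //; exact: ES.
  have -> : E n * ((n%:R + a%:R) ^+ s / (n%:R - a%:R) ^+ r) * m.+1`!%:R / eta ^+ m.+1 =
    E n * m`!%:R / eta ^+ m * (m.+1%:R * (n%:R + a%:R) ^+ s / (eta * (n%:R - a%:R) ^+ r)).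
    rewrite exprS factS natrM; field.
    by rewrite !expf_neq0 ?gt_eqF.
  rewrite ler_piMr ?divr_ge0 ?mulr_ge0 ?exprn_ge0 ?(ltW eta0) //.
  by rewrite ler_pdivrMr ?mul1r ?h // mulr_gt0 ?exprn_gt0.
move=> hc; have : (fun m => eta ^+ m / m`!%:R * D (l + m) * `|K|) @ \oo --> (0 : R).
  by rewrite -(mul0r `|K|); apply: cvgMl.
move=> /cvgrPdist_lt /(_ 1 ltr01) [m _ /(_ m (leqnn m))] /=.
apply/negP; rewrite -leNgt sub0r normrN.
have p : 0 < eta ^+ m / m`!%:R by rewrite divr_gt0 ?exprn_gt0 // ltr0n fact_gt0.
rewrite ger0_norm; last by rewrite mulr_ge0 // mulr_ge0 // ltW.
apply: le_trans (DE (l + m)) _.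
have -> : D (l + m) * E (l + m) =
  eta ^+ m / m`!%:R * D (l + m) * (E (l + m) * m`!%:R / eta ^+ m).
  have f0 : m`!%:R != 0 :> R by rewrite pnatr_eq0 -lt0n fact_gt0.
  have e0 : eta != 0 by rewrite gt_eqF.
  by field; rewrite f0 expf_neq0.
by apply: ler_wpM2l; [rewrite mulr_ge0 // ltW | apply: le_trans (HK m) (ler_norm _)].
Qed.

Lemma shifted_pow_le (n k : nat) : (a < n)%N ->
  (1 - k%:R * (2 * a%:R / (n%:R + a%:R))) * (n%:R + a%:R) ^+ k <= (n%:R - a%:R) ^+ k :> R.
Proof.
move=> an; have an' : a%:R < n%:R :> R by rewrite ltr_nat.
have a0 : 0 <= a%:R :> R by [].
have p : 0 < n%:R + a%:R :> R by lra.
have -> : n%:R - a%:R = (1 - 2 * a%:R / (n%:R + a%:R)) * (n%:R + a%:R) :> R.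
  by field; rewrite gt_eqF.
rewrite exprMn ler_wpM2r ?exprn_ge0 ?(ltW p) //; apply: bernoulli_ineq.
by rewrite divr_ge0 ?mulr_ge0 ?(ltW p) //= ler_pdivrMr // mul1r; lra.
Qed.

(** For r <= s every radius is admissible, in particular eta + 1; for r = s + 1 and eta < 1, every
    radius below 1, in particular the midpoint of eta and 1. Elsewhere [no_decay_of_ratio], at one
    well chosen l, contradicts the assumption. *)
Lemma radius_beyond eta : 0 < eta ->
  (forall l, (fun m => eta ^+ m / m`!%:R * D (l + m)) @ \oo --> (0 : R)) ->
  exists2 rho, eta < rho & bounded_at rho.
Proof.
move=> eta0 hc.
have aS (n n0 : nat) : (3 * a + n0.+1 <= n)%N ->
    [/\ (a < n)%N, 1 <= n%:R - a%:R :> R & n%:R + a%:R <= 2 * (n%:R - a%:R) :> R].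
  move=> h; have an : (a < n)%N by lia.
  have h1 : (3 * a + n0.+1)%:R <= n%:R :> R by rewrite ler_nat.
  rewrite natrD natrM -natr1 in h1.
  have : 0 <= n0%:R :> R by [].
  have : 0 <= a%:R :> R by [].
  by split=> //; lra.
have [rs|] := leqP r s.
  exists (eta + 1); first by rewrite ltrDl.
  have [n0 _ hn0] := ex_nat_ge ((eta + 1) * 2 ^+ r).
  apply: (@bounded_of_ratio _ (3 * a + n0.+1)); [lra|lia|move=> n hn].
  have [an p1 p2] := aS _ _ hn.
  have p0 : 0 <= n%:R - a%:R :> R by lra.
  apply: (@le_trans _ _ ((eta + 1) * (2 ^+ r * (n%:R - a%:R) ^+ r))).
    apply: ler_wpM2l; first lra.
    by rewrite -exprMn; apply: lerXn2r; rewrite // nnegrE ?addr_ge0 ?mulr_ge0.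
  rewrite mulrA mulrC; apply: ler_pM; rewrite ?exprn_ge0 ?mulr_ge0 //; first lra.
    by apply: ler_weXn2l.
  by apply: le_trans hn0 _; rewrite ler_nat; lia.
rewrite leq_eqVlt => /orP[/eqP rs|rs].
  have [eta1|eta1] := ltP eta 1.
    pose rho := (1 + eta) / 2; exists rho; first by rewrite /rho; lra.
    have r1 : 0 < 1 - rho by rewrite /rho; lra.
    have [n0 _ hn0] := ex_nat_ge (r%:R * (2 * a%:R) / (1 - rho)).
    apply: (@bounded_of_ratio _ (3 * a + n0.+1)); [rewrite /rho; lra|lia|move=> n hn].
    have [an p1 p2] := aS _ _ hn.
    have pp : 0 < n%:R + a%:R :> R by rewrite ltr_wpDr // ltr0n; lia.
    apply: le_trans (le_trans (shifted_pow_le r an) _).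
      rewrite ler_wpM2r ?exprn_ge0 ?(ltW pp) // lerBrDr addrC -lerBrDr.
      rewrite mulrA ler_pdivrMr // [leRHS]mulrC -ler_pdivrMr //; apply: le_trans hn0 _.
      by rewrite -natrD ler_nat; lia.
    rewrite -rs exprSr ler_wpM2l ?exprn_ge0 //; first lra.
    by rewrite -natr1; have : 0 <= a%:R :> R by []; lra.
  (* The shift by l absorbs the parameters: n - a loses a, and comparing (n + a)^s with (n - a)^s
     loses 2 a s by Bernoulli's inequality. With n = l + m, what is left is exactly m + 1. *)
  exfalso; pose l := (1 + a + 2 * a * s)%N.
  apply: (@no_decay_of_ratio eta l 0 eta0 _ _ (hc l)); first by rewrite /l; lia.
  move=> m _; have an : (a < l + m)%N by rewrite /l; lia.
  have p0 : 0 <= (l + m)%:R - a%:R :> R by rewrite subr_ge0 ler_nat ltnW.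
  apply: (@le_trans _ _ (((l + m)%:R - a%:R) ^+ r)); last by rewrite ler_peMl ?exprn_ge0.
  rewrite -rs exprS.
  have pp : 0 < (l + m)%:R + a%:R :> R by rewrite ltr_wpDr // ltr0n; lia.
  apply: le_trans (ler_wpM2l p0 (shifted_pow_le s an)); rewrite [leRHS]mulrA.
  rewrite ler_wpM2r ?exprn_ge0 ?(ltW pp) //.
  have e1 : m.+1%:R = (l + m)%:R - a%:R - s%:R * (2 * a%:R) :> R.
    by rewrite /l !natrD !natrM -natr1; ring.
  rewrite e1 mulrBr mulr1 lerD2l lerN2 mulrCA; apply: ler_wpM2l => //.
  rewrite mulrA ler_pdivrMr // mulrC ler_wpM2l ?mulr_ge0 //.
  by have : 0 <= a%:R :> R by []; lra.
(* Chosen so that l + m - a is m + 1. A spare power of m + 1 then outgrows 2^s / eta. *)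
exfalso; pose l := a.+1.
have [n0 _ hn0] := ex_nat_ge (2 ^+ s / eta).
apply: (@no_decay_of_ratio eta l (2 * a + n0) eta0 _ _ (hc l)) => // m hm.
have [an p1 p2] : [/\ (a < l + m)%N, 1 <= (l + m)%:R - a%:R :> R &
  (l + m)%:R + a%:R <= 2 * ((l + m)%:R - a%:R) :> R] by apply: (aS _ n0); rewrite /l; lia.
have e1 : (l + m)%:R - a%:R = m.+1%:R :> R by rewrite /l -natrB; [congr _%:R; lia|lia].
rewrite e1 in p1 p2 *; rewrite -(subnK rs) exprD.
apply: (@le_trans _ _ (m.+1%:R * (2 ^+ s * m.+1%:R ^+ s))).
  apply: ler_wpM2l => //; rewrite -exprMn; apply: lerXn2r; rewrite // nnegrE ?addr_ge0 ?mulr_ge0 //.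
have e2 : 1 <= m.+1%:R ^+ (r - s.+2) :> R by exact: exprn_ege1.
have e3 : 2 ^+ s <= eta * m.+1%:R :> R.
  rewrite -ler_pdivrMl // mulrC; apply: le_trans hn0 _; rewrite ler_nat; lia.
apply: (@le_trans _ _ (eta * m.+1%:R ^+ s.+2)); last first.
  by apply: ler_wpM2l; [exact: ltW|rewrite ler_peMl ?exprn_ge0].
have -> : eta * m.+1%:R ^+ s.+2 = m.+1%:R * (eta * m.+1%:R * m.+1%:R ^+ s) by rewrite !exprS; ring.
by apply: ler_wpM2l => //; rewrite ler_wpM2r ?exprn_ge0.
Qed.

End Radius.

(** * Products over commuting families *)

Section CommutingProducts.
Variable T : unitRingType.
Implicit Types (X Y M : T) (S : seq T) (F G : T -> T).

(** [F M] lies in the double commutant of M, as a function of M should. Commutation of the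
    parameters thus extends to their Pochhammer symbols and Gamma functions, and products can be
    reordered. *)
Definition natural_map F := forall X M, GRing.comm X M -> GRing.comm X (F M).

Definition commuting S := {in S &, forall M M', GRing.comm M M'}.

Lemma comm_prod_natural F S X : natural_map F ->
  {in S, forall M, GRing.comm X M} -> GRing.comm X (\prod_(M <- S) F M).
Proof. by move=> nF h; rewrite big_seq; apply: commr_prod => M MS; apply/nF/h. Qed.

Lemma commuting_cons M S : commuting (M :: S) ->
  {in S, forall M', GRing.comm M M'} /\ commuting S.
Proof.
move=> h; split=> [M' M'S|M' M'' M'S M''S]; apply: h; rewrite ?mem_head //.
all: by rewrite in_cons ?M'S ?M''S orbT.
Qed.

Lemma commuting_catl S S' : commuting (S ++ S') -> commuting S.
Proof. by move=> h M M' hM hM'; apply: h; rewrite mem_cat ?hM ?hM'. Qed.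

Lemma commuting_catr S S' : commuting (S ++ S') -> commuting S'.
Proof. by move=> h M M' hM hM'; apply: h; rewrite mem_cat ?hM ?hM' orbT. Qed.

Lemma prod_natural_comm F G S S' : natural_map F -> natural_map G ->
  commuting (S ++ S') ->
  GRing.comm (\prod_(M <- S) F M) (\prod_(M <- S') G M).
Proof.
move=> nF nG h; apply: comm_prod_natural => // M' M'S; apply/commr_sym/comm_prod_natural => // M MS.
by apply: h; rewrite mem_cat ?MS ?M'S ?orbT.
Qed.

Lemma prod_naturalM F G S : natural_map F -> natural_map G -> commuting S ->
  \prod_(M <- S) (F M * G M) = (\prod_(M <- S) F M) * (\prod_(M <- S) G M).
Proof.
move=> nF nG; elim: S => [|M S IH] h; first by rewrite !big_nil mulr1.
have [hM hS] := commuting_cons h.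
rewrite !big_cons IH // !mulrA; congr (_ * _); rewrite -!mulrA; congr (_ * _).
apply: comm_prod_natural => // M' M'S; apply/commr_sym/nG/commr_sym/hM/M'S.
Qed.

Lemma prod_natural_unitV F S : natural_map F -> commuting S ->
  {in S, forall M, F M \is a GRing.unit} ->
  \prod_(M <- S) F M \is a GRing.unit /\
  \prod_(M <- S) (F M)^-1 = (\prod_(M <- S) F M)^-1.
Proof.
move=> nF hS uF.
have nFV : natural_map (fun M => (F M)^-1) by move=> X M /nF; exact: commrV.
have pU : \prod_(M <- S) F M \is a GRing.unit.
  elim: S hS uF => [|M S IH] hS uF; first by rewrite big_nil unitr1.
  rewrite big_cons unitrMr ?uF ?mem_head //.
  have [_ hS'] := commuting_cons hS; apply: IH => // M' M'S.
  by rewrite uF // in_cons M'S orbT.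
split=> //; apply: (mulrI pU); rewrite divrr // -prod_naturalM //.
by rewrite big_seq big1 // => M MS; rewrite divrr // uF.
Qed.

Lemma comm_ratioM (a a' b b' : T) : GRing.comm b a' -> GRing.comm b b' ->
  b \is a GRing.unit -> b' \is a GRing.unit ->
  (a * a') * (b * b')^-1 = a / b * (a' / b').
Proof.
move=> c1 c2 u u'; rewrite c2 invrM // !mulrA; congr (_ * _).
rewrite -!mulrA; congr (_ * _).
by apply/commrV/commr_sym.
Qed.

Lemma comm_ratio_cancel (a a' b b' : T) : GRing.comm a b -> GRing.comm a b' ->
  GRing.comm b b' -> a' \is a GRing.unit -> b \is a GRing.unit -> b' \is a GRing.unit ->
  ((b * b')^-1 * (a * a')) * (a'^-1 * b') = a / b.
Proof.
move=> c1 c2 c3 ua ub ub'.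
rewrite mulrA -[X in X * b']mulrA mulrK // -mulrA c2 c3 invrM //.
by rewrite mulrA mulrVK //; apply/commr_sym/commrV.
Qed.

End CommutingProducts.

Section PochhammerProducts.
Variables (R : realType) (N : nat).
Local Notation MC := 'M[R[i]]_N.+1.
Implicit Types (M X : MC) (A B S : seq MC).

Lemma comm_scalar_mx X (c : R[i]) : GRing.comm X (c%:M : MC).
Proof. by rewrite /GRing.comm -!mulmxE scalar_mxC. Qed.

Lemma natural_shift (k : nat) : natural_map (fun M : MC => M + k%:R%:M).
Proof. by move=> X M XM; apply: commrD XM _; exact: comm_scalar_mx. Qed.

Lemma natural_pochmx (n : nat) : natural_map (fun M : MC => pochmx M n).
Proof. by move=> X M XM; exact: pochmx_comm. Qed.

Lemma natural_rgauss : natural_map (fun M : MC => rgauss M).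
Proof. by move=> X M XM; exact: rgauss_comm. Qed.

Lemma natural_comp (F G : MC -> MC) : natural_map F -> natural_map G ->
  natural_map (fun M => F (G M)).
Proof. by move=> nF nG X M XM; apply/nF/nG. Qed.

Definition pochmx_ratio A B (n : nat) : MC :=
  (\prod_(M <- A) pochmx M n) * (\prod_(M <- B) pochmx M n)^-1.

Definition shifted_regular S :=
  {in S, forall M, forall k : nat, M + k%:R%:M \is a GRing.unit}.

Variables A B : seq MC.
Hypothesis ABcomm : commuting (A ++ B).
Hypothesis Areg : shifted_regular A.
Hypothesis Breg : shifted_regular B.

Let Acomm : commuting A.
Proof. exact: commuting_catl ABcomm. Qed.

Let Bcomm : commuting B.
Proof. exact: commuting_catr ABcomm. Qed.

Let BAcomm : commuting (B ++ A).
Proof.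
by move=> M M' hM hM'; apply: ABcomm; rewrite mem_cat orbC -mem_cat.
Qed.

Lemma pochmx_prodD S l m : commuting S -> \prod_(M <- S) pochmx M (l + m) =
  (\prod_(M <- S) pochmx M l) * (\prod_(M <- S) pochmx (M + l%:R%:M) m).
Proof.
move=> hS; rewrite -prod_naturalM //; last 2 first.
- exact: natural_pochmx.
- exact: natural_comp (natural_pochmx m) (natural_shift l).
by apply: eq_bigr => M _; rewrite pochmxD.
Qed.

Lemma pochmx_prod_unit S l n : commuting S -> shifted_regular S ->
  \prod_(M <- S) pochmx (M + l%:R%:M) n \is a GRing.unit.
Proof.
move=> hS uS.
have nF : natural_map (fun M : MC => pochmx (M + l%:R%:M) n).
  exact: natural_comp (natural_pochmx n) (natural_shift l).
have [] // := prod_natural_unitV nF hS _.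
move=> M MS; apply: pochmx_unit => k; rewrite -addrA -raddfD -natrD; exact: uS.
Qed.

Lemma pochmx_prod_unit0 S n : commuting S -> shifted_regular S ->
  \prod_(M <- S) pochmx M n \is a GRing.unit.
Proof.
move=> hS uS; have := pochmx_prod_unit 0 n hS uS.
rewrite (eq_bigr (fun M => pochmx M n)) // => M _; by rewrite raddf0 addr0.
Qed.

Lemma pochmx_ratioD l m : pochmx_ratio A B (l + m) = pochmx_ratio A B l *
  ((\prod_(M <- A) pochmx (M + l%:R%:M) m) * (\prod_(M <- B) pochmx (M + l%:R%:M) m)^-1).
Proof.
rewrite /pochmx_ratio !pochmx_prodD //.
have nm : natural_map (fun M : MC => pochmx (M + l%:R%:M) m).
  exact: natural_comp (natural_pochmx m) (natural_shift l).
have c1 := prod_natural_comm (natural_pochmx l) nm BAcomm.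
have c2 : GRing.comm (\prod_(M <- B) pochmx M l) (\prod_(M <- B) pochmx (M + l%:R%:M) m).
  apply: (prod_natural_comm (natural_pochmx l) nm) => M M'; rewrite !mem_cat !orbb; exact: Bcomm.
have u1 := pochmx_prod_unit0 l Bcomm Breg.
have u2 := pochmx_prod_unit l m Bcomm Breg.
exact: (comm_ratioM _ c1 c2 u1 u2).
Qed.

(** Gamma^-1(M) = (M)_l Gamma^-1(M + l) for each parameter; the shifted Gamma factors cancel, and
    the Pochhammer symbols remain. *)
Lemma gamma_prefactor l :
  ((\prod_(M <- B) rgauss M)^-1 * (\prod_(M <- A) rgauss M)) *
  ((\prod_(M <- A) rgauss (M + l%:R%:M))^-1 * (\prod_(M <- B) rgauss (M + l%:R%:M))) =
  pochmx_ratio A B l.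
Proof.
have nl : natural_map (fun M : MC => rgauss (M + l%:R%:M)).
  exact: natural_comp natural_rgauss (natural_shift l).
have split S : commuting S -> \prod_(M <- S) rgauss M =
    (\prod_(M <- S) pochmx M l) * \prod_(M <- S) rgauss (M + l%:R%:M).
  move=> hS; rewrite -prod_naturalM //; last exact: natural_pochmx.
  by apply: eq_bigr => M _; rewrite -rgauss_pochmx.
have unit S : commuting S -> shifted_regular S ->
    \prod_(M <- S) rgauss (M + l%:R%:M) \is a GRing.unit.
  move=> hS uS; have [] // := prod_natural_unitV nl hS _.
  move=> M MS; apply: rgauss_unit => k; rewrite -addrA -raddfD -natrD; exact: uS.
have uA := unit A Acomm Areg; have uB := unit B Bcomm Breg.
have c1 := prod_natural_comm (natural_pochmx l) (natural_pochmx l) ABcomm.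
have c2 := prod_natural_comm (natural_pochmx l) nl ABcomm.
have c3 : GRing.comm (\prod_(M <- B) pochmx M l) (\prod_(M <- B) rgauss (M + l%:R%:M)).
  apply: (prod_natural_comm (natural_pochmx l) nl).
  by move=> M M'; rewrite !mem_cat !orbb; exact: Bcomm.
have u1 := pochmx_prod_unit0 l Bcomm Breg.
apply: etrans (comm_ratio_cancel c1 c2 c3 uA u1 uB).
pose Z := (\prod_(M <- A) rgauss (M + l%:R%:M))^-1 * (\prod_(M <- B) rgauss (M + l%:R%:M)).
exact: (congr2 (fun X Y : MC => X^-1 * Y * Z) (split B Bcomm) (split A Acomm)).
Qed.

End PochhammerProducts.

Section PochhammerGrowth.
Variables (R : realType) (N : nat) (v : algnorm R N).
Local Notation MC := 'M[R[i]]_N.+1.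
Implicit Types (M : MC) (S A B : seq MC) (a k : nat).

Lemma nu_shift_inv M a k : v M <= a%:R -> (a < k)%N ->
  v (M + k%:R%:M)^-1 <= (k%:R - a%:R)^-1.
Proof.
move=> Ma ak; have k0 : 0 < k%:R :> R by rewrite ltr0n (leq_trans _ ak).
have ak' : a%:R < k%:R :> R by rewrite ltr_nat.
pose Z : MC := 1 + k%:R^-1 *: M.
have cU : (k%:R : R[i]) \is a GRing.unit by rewrite unitfE pnatr_eq0 -lt0n -(ltr0n R).
have ME : M + k%:R%:M = k%:R *: Z.
  by rewrite /Z scalerDr scalerA divrr // scale1r scalemx1 addrC.
have h1 : v (1 - Z) <= a%:R / k%:R.
  by rewrite /Z opprD addNKr nuN nuZ cmodV cmod_nat mulrC ler_pM2r ?invr_gt0.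
have h2 : a%:R / k%:R < 1 :> R by rewrite ltr_pdivrMr // mul1r.
have [Zu Zn] := nu_unit (le_lt_trans h1 h2).
rewrite ME invrZ // nuZ cmodV cmod_nat.
apply: le_trans (ler_wpM2l _ Zn) _; first by rewrite invr_ge0.
rewrite -invfM lef_pV2 ?posrE ?mulr_gt0 ?subr_gt0 //; last exact: le_lt_trans h1 h2.
by rewrite mulrBr mulr1 lerD2l lerN2 mulrC -ler_pdivlMr.
Qed.

Lemma prod_le_expr (T : Type) (s : seq T) (P : pred T) (F : T -> R) (c : R) :
  0 <= c -> (forall i, P i -> 0 <= F i <= c) -> all P s ->
  \prod_(i <- s) F i <= c ^+ size s.
Proof.
move=> c0 h; elim: s => [_|i s IH /= /andP[Pi PS]]; first by rewrite big_nil.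
have /andP[f0 fc] := h i Pi.
rewrite big_cons exprS; apply: ler_pM => //; last exact: IH.
elim: s PS {IH} => [_|j s IH /= /andP[Pj PS]]; first by rewrite big_nil.
by rewrite big_cons mulr_ge0 ?IH //; have /andP[] := h j Pj.
Qed.

Lemma nu_shift_prod S a k : {in S, forall M, v M <= a%:R} ->
  v (\prod_(M <- S) (M + k%:R%:M)) <= (k%:R + a%:R) ^+ size S.
Proof.
move=> h; apply: le_trans (nu_prod _ _ _ _) _.
apply: (prod_le_expr (P := fun M => v M <= a%:R)).
- by rewrite addr_ge0.
- move=> M Ma; rewrite nu_ge0 /=; apply: le_trans (nuD _ _ _) _.
  by rewrite nu_scalar cmod_nat addrC lerD2l.
- by apply/allP.
Qed.

Lemma nu_shift_prod_inv S a k : commuting S -> shifted_regular S ->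
  {in S, forall M, v M <= a%:R} -> (a < k)%N ->
  v (\prod_(M <- S) (M + k%:R%:M))^-1 <= ((k%:R - a%:R) ^+ size S)^-1.
Proof.
move=> hS uS h ak; have ak' : a%:R < k%:R :> R by rewrite ltr_nat.
have [|_ <-] := prod_natural_unitV (natural_shift k) hS.
  by move=> M MS; exact: uS.
apply: le_trans (nu_prod _ _ _ _) _; rewrite -exprVn.
apply: (prod_le_expr (P := fun M => v M <= a%:R)).
- by rewrite invr_ge0 subr_ge0 ltW.
- by move=> M Ma; rewrite nu_ge0 nu_shift_inv.
- by apply/allP.
Qed.

(** One integer a bounds the norms of all parameters. The factors M + n then have norm at most n + a
    and inverses of norm at most 1 / (n - a). The estimate for the inverse ratio stands in for a
    lower bound on the ratio. *)
Lemma pochmx_ratio_growth A B : commuting (A ++ B) -> shifted_regular A -> shifted_regular B ->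
  exists a : nat, forall n, (a < n)%N ->
  v (pochmx_ratio A B n.+1) <= v (pochmx_ratio A B n) *
    ((n%:R + a%:R) ^+ size A / (n%:R - a%:R) ^+ size B) /\
  v (pochmx_ratio A B n.+1)^-1 <= v (pochmx_ratio A B n)^-1 *
    ((n%:R + a%:R) ^+ size B / (n%:R - a%:R) ^+ size A).
Proof.
move=> hAB uA uB; have [a a0 ha] := ex_nat_ge (\sum_(M <- A ++ B) v M).
have le_a : {in A ++ B, forall M, v M <= a%:R}.
  move=> M MS; apply: le_trans ha; rewrite (big_rem M) //= lerDl.
  by apply: sumr_ge0 => M' _; exact: nu_ge0.
have Acomm := commuting_catl hAB.
have Bcomm := commuting_catr hAB.
have leA : {in A, forall M, v M <= a%:R} by move=> M MA; apply: le_a; rewrite mem_cat MA.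
have leB : {in B, forall M, v M <= a%:R} by move=> M MA; apply: le_a; rewrite mem_cat MA orbT.
exists a => n an.
have SA := prod_natural_unitV (natural_shift n) Acomm (fun M MA => uA M MA n).
have SB := prod_natural_unitV (natural_shift n) Bcomm (fun M MA => uB M MA n).
have nA := nu_shift_prod n leA; have nB := nu_shift_prod n leB.
have nA' := nu_shift_prod_inv Acomm uA leA an.
have nB' := nu_shift_prod_inv Bcomm uB leB an.
have dS : pochmx_ratio A B n.+1 = pochmx_ratio A B n *
    ((\prod_(M <- A) (M + n%:R%:M)) / (\prod_(M <- B) (M + n%:R%:M))).
  rewrite -(addn1 n) (pochmx_ratioD hAB uB).
  have p1 S : \prod_(M <- S) pochmx (M + n%:R%:M) 1 = \prod_(M <- S) (M + n%:R%:M).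
    by apply: eq_bigr => M _; rewrite pochmxS pochmx0 mul1r raddf0 addr0.
  by rewrite !p1.
have dU : pochmx_ratio A B n \is a GRing.unit.
  by rewrite /pochmx_ratio unitrMl ?unitrV; apply: pochmx_prod_unit0.
move: SA SB nA nB nA' nB' dS dU => [+ _] [+ _].
move: (\prod_(M <- A) _) (\prod_(M <- B) _) (pochmx_ratio A B n.+1) (pochmx_ratio A B n).
move=> PA PB d' d UA UB nA nB nA' nB' -> dU; split.
  apply: le_trans (nuM _ _ _) _; apply: ler_wpM2l; first exact: nu_ge0.
  apply: le_trans (nuM _ _ _) _; apply: ler_pM; rewrite ?nu_ge0 //.
have UAB : PA / PB \is a GRing.unit by rewrite unitrMl ?unitrV.
rewrite invrM // invrM ?unitrV // invrK; apply: le_trans (nuM _ _ _) _.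
rewrite mulrC; apply: ler_wpM2l; first exact: nu_ge0.
by apply: le_trans (nuM _ _ _) _; apply: ler_pM; rewrite ?nu_ge0.
Qed.

End PochhammerGrowth.

(** * The coefficients of the series and the final identity *)

Section IncompleteExponential.
Variables (R : realType) (N : nat).
Local Notation MC := 'M[R[i]]_N.+1.
Implicit Types (x : R) (y z w : R[i]) (P Q : MC) (A B : seq MC) (v : algnorm R N).

Definition gamma_ratio x P Q (n : nat) : MC :=
  incgammamx (n%:R *: P + Q) x * rgauss (n%:R *: P + Q).

Definition incexp_coef x P Q A B (n : nat) : MC :=
  n`!%:R^-1 *: (pochmx_ratio A B n * gamma_ratio x P Q n).

Lemma incexp_termE x P Q A B w :
  incexp_term x P Q A B w = pseries_term (incexp_coef x P Q A B) w.
Proof.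
apply/funext => n.
rewrite /incexp_term rgammamxE /pseries_term /incexp_coef scalerA.
by congr (_ *: _); rewrite -mulrA.
Qed.

(** Three additive splittings of l + m: of the binomial coefficient against the factorials, of the
    Pochhammer symbols, and of (l + m) P + Q as m P + (l P + Q). *)
Lemma taylor_termE x P Q A B w l m : commuting (A ++ B) -> shifted_regular B ->
  taylor_term (incexp_coef x P Q A B) w l m = l`!%:R^-1 *: (pochmx_ratio A B l *
    incexp_term x P (l%:R *: P + Q) (shiftmx l A) (shiftmx l B) w m).
Proof.
move=> hAB uB; rewrite /taylor_term /incexp_coef (pochmx_ratioD hAB uB) /incexp_term.
rewrite rgammamxE /shiftmx !big_map -scalerAr !scalerA.
have -> : m%:R *: P + (l%:R *: P + Q) = (l + m)%:R *: P + Q.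
  by rewrite natrD scalerDl addrCA addrA.
have nz (k : nat) : k`!%:R != 0 :> R[i] by rewrite pnatr_eq0 -lt0n fact_gt0.
have -> : 'C(l + m, l)%:R * w ^+ m / (l + m)`!%:R = l`!%:R^-1 * (w ^+ m / m`!%:R) :> R[i].
  rewrite -(bin_fact (leq_addr m l)) addKn !natrM.
  have bz : 'C(l + m, l)%:R != 0 :> R[i] by rewrite pnatr_eq0 -lt0n bin_gt0 leq_addr.
  by field; rewrite !nz bz.
by congr (_ *: _); rewrite /gamma_ratio -!mulrA.
Qed.

(** For large n, |I - G_n| <= 1/2 gives |d_n| <= 2 |d_n G_n| and |d_n G_n| <= 2 |d_n|. The first
    carries the decay of the Taylor terms over to d_n, as [radius_beyond] requires; the second
    brings the resulting bound back to the coefficients. *)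
Lemma incexp_coef_radius v x P Q A B y (h q : R) :
  P * Q = Q * P -> 0 < h -> 0 <= q < 1 -> v (1 - h%:C%C *: P) <= q -> 0 < x ->
  commuting (A ++ B) -> shifted_regular A -> shifted_regular B -> y != 0 ->
  (forall l, exists L : MC, series (taylor_term (incexp_coef x P Q A B) y l) @ \oo --> L) ->
  exists2 rho : R, cmod y < rho & coef_bounded v (incexp_coef x P Q A B) rho.
Proof.
move=> PQ h0 q01 vP x0 hAB uA uB y0 hy.
have [n0 hn0] := incgamma_ratio PQ h0 q01 vP x0.
have [a ha] := pochmx_ratio_growth v hAB uA uB.
pose d := pochmx_ratio A B; pose G := gamma_ratio x P Q.
have G_near n : (n0 <= n)%N -> v (1 - G n) <= 1 / 2 by exact: hn0.
have Acomm := commuting_catl hAB.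
have Bcomm := commuting_catr hAB.
have dU n : d n \is a GRing.unit.
  by rewrite /d /pochmx_ratio unitrMl ?unitrV; apply: pochmx_prod_unit0.
have dle n : (n0 <= n)%N -> v (d n) <= 2 * v (d n * G n).
  move=> /G_near hG; have -> : v (d n) = v (d n * G n + d n * (1 - G n)).
    by rewrite -mulrDr addrC subrK mulr1.
  have := nuD v (d n * G n) (d n * (1 - G n)).
  have := nuM v (d n) (1 - G n).
  have : v (d n) * v (1 - G n) <= v (d n) * (1 / 2) by rewrite ler_wpM2l ?nu_ge0.
  have -> : d n * G n + d n * (1 - G n) = d n by rewrite -mulrDr addrC subrK mulr1.
  by lra.
have leD n : (n0 <= n)%N -> v (d n * G n) <= 2 * v (d n).
  move=> /G_near hG; apply: le_trans (nuM _ _ _) _; rewrite mulrC ler_wpM2r ?nu_ge0 //.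
  have := nu_dist v (G n) 1; rewrite nu1 nu_subC; lra.
have y0' : 0 < cmod y.
  by rewrite lt_neqAle cmod_ge0 andbT eq_sym; apply: contraNneq y0 => /cmod_eq0 ->.
have [rho yr [K HK]] : exists2 rho, cmod y < rho &
    exists K, forall n, v (d n) * rho ^+ n / n`!%:R <= K.
  apply: (@radius_beyond _ (size A) (size B) a (fun n => v (d n)) (fun n => v (d n)^-1)) => //.
  - by move=> n; exact: nu_ge0.
  - by move=> n; exact: nu_ge0.
  - by move=> n; rewrite -(nu1 v) -(divrr (dU n)); exact: nuM.
  - by move=> n an; case: (ha n an).
  - by move=> n an; case: (ha n an).
  move=> l; have [L hL] := hy l.
  have lim0 : (fun m => 2 * l`!%:R * v (taylor_term (incexp_coef x P Q A B) y l m)) @ \oo -->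
      (0 : R).
    have := @cvg_nu _ _ v _ _ (series_mx_cvg0 hL); rewrite nu0 => h1.
    by rewrite -(mulr0 (2 * l`!%:R)); apply: cvgMr.
  apply: (@squeeze_cvgr _ _ _ _ (fun=> 0) _ _ _ _ (cvg_cst _) lim0).
  near=> m; apply/andP; split.
    by rewrite mulr_ge0 ?nu_ge0 // divr_ge0 ?exprn_ge0 // cmod_ge0.
  have n0m : (n0 <= l + m)%N by apply: (leq_trans _ (leq_addl _ _)); near: m; exists n0.
  rewrite /taylor_term /incexp_coef nuZ nuZ !cmodM cmodX cmodV !cmod_nat.
  have fz (k : nat) : k`!%:R != 0 :> R by rewrite pnatr_eq0 -lt0n fact_gt0.
  have -> : 2 * l`!%:R * ('C(l + m, l)%:R * cmod y ^+ m * ((l + m)`!%:R^-1 *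
      v (d (l + m)%N * G (l + m)%N))) = cmod y ^+ m / m`!%:R * (2 * v (d (l + m)%N * G (l + m)%N)).
    rewrite -(bin_fact (leq_addr m l)) addKn !natrM.
    have bz : 'C(l + m, l)%:R != 0 :> R by rewrite pnatr_eq0 -lt0n bin_gt0 leq_addr.
    by field; rewrite !fz bz.
  by apply: ler_wpM2l; [rewrite divr_ge0 ?exprn_ge0 ?cmod_ge0 | exact: dle].
have rho0 : 0 < rho by exact: lt_trans yr.
(* The finite sum covers the indices below [n0], where the ratio of Gamma functions is not under
   control. *)
exists rho => //; exists (2 * K + \sum_(i < n0) v (incexp_coef x P Q A B i) * rho ^+ i) => n.
have K0 : 0 <= K.
  apply: le_trans (HK 0%N); by rewrite divr_ge0 // mulr_ge0 ?nu_ge0 ?exprn_ge0 // ltW.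
have pos i : 0 <= v (incexp_coef x P Q A B i) * rho ^+ i.
  by rewrite mulr_ge0 ?nu_ge0 ?exprn_ge0 // ltW.
have [n0n|nn0] := leqP n0 n.
  apply: ler_wpDr; first by apply: sumr_ge0.
  apply: le_trans (ler_wpM2l _ (HK n)) => //.
  rewrite /incexp_coef nuZ cmodV cmod_nat.
  apply: (@le_trans _ _ (n`!%:R^-1 * (2 * v (d n)) * rho ^+ n)).
    rewrite ler_wpM2r ?exprn_ge0 ?(ltW rho0) // ler_wpM2l ?invr_ge0 //; exact: leD.
  by rewrite le_eqVlt; apply/orP; left; apply/eqP; ring.
rewrite (bigD1 (Ordinal nn0)) //= addrCA lerDl addr_ge0 ?mulr_ge0 //.
by apply: sumr_ge0.
Unshelve. all: by end_near.
Qed.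

Lemma series_mulmx (X : MC) (u : nat -> MC) n :
  series (fun k => X * u k) n = X * series u n.
Proof. by rewrite /series /= mulr_sumr. Qed.

Lemma gammamx_prod (S : seq MC) (l : nat) : commuting S -> shifted_regular S ->
  \prod_(M <- S) gammamx (M + l%:R%:M) = (\prod_(M <- S) rgauss (M + l%:R%:M))^-1.
Proof.
move=> hS uS.
have nl : natural_map (fun M : MC => rgauss (M + l%:R%:M)).
  exact: natural_comp (@natural_rgauss R N) (natural_shift l).
have [|_ <-] := prod_natural_unitV nl hS.
  move=> M MS; apply: rgauss_unit => k; rewrite -addrA -raddfD -natrD; exact: uS.
by apply: eq_bigr => M _; rewrite /gammamx rgammamxE.
Qed.

Lemma gammamx_prefactor A B l :
  commuting (A ++ B) -> shifted_regular A -> shifted_regular B ->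
  ((\prod_(M <- B) gammamx M) * (\prod_(M <- A) rgammamx M)) *
  ((\prod_(M <- A) gammamx (M + l%:R%:M)) * (\prod_(M <- B) rgammamx (M + l%:R%:M))) =
  pochmx_ratio A B l.
Proof.
move=> hAB uA uB.
have Acomm := commuting_catl hAB.
have Bcomm := commuting_catr hAB.
have shift0 (S : seq MC) (f : MC -> MC) :
    \prod_(M <- S) f (M + 0%:R%:M) = \prod_(M <- S) f M.
  by apply: eq_bigr => M _; rewrite raddf0 addr0.
have rE (S : seq MC) (g : MC -> MC) :
    \prod_(M <- S) rgammamx (g M) = \prod_(M <- S) rgauss (g M).
  by apply: eq_bigr => M _; rewrite rgammamxE.
have e1 := etrans (esym (shift0 B (@gammamx R N)))
  (etrans (gammamx_prod 0 Bcomm uB) (congr1 GRing.inv (shift0 B (@rgauss R N)))).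
have e2 := rE A id; have e3 := gammamx_prod l Acomm uA.
have e4 := rE B (fun M => M + l%:R%:M).
exact: etrans (congr2 *%R (congr2 *%R e1 e2) (congr2 *%R e3 e4)) (gamma_prefactor hAB uA uB l).
Qed.

End IncompleteExponential.

Unset Implicit Arguments.

Theorem theorem3p9 (R : realType) (N r s : nat)
  (P Q : 'M[R[i]]_N.+1)
  (A : r.-tuple 'M[R[i]]_N.+1) (B : s.-tuple 'M[R[i]]_N.+1)
  (x : R) (y z : R[i])
  (hcomm : {in P :: Q :: A ++ B &, forall M M', comm_mx M M'})
  (hP : positive_stable P) (hQ : positive_stable Q)
  (hA : forall (i : 'I_r) (l : nat), tnth A i + l%:R%:M \in unitmx)
  (hB : forall (j : 'I_s) (l : nat), tnth B j + l%:R%:M \in unitmx)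
  (hx : 0 < x) :
  let outer_term (l : nat) : 'M[R[i]]_N.+1 :=
    (\prod_(M <- A) gammamx (M + l%:R%:M))
    * (\prod_(M <- B) rgammamx (M + l%:R%:M))
    * ((z ^+ l / l`!%:R) *:
         incexp x P (l%:R *: P + Q) (shiftmx l A) (shiftmx l B) y) in
  forall (hsum : incexp_cvg x P Q A B (y + z))
    (hinner : forall l : nat,
       incexp_cvg x P (l%:R *: P + Q) (shiftmx l A) (shiftmx l B) y)
    (houter : cvgn (series outer_term)),
  incexp x P Q A B (y + z) =
    (\prod_(M <- B) gammamx M) * (\prod_(M <- A) rgammamx M)
    * limn (series outer_term).
Proof.
move=> outer_term hsum hinner houter.
have PQ : P * Q = Q * P by apply: hcomm; rewrite !inE eqxx ?orbT.
have hAB : commuting (A ++ B).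
  by move=> M M' hM hM'; apply: hcomm; rewrite !in_cons ?hM ?hM' !orbT.
have uA : shifted_regular A by move=> M /tnthP[i ->] k; exact: hA.
have uB : shifted_regular B by move=> M /tnthP[i ->] k; exact: hB.
pose a := incexp_coef x P Q A B.
have hF : series (pseries_term a (y + z)) @ \oo --> incexp x P Q A B (y + z).
  by rewrite -(incexp_termE x P Q A B); exact: hsum.
have hT l : series (taylor_term a y l) @ \oo --> l`!%:R^-1 *: (pochmx_ratio A B l *
    incexp x P (l%:R *: P + Q) (shiftmx l A) (shiftmx l B) y).
  have := cvg_mxZ (c := l`!%:R^-1) (cvg_mxMl (X := pochmx_ratio A B l) (hinner l)).
  apply: cvg_trans; apply: near_eq_cvg; near=> n.
  rewrite /series /= mulr_sumr scaler_sumr; apply: eq_bigr => m _.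
  by rewrite -(taylor_termE x P Q y l m hAB uB).
pose pre : 'M[R[i]]_N.+1 := (\prod_(M <- B) gammamx M) * (\prod_(M <- A) rgammamx M).
have hG : series (pseries_term (taylor a y) z) @ \oo --> pre * limn (series outer_term).
  have := cvg_mxMl (X := pre) houter.
  apply: cvg_trans; apply: near_eq_cvg; near=> n.
  rewrite -series_mulmx /series /=; apply: eq_bigr => l _.
  rewrite /outer_term mulrA (gammamx_prefactor l hAB uA uB) /pseries_term /taylor.
  rewrite (cvg_mx_lim (hT l)) -scalerAr scalerA.
  exact: erefl.
have [y0|y0] := eqVneq y 0.
  move: hF hG; rewrite y0 add0r taylor_at0; exact: cvg_mx_unique.
have hcvg l : exists L : 'M[R[i]]_N.+1, series (taylor_term a y l) @ \oo --> L.
  by eexists; exact: hT.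
(* The norm is chosen only now: the limits in [hF] and [hG] do not depend on it. *)
have [v [h [q [h0 q01 vP]]]] := adapted_norm hP.
have [rho yr ha] := incexp_coef_radius PQ h0 q01 vP hx hAB uA uB y0 hcvg.
exact: taylor_sum ha yr hF hG.
Unshelve. all: by end_near.
Qed.
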